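(* Let $\Omega=(a,b)$ be a finite interval, $\alpha>0$ and $1\le p<\infty$, and fix a sign $\pm$. For each $\Omega'\subset\subset\Omega$ there exist a compact set $K\subset\Omega$ and a constant $C=C(\alpha,p,K)>0$ so that for every $u\in{}^{\pm}W^{\alpha,p}(\Omega)$ there exists a mapping $E:{}^{\pm}W^{\alpha,p}(\Omega)\to{}^{\pm}W^{\alpha,p}(\mathbb{R})$ so that (i) $Eu=u$ a.e. in $\Omega'$; (ii) $\operatorname{supp}(Eu)\subseteq K$; (iii) $\|Eu\|_{{}^{\pm}W^{\alpha,p}(\mathbb{R})}\le C\,\|u\|_{{}^{\pm}W^{\alpha,p}(\Omega)}$.
   Context: Let $\Omega$ be $(a,b)$ or $\mathbb{R}$; put $a^*=a,b^*=b$ in the first case and $a^*=-\infty,b^*=\infty$ in the second. For $\sigma>0$: ${}^{-}I^{\sigma}f(x)=\frac{1}{\Gamma(\sigma)}\int_{a^*}^x\frac{f(y)}{(x-y)^{1-\sigma}}\,dy$ and ${}^{+}I^{\sigma}f(x)=\frac{1}{\Gamma(\sigma)}\int_x^{b^*}\frac{f(y)}{(y-x)^{1-\sigma}}\,dy$. For $n-1<\alpha<n$ ($n\in\mathbb{N}$): ${}^{-}D^{\alpha}\varphi=\frac{d^n}{dx^n}\,{}^{-}I^{n-\alpha}\varphi$ and ${}^{+}D^{\alpha}\varphi=(-1)^n\frac{d^n}{dx^n}\,{}^{+}I^{n-\alpha}\varphi$; for integer $\alpha$, ${}^{\pm}D^{\alpha}$ is the ordinary derivative of order $\alpha$. Weak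 fractional derivatives: let $[\alpha]$ be the integer part of $\alpha$. For $u\in L^p(\Omega)$, $v\in L^1_{loc}(\Omega)$ is the left (resp. right) weak fractional derivative of $u$, written ${}^{-}\mathcal{D}^{\alpha}u=v$ (resp. ${}^{+}\mathcal{D}^{\alpha}u=v$), if $\int_\Omega v\varphi\,dx=(-1)^{[\alpha]}\int_\Omega u\,{}^{+}D^{\alpha}\varphi\,dx$ (resp. with ${}^{-}D^{\alpha}\varphi$ on the right-hand side) for all $\varphi\in C_0^\infty(\Omega)$. With $m=[\alpha]$, ${}^{\pm}W^{\alpha,p}(\Omega)=\{u\in W^{m,p}(\Omega):{}^{\pm}\mathcal{D}^{\alpha}u\in L^p(\Omega)\}$ with norm $\|u\|_{{}^{\pm}W^{\alpha,p}(\Omega)}=\big(\|u\|_{W^{m,p}(\Omega)}^p+\|{}^{\pm}\mathcal{D}^{\alpha}u\|_{L^p(\Omega)}^p\big)^{1/p}$ ($W^{0,p}=L^p$). $\Omega'\subset\subset\Omega$ means that the closure of $\Omega'$ is a compact subset of $\Omega$. *)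

(* Defs.v *)
From HB Require Import structures.
From mathcomp Require Import all_boot all_order all_algebra.
From mathcomp Require Import all_classical all_reals all_analysis.
Import Order.TTheory GRing.Theory Num.Theory.
Import numFieldNormedType.Exports.

Set Implicit Arguments.
Unset Strict Implicit.
Unset Printing Implicit Defensive.

Local Open Scope classical_set_scope.
Local Open Scope ring_scope.

(* [Left] is the superscript -, [Right] the superscript +. *)
Variant side := Left | Right.

Definition opposite (s : side) : side :=
  match s with Left => Right | Right => Left end.

Definition Gamma (R : realType) (z : R) : R :=
  \int[lebesgue_measure]_(t in `]0, +oo[) (t `^ (z - 1) * expR (- t)).

(* For x in Omega = ]a, b[ (resp. setT), the set Omega `&` `]-oo, x[ is
   ]a, x[ (resp. ]-oo, x[), and symmetrically on the right, so the endpoints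
   a*, b* need not be mentioned.  Values at x outside Omega are never used. *)
Definition fracI (R : realType) (s : side) (Omega : set R) (sigma : R)
    (f : R -> R) (x : R) : R :=
  match s with
  | Left => (Gamma sigma)^-1 *
      \int[lebesgue_measure]_(y in Omega `&` `]-oo, x[)
        (f y / (x - y) `^ (1 - sigma))
  | Right => (Gamma sigma)^-1 *
      \int[lebesgue_measure]_(y in Omega `&` `]x, +oo[)
        (f y / (y - x) `^ (1 - sigma))
  end.

(* For non-integer alpha > 0, the n with n - 1 < alpha < n is
   (Num.truncn alpha).+1. *)
Definition fracD (R : realType) (s : side) (Omega : set R) (alpha : R)
    (phi : R -> R) : R -> R :=
  if alpha \is a Num.nat then derive1n (Num.truncn alpha) phi
  else
    let n := (Num.truncn alpha).+1 in
    let D := derive1n n (fracI s Omega (n%:R - alpha) phi) in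
    match s with
    | Left => D
    | Right => fun x => (-1) ^+ n * D x
    end.

(* Functions on an open set Omega are represented by functions R -> R whose
   values outside Omega are irrelevant, except for test functions, which are
   extended by 0. *)
Definition test_fun (R : realType) (Omega : set R) (phi : R -> R) : Prop :=
  [/\ forall (n : nat) (x : R), derivable (derive1n n phi) x 1,
      compact (closure [set x | phi x != 0])
    & closure [set x | phi x != 0] `<=` Omega].

Definition in_Lp (R : realType) (Omega : set R) (p : R) (u : R -> R) : Prop :=
  u \_ Omega \in Lfun lebesgue_measure p%:E.

Definition Lp_norm (R : realType) (Omega : set R) (p : R) (u : R -> R) : R :=
  fine 'N[lebesgue_measure]_p%:E[EFin \o (u \_ Omega)].

Definition is_weakD (R : realType) (Omega : set R) (k : nat)
    (u v : R -> R) : Prop :=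
  locally_integrable Omega v /\
  forall phi, test_fun Omega phi ->
    \int[lebesgue_measure]_(x in Omega) (v x * phi x) =
    (-1) ^+ k * \int[lebesgue_measure]_(x in Omega) (u x * derive1n k phi x).

Definition is_weak_fracD (R : realType) (s : side) (Omega : set R) (alpha : R)
    (u v : R -> R) : Prop :=
  locally_integrable Omega v /\
  forall phi, test_fun Omega phi ->
    \int[lebesgue_measure]_(x in Omega) (v x * phi x) =
    (-1) ^+ Num.truncn alpha *
    \int[lebesgue_measure]_(x in Omega)
      (u x * fracD (opposite s) Omega alpha phi x).

(* Weak derivatives are unique up to a null set; these pick one, which is all
   that the norms below depend on. *)
Definition weakD (R : realType) (Omega : set R) (k : nat)
    (u : R -> R) : R -> R :=
  xget (cst 0) [set v | is_weakD Omega k u v].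

Definition weak_fracD (R : realType) (s : side) (Omega : set R) (alpha : R)
    (u : R -> R) : R -> R :=
  xget (cst 0) [set v | is_weak_fracD s Omega alpha u v].

Definition Sobolev (R : realType) (Omega : set R) (m : nat) (p : R) :
    set (R -> R) :=
  [set u | in_Lp Omega p u /\
    forall k, (k <= m)%N -> exists2 v, is_weakD Omega k u v & in_Lp Omega p v].

Definition Sobolev_norm (R : realType) (Omega : set R) (m : nat) (p : R)
    (u : R -> R) : R :=
  (\sum_(k < m.+1) Lp_norm Omega p (weakD Omega k u) `^ p) `^ p^-1.

Definition fracSobolev (R : realType) (s : side) (Omega : set R) (alpha p : R) :
    set (R -> R) :=
  [set u | Sobolev Omega (Num.truncn alpha) p u /\
    exists2 v, is_weak_fracD s Omega alpha u v & in_Lp Omega p v].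

Definition fracSobolev_norm (R : realType) (s : side) (Omega : set R)
    (alpha p : R) (u : R -> R) : R :=
  (Sobolev_norm Omega (Num.truncn alpha) p u `^ p +
   Lp_norm Omega p (weak_fracD s Omega alpha u) `^ p) `^ p^-1.

(* The support of a class of functions modulo null sets: the complement of the
   largest open set on which u vanishes almost everywhere. *)
Definition ess_support (R : realType) (u : R -> R) : set R :=
  ~` \bigcup_(U in [set U : set R |
      open U /\ u = cst 0 %[ae lebesgue_measure in U]]) U.

Definition compactly_contained (R : realType) (A Omega : set R) : Prop :=
  compact (closure A) /\ closure A `<=` Omega.

(* A map between function spaces that acts on classes modulo null sets. *)
Definition space_map (R : realType) (Omega Omega' : set R)
    (A B : set (R -> R)) (E : (R -> R) -> (R -> R)) : Prop :=
  (forall u, A u -> B (E u)) /\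
  (forall u v, A u -> A v -> u = v %[ae lebesgue_measure in Omega] ->
    E u = E v %[ae lebesgue_measure in Omega']).

(* Main.v *)
(** The extension is [E u = psi u], with [psi] a smooth cutoff supported well
    inside the interval.  For non-integer [alpha], with [m] its integer part and
    [beta = alpha - m], differentiation under the integral shows that on test functions
    [phi] the fractional derivative is a constant times the one-sided convolution of
    [t^-beta] with [phi^(m+1)].  Split [t^-beta = k0 + k1], where [k0] carries the
    singularity and is supported in [0, 2r], and [k1] is smooth with
    [k1^(m+1)] integrable.
    - The [k1] part is convolution of [phi] with [k1^(m+1)], hence its adjoint is
      bounded on [L^p] by Young's inequality.
    - In the [k0] part, [m] derivatives of [phi] are moved onto [psi u].  All
      terms of the Leibniz formula but [psi u^(m)] contain only [u^(j)], [j < m],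
      and allow one more integration by parts.  For [psi u^(m)], the commutator of
      multiplication by [psi] with [phi |-> k0 * phi'] has the kernel
      [k0'(t) (psi x - psi (x - t)) = O(t^-beta)], which is integrable; what
      remains is [u^(m)] tested against [k0 * (psi phi)'].  As [k0] has short
      range, [k0 * (psi phi)] is a test function on the interval, and this is the
      weak fractional derivative of [u] tested against [psi phi], up to a [k1] term.
    Since the norms are defined through chosen weak derivatives, the bounds on the
    functions so obtained are transferred by uniqueness of weak derivatives. *)
Require Import Defs.
From HB Require Import structures.
From mathcomp Require Import all_boot all_order all_algebra.
From mathcomp Require Import all_classical all_reals all_analysis.
From mathcomp Require Import measurable_realfun ring lra.
Import Order.TTheory GRing.Theory Num.Theory.
Import numFieldNormedType.Exports.

Set Implicit Arguments.
Unset Strict Implicit.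
Unset Printing Implicit Defensive.

Local Open Scope classical_set_scope.
Local Open Scope ring_scope.

(** * Smooth functions and cutoffs *)

Section smooth.
Context {R : realType}.
Implicit Types (f g : R -> R) (x c d : R).

(** The obstacle is non-locality. The weak fractional derivative of [u] is known only against test
    functions supported in the interval, whereas [psi u] is tested against functions supported
    anywhere on the line, and the kernel reaches arbitrarily far. So every pairing that uses the
    hypotheses on [u] must carry a factor psi, or come from psi phi through an operator of short
    range; the long range part has to be controlled by integrability alone. This is why m+1
    derivatives are moved to k1, which by itself decays too slowly to be integrable. The interval
    and the line can be compared because their fractional operators agree, with the same constant,
    on test functions vanishing outside the interval. Boundedness of the interval gives the
    inclusion of L^p in L^1, which supplies the integrability for Fubini. For integer alpha the
    Leibniz formula alone is enough. Finally, the constant may see the interval only through [K].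
    The compact set is therefore built so that it determines the interval and the cutoff, and the
    constant is chosen as a function of that set. *)

Definition smooth f := forall n x, derivable (derive1n n f) x 1.

Lemma derive1n_derive1 n f : derive1n n (derive1 f) = derive1n n.+1 f.
Proof. by rewrite /derive1n iterSr. Qed.

Lemma smooth_derive1 f : smooth f -> smooth (derive1 f).
Proof. by move=> sf n x; rewrite derive1n_derive1. Qed.

Lemma smooth_derive1n n f : smooth f -> smooth (derive1n n f).
Proof. by move=> sf; elim: n => [|n IH]; [|exact: smooth_derive1]. Qed.

Lemma smooth_is_derive f x : smooth f -> is_derive x 1 f (derive1 f x).
Proof. by move=> /(_ 0 x) sf; rewrite derive1E; exact: derivableP. Qed.

Lemma is_derive_fun f g : (forall x, is_derive x 1 f (g x)) -> derive1 f = g.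
Proof. by move=> fg; apply/funext => x; rewrite derive1E; exact: derive_val. Qed.

(** Coinduction in place of formulas for iterated derivatives: by induction on the order, they never
    leave the class [P]. *)
Lemma smooth_coind (P : (R -> R) -> Prop) :
  (forall f, P f -> exists2 g, P g & forall x, is_derive x 1 f (g x)) ->
  forall f, P f -> smooth f.
Proof.
move=> HP f Pf n x.
suff Pn : P (derive1n n f) by have [g _ /(_ x) fg] := HP _ Pn; exact: ex_derive.
elim: n => //= n IH; rewrite [derive1n _ _]/=.
by have [g Pg /is_derive_fun ->] := HP _ IH.
Qed.

(** The classical flat function exp(-1/x), with a factor x^-k that closes the family under
    differentiation up to linear combinations. *)
Definition flat (k : nat) x := if 0 < x then x^-1 ^+ k * expR (- x^-1) else 0.

Lemma flat_ge0 k x : 0 <= flat k x.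
Proof.
rewrite /flat; case: ifPn => // x0.
by rewrite mulr_ge0 ?exprn_ge0 ?expR_ge0// invr_ge0 ltW.
Qed.

(** With y = 1/x, one term of the exponential series gives y^(k+2) / (k+2)! <= exp y. A quadratic
    bound is what yields derivative 0 at the origin. *)
Lemma flat_le_sqr k x : flat k x <= (k.+2)`!%:R * x ^+ 2.
Proof.
rewrite /flat; case: ifPn => x0; last by rewrite mulr_ge0 ?sqr_ge0.
have y0 : 0 < x^-1 by rewrite invr_gt0.
have := expR_ge1Dxn k.+1 (ltW y0) => h.
have h2 : x^-1 ^+ k.+2 / (k.+2)`!%:R <= expR x^-1 by apply: le_trans h; rewrite lerDr.
move: h2; rewrite ler_pdivrMr ?ltr0n ?fact_gt0// => h2.
rewrite expRN ler_pdivrMr ?expR_gt0//.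
have -> : x ^+ 2 = (x^-1 ^+ 2)^-1 by rewrite exprVn invrK.
rewrite mulrAC ler_pdivlMr ?exprn_gt0// -exprD addn2.
by rewrite mulrC.
Qed.

Lemma is_derive0_sqr f (C : R) : 0 < C ->
  (forall x, `|f x| <= C * x ^+ 2) ->
  is_derive (0 : R) 1 f 0.
Proof.
move=> C0 fC.
have f0 : f 0 = 0.
  by apply/eqP; rewrite -normr_le0 (le_trans (fC 0))// expr0n/= mulr0.
have : h^-1 *: (f (h *: 1 + 0) - f 0) @[h --> 0^'] --> (0 : R).
  apply/cvgr0Pnorm_le => e e0; near=> h.
  have h0 : h != 0 by near: h; exact: nbhs_dnbhs_neq.
  rewrite f0 subr0 addr0 [X in f X]mulr1 normrZ normfV.
  rewrite ler_pdivrMl ?normr_gt0// (le_trans (fC h))//.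
  rewrite -real_normK ?num_real// expr2 mulrA [leRHS]mulrC ler_wpM2r//.
  rewrite -ler_pdivlMl//; near: h; apply: dnbhs0_le.
  by rewrite mulr_gt0 ?invr_gt0.
move=> df; apply: DeriveDef; first by apply/cvg_ex; exists 0.
exact/cvg_lim.
Unshelve. all: by end_near. Qed.

Lemma is_derive_mul f g x (a b : R) : is_derive x 1 f a -> is_derive x 1 g b ->
  is_derive x 1 (fun y => f y * g y) (a * g x + f x * b).
Proof.
move=> df dg; apply: is_derive_eq (is_deriveM df dg) _.
by rewrite addrC /GRing.scale /= [g x * a]mulrC.
Qed.

Lemma is_derive_comp f g x (a b : R) : is_derive (g x) 1 f a ->
  is_derive x 1 g b -> is_derive x 1 (fun y => f (g y)) (a * b).
Proof. by move=> df dg; exact: is_derive1_comp. Qed.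

Lemma flat_is_derive k x :
  is_derive x 1 (flat k) (- k%:R * flat k.+1 x + flat k.+2 x).
Proof.
have [x0|x0|<-] := ltgtP 0 x.
- pose g (y : R) := y^-1 ^+ k * expR (- y^-1).
  have fg : {near x, g =1 flat k}.
    by near=> y; rewrite /flat ifT//; near: y; exact: lt_nbhsr.
  apply: near_eq_is_derive fg _.
  rewrite /flat x0.
  have xn0 : x != 0 by rewrite gt_eqF.
  have dV : is_derive x 1 (fun y : R => y^-1) (- x^-1 ^+ 2).
    have := @is_deriveV _ id x 1 1 xn0 (is_derive_id _ _).
    by rewrite /GRing.scale/= mulr1 exprVn.
  have dX : is_derive x 1 (fun y : R => y^-1 ^+ k)
      (k%:R * x^-1 ^+ k.-1 * (- x^-1 ^+ 2)).
    apply: (@is_derive_comp (fun y => y ^+ k)) dV.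
    rewrite [X in is_derive _ _ X](_ : _ = (id : R -> R) ^+ k); last first.
      by rewrite exprfctE.
    apply: is_derive_eq (is_deriveX k (is_derive_id _ _)) _.
    by rewrite /GRing.scale/= mulr1.
  have dE : is_derive x 1 (fun y : R => expR (- y^-1))
      (expR (- x^-1) * (- - x^-1 ^+ 2)).
    by apply: is_derive_comp; exact: is_deriveN.
  apply: is_derive_eq (is_derive_mul dX dE) _.
  rewrite opprK; case: k {dX g} => [|k] /=; first by ring.
  by rewrite !exprS; ring.
- have fg : {near x, cst 0 =1 flat k}.
    near=> y; rewrite /flat ifF//; apply/negbTE; rewrite -leNgt ltW//.
    by near: y; exact: lt_nbhsl.
  apply: near_eq_is_derive fg _.
  by rewrite /flat ltNge ltW//= mulr0 addr0; exact: is_derive_cst.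
(* At the origin [flat] is given by no single formula on a neighbourhood; the quadratic bound gives
   derivative 0. *)
- rewrite /flat ltxx mulr0 addr0.
  apply: (@is_derive0_sqr _ (k.+2)`!%:R) => [|y]; first by rewrite ltr0n fact_gt0.
  by rewrite ger0_norm ?flat_ge0// flat_le_sqr.
Unshelve. all: by end_near. Qed.

(* Derivatives of these terms are again such terms: this is what makes them
   smooth.  [flat k] has derivative [- k flat (k+1) + flat (k+2)]. *)
Inductive smooth_term : (R -> R) -> Prop :=
| ST_smooth f : smooth f -> smooth_term f
| ST_cst c : smooth_term (fun=> c)
| ST_affine c d f : smooth_term f -> smooth_term (fun x => f (c * x + d))
| ST_flat k : smooth_term (flat k)
| ST_add f g : smooth_term f -> smooth_term g -> smooth_term (fun x => f x + g x)
| ST_mul f g : smooth_term f -> smooth_term g -> smooth_term (fun x => f x * g x)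
| ST_pow r f : smooth_term f -> (forall x, 0 < f x) ->
    smooth_term (fun x => f x `^ r).

Lemma smooth_term_smooth f : smooth_term f -> smooth f.
Proof.
apply: smooth_coind => {}f.
elim => [{}f sf|c|c d {}f _ [g tg dg]|k|{}f f' tf [g tg dg] tf' [g' tg' dg']|
         {}f f' tf [g tg dg] tf' [g' tg' dg']|r {}f tf [g tg dg] f0].
- exists (derive1 f); first exact/ST_smooth/smooth_derive1.
  by move=> x; exact: smooth_is_derive.
- by exists (fun=> 0) => [|x]; [exact: ST_cst|exact: is_derive_cst].
- exists (fun x => g (c * x + d) * c).
    by apply: ST_mul (ST_cst _); exact: ST_affine.
  move=> x; apply: (@is_derive_comp f (fun x => c * x + d)) => //.
  apply: is_derive_eq (is_deriveD (is_deriveZ c (is_derive_id _ _))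
    (is_derive_cst d x 1)) _.
  by rewrite /GRing.scale/= mulr1 addr0.
- exists (fun x => - k%:R * flat k.+1 x + flat k.+2 x).
    by apply: ST_add (ST_flat _); apply: ST_mul (ST_cst _) (ST_flat _).
  exact: flat_is_derive.
- exists (fun x => g x + g' x); first exact: ST_add.
  by move=> x; exact: is_deriveD.
- exists (fun x => g x * f' x + f x * g' x).
    by apply: ST_add; exact: ST_mul.
  by move=> x; exact: is_derive_mul.
- exists (fun x => r * f x `^ (r - 1) * g x).
    by apply: ST_mul tg; apply: ST_mul (ST_cst _) (ST_pow _ tf f0).
  by move=> x; apply: (@is_derive_comp (fun y => y `^ r) f) => //; exact: is_derive1_powR.
Qed.

Lemma smooth_cst c : smooth (fun=> c).
Proof. exact/smooth_term_smooth/ST_cst. Qed.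

Lemma smooth_affine c d f : smooth f -> smooth (fun x => f (c * x + d)).
Proof. by move=> sf; apply/smooth_term_smooth/ST_affine/ST_smooth. Qed.

Lemma smoothD f g : smooth f -> smooth g -> smooth (fun x => f x + g x).
Proof. by move=> sf sg; apply/smooth_term_smooth/ST_add; exact: ST_smooth. Qed.

Lemma smoothM f g : smooth f -> smooth g -> smooth (fun x => f x * g x).
Proof. by move=> sf sg; apply/smooth_term_smooth/ST_mul; exact: ST_smooth. Qed.

Lemma smooth_powR r f : smooth f -> (forall x, 0 < f x) ->
  smooth (fun x => f x `^ r).
Proof. by move=> sf f0; apply/smooth_term_smooth/ST_pow => //; exact: ST_smooth. Qed.

Lemma smooth_id : smooth (fun x => x).
Proof.
apply: (@smooth_coind (fun f => f = (fun x => x) \/ exists c, f = fun=> c)); last by left.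
move=> f [->|[c ->]]; last first.
  by exists (fun=> 0) => [|x]; [right; exists 0|exact: is_derive_cst].
by exists (fun=> 1) => [|x]; [right; exists 1|exact: is_derive_id].
Qed.

Lemma smooth_continuous f : smooth f -> continuous f.
Proof.
by move=> sf x; apply/differentiable_continuous/derivable1_diffP; exact: (sf 0).
Qed.

(** The standard smooth transition from 0 to 1 across [0, 1]; the two summands of the denominator
    never vanish together. *)
Definition step x := flat 0 x / (flat 0 x + flat 0 (1 - x)).

Lemma flat0_gt0 x : 0 < x -> 0 < flat 0 x.
Proof. by move=> x0; rewrite /flat x0 expr0 mul1r expR_gt0. Qed.

Lemma flat_eq0 k x : x <= 0 -> flat k x = 0.
Proof. by move=> x0; rewrite /flat ltNge x0. Qed.

Lemma step_den_gt0 x : 0 < flat 0 x + flat 0 (1 - x).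
Proof.
have [x0|x0] := ltP 0 x; first by rewrite ltr_wpDr ?flat_ge0 ?flat0_gt0.
by rewrite ltr_wpDl ?flat_ge0// flat0_gt0//; lra.
Qed.

Lemma smooth_step : smooth step.
Proof.
(* The quotient becomes a product with a power of exponent -1, so that positivity of the denominator
   is all that remains to check. *)
have -> : step =
    (fun x => flat 0 x * (flat 0 x + flat 0 (-1 * x + 1)) `^ (-1)).
  apply/funext => x; rewrite powR_inv1; last first.
    by rewrite addr_ge0 ?flat_ge0.
  by rewrite mulN1r [- x + 1]addrC.
apply: smoothM; first exact/smooth_term_smooth/ST_flat.
apply: smooth_powR.
  apply: smoothD; first exact/smooth_term_smooth/ST_flat.
  by apply: smooth_affine; exact/smooth_term_smooth/ST_flat.
by move=> x; rewrite mulN1r [- x + 1]addrC step_den_gt0.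
Qed.

Lemma step_le0 x : x <= 0 -> step x = 0.
Proof. by move=> x0; rewrite /step flat_eq0// mul0r. Qed.

Lemma step_ge1 x : 1 <= x -> step x = 1.
Proof.
move=> x1; have := step_den_gt0 x; rewrite /step (@flat_eq0 0 (1 - x)) ?addr0.
  by move=> d0; rewrite divff// gt_eqF.
by rewrite subr_le0.
Qed.

Lemma step_ge0 x : 0 <= step x.
Proof. by rewrite divr_ge0 ?flat_ge0// ltW// step_den_gt0. Qed.

Lemma step_le1 x : step x <= 1.
Proof. by rewrite ler_pdivrMr ?step_den_gt0// mul1r lerDl flat_ge0. Qed.

(** A smooth approximation from below of the indicator of ]c, d[, where [e] is the width of the two
    transition layers. *)
Definition bump (e c d : R) x := step (e^-1 * (x - c)) * step (e^-1 * (d - x)).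

Lemma smooth_bump (e c d : R) : smooth (bump e c d).
Proof.
have -> : bump e c d = fun x =>
    step (e^-1 * x + - (e^-1 * c)) * step (- e^-1 * x + e^-1 * d).
  by apply/funext => x; rewrite /bump; congr (step _ * step _); ring.
by apply: smoothM; apply: smooth_affine; exact: smooth_step.
Qed.

Lemma bump_ge0 (e c d x : R) : 0 <= bump e c d x.
Proof. by rewrite mulr_ge0 ?step_ge0. Qed.

Lemma bump_le1 (e c d x : R) : bump e c d x <= 1.
Proof. by rewrite mulr_ile1 ?step_ge0 ?step_le1. Qed.

Lemma bump_eq0 (e c d x : R) : 0 < e -> x \notin `]c, d[ -> bump e c d x = 0.
Proof.
move=> e0; rewrite in_itv/= negb_and -!leNgt => /orP[xc|dx]; rewrite /bump.
  by rewrite step_le0 ?mul0r// pmulr_rle0 ?invr_gt0// subr_le0.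
by rewrite mulrC step_le0 ?mul0r// pmulr_rle0 ?invr_gt0// subr_le0.
Qed.

Lemma bump_eq1 (e c d x : R) : 0 < e -> x \in `[c + e, d - e] ->
  bump e c d x = 1.
Proof.
move=> e0; rewrite in_itv/= => /andP[cx xd].
by rewrite /bump !step_ge1 ?mul1r// ler_pdivlMl// mulr1; lra.
Qed.

End smooth.

(** * Integration on the line *)

Section integration.
Context {R : realType}.
Local Notation mu := (@lebesgue_measure R).
Implicit Types (f g h : R -> R).

Lemma ae_imp (P Q : R -> Prop) : {ae mu, forall x, P x} ->
  (forall x, P x -> Q x) -> {ae mu, forall x, Q x}.
Proof.
by move=> /[swap] PQ; apply: filterS; [exact: (ae_filter_ringOfSetsType mu)|].
Qed.

Definition L1 f := mu.-integrable setT (EFin \o f).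

Lemma L1_meas f : L1 f -> measurable_fun setT f.
Proof. by move=> /measurable_int /measurable_EFinP. Qed.

Lemma L1D f g : L1 f -> L1 g -> L1 (fun x => f x + g x).
Proof. by move=> If Ig; exact: (integrableD measurableT If Ig). Qed.

Lemma L1Z c f : L1 f -> L1 (fun x => c * f x).
Proof. by move=> If; exact: (integrableZl measurableT c If). Qed.

Lemma L1_le f g : measurable_fun setT f -> (forall x, `|f x| <= `|g x|) ->
  L1 g -> L1 f.
Proof.
move=> mf fg; apply: le_integrable => //; first exact/measurable_EFinP.
by move=> x _; rewrite lee_fin.
Qed.

Lemma L1_norm f : L1 f -> L1 (fun x => `|f x|).
Proof. by move=> If; exact: (integrable_norm If). Qed.

Definition bmeas f := measurable_fun setT f /\ exists M, forall x, `|f x| <= M.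

Lemma L1Ml f g : L1 f -> bmeas g -> L1 (fun x => f x * g x).
Proof.
move=> If [mg [M gM]]; apply: (integrableMl measurableT If mg).
exists M; split; first exact: num_real.
by move=> x Mx y _; exact: le_trans (gM _) (ltW Mx).
Qed.

Lemma Rint_add f g : L1 f -> L1 g ->
  \int[mu]_x (f x + g x) = \int[mu]_x f x + \int[mu]_x g x.
Proof. by move=> If Ig; rewrite RintegralD. Qed.

Lemma Rint_scale c f : L1 f -> \int[mu]_x (c * f x) = c * \int[mu]_x f x.
Proof. by move=> If; rewrite RintegralZl. Qed.

Lemma ae_eq_Rint f g : measurable_fun setT f -> measurable_fun setT g ->
  {ae mu, forall x, f x = g x} -> \int[mu]_x f x = \int[mu]_x g x.
Proof.
move=> mf mg fg; rewrite /Rintegral; congr fine; apply: ae_eq_integral => //.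
- exact/measurable_EFinP.
- exact/measurable_EFinP.
- by apply: (ae_imp fg) => x /= ->.
Qed.

Definition aff (c d : R) (x : R) : R := c * x + d.

Lemma measurable_aff c d : measurable_fun setT (aff c d).
Proof.
exact: (measurable_funD (mulrl_measurable c) (measurable_cst d)).
Qed.

(** Translation invariance follows from the uniqueness of Lebesgue measure, since the pushforward
    agrees with it on half-open intervals. *)
Lemma pushforward_shift (d : R) (A : set R) : measurable A ->
  pushforward mu (aff 1 d : measurableTypeR R -> measurableTypeR R) A = mu A.
Proof.
move=> mA; apply/esym.
apply: lebesgue_measure_unique => //; first exact: measurable_aff.
move=> ? _ [[a b]] _ <-.
transitivity (mu `]a - d, b - d]).
  rewrite !lebesgue_measure_itv/= !lte_fin ltrD2r -!EFinD.
  by rewrite opprD opprK addrACA addNr addr0.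
rewrite /pushforward; congr (mu _).
by apply/seteqP; split => x /=; rewrite /aff mul1r !in_itv/= ltrBlDr lerBrDr.
Qed.

Lemma ge0_integral_shift (d : R) (f : R -> \bar R) : measurable_fun setT f ->
  (forall x, 0 <= f x)%E -> (\int[mu]_x f (x + d)%R = \int[mu]_x f x)%E.
Proof.
move=> mf f0.
transitivity (\int[pushforward mu
  (aff 1 d : measurableTypeR R -> measurableTypeR R)]_x f x)%E.
  rewrite ge0_integral_pushforward//; last exact: measurable_aff.
  by rewrite preimage_setT; apply: eq_integral => x _; rewrite /= /aff mul1r.
apply: eq_measure_integral => [|? A mA _]; first exact: measurable_aff.
exact: pushforward_shift.
Qed.

Lemma ge0_integral_opp (f : R -> \bar R) : measurable_fun setT f ->
  (forall x, 0 <= f x)%E -> (\int[mu]_x f (- x)%R = \int[mu]_x f x)%E.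
Proof.
move=> mf f0; transitivity (\int[pushforward mu (-%R : _ -> measurableTypeR R)]_x f x)%E.
  by rewrite ge0_integral_pushforward//= preimage_setT.
by apply: eq_measure_integral => A mA _; exact: lebesgue_measureN.
Qed.

(** With |e| = 1 no Jacobian appears. Positive and negative parts are transported separately, so
    that measurability of [f] suffices. *)
Lemma Rint_aff e d f : (e = 1 \/ e = -1) -> measurable_fun setT f ->
  \int[mu]_x f (e * x + d) = \int[mu]_x f x.
Proof.
move=> e1 mf.
have H (F : R -> \bar R) : measurable_fun setT F -> (forall x, 0 <= F x)%E ->
    (\int[mu]_x F (e * x + d)%R = \int[mu]_x F x)%E.
  move=> mF F0; case: e1 => ->.
    by under eq_integral do rewrite mul1r; exact: ge0_integral_shift.
  rewrite -[RHS](ge0_integral_shift d)//.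
  rewrite -[RHS]ge0_integral_opp//; last first.
    apply: (measurableT_comp mF).
    by apply: measurable_funD => //.
  by under eq_integral do rewrite mulN1r.
rewrite /Rintegral; congr fine; rewrite integralE [RHS]integralE; congr (_ - _)%E.
  rewrite -(H ((EFin \o f)^\+)%E)//; first
    by congr (integral _ _ _); apply: funext => x; rewrite !(funeposE,funenegE).
  exact/measurable_funepos/measurable_EFinP.
rewrite -(H ((EFin \o f)^\-)%E)//; first
  by congr (integral _ _ _); apply: funext => x; rewrite !(funeposE,funenegE).
exact/measurable_funeneg/measurable_EFinP.
Qed.

Lemma Rfubini (f : R * R -> R) : measurable_fun setT f ->
  (\int[mu]_x \int[mu]_y `|(f (x, y))%:E| < +oo)%E ->
  [/\ L1 (fun x => \int[mu]_y f (x, y)),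
      {ae mu, forall x, L1 (fun y => f (x, y))} &
   \int[mu]_x \int[mu]_y f (x, y) = \int[mu]_y \int[mu]_x f (x, y)].
Proof.
move=> mf foo.
have mEf : measurable_fun setT (EFin \o f) by exact/measurable_EFinP.
have If : (mu \x mu)%E.-integrable setT (EFin \o f) by apply/integrable12ltyP.
have IF := integrable_fubini_F If.
have IG := measurable_fubini_G If.
(* On a null set the inner extended integral may fail to be finite, and [fine] then returns a
   default value; the two inner integrals are compared only almost everywhere. *)
have fin1 : {ae mu, forall x, fubini_F mu (EFin \o f) x = (\int[mu]_y f (x, y))%:E}.
  apply: (ae_imp (ae_integrable1 If)) => x Ix.
  by rewrite /fubini_F /Rintegral fineK//; exact: integrable_fin_num.
have fin2 : {ae mu, forall y, fubini_G mu (EFin \o f) y = (\int[mu]_x f (x, y))%:E}.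
  apply: (ae_imp (ae_integrable2 If)) => x Ix.
  by rewrite /fubini_G /Rintegral fineK//; exact: integrable_fin_num.
have mF : measurable_fun setT (fun x => \int[mu]_y f (x, y)).
  rewrite -[X in measurable_fun _ X]/(fine \o fubini_F mu (EFin \o f)).
  by apply: measurableT_comp; [exact: fine_measurable|exact: measurable_int IF].
have mG : measurable_fun setT (fun y => \int[mu]_x f (x, y)).
  rewrite -[X in measurable_fun _ X]/(fine \o fubini_G mu (EFin \o f)).
  by apply: measurableT_comp; [exact: fine_measurable|exact: IG].
split.
- apply/integrableP; split; first exact/measurable_EFinP.
  case/integrableP: IF => mF' /le_lt_trans; apply.
  rewrite le_eqVlt; apply/orP; left; apply/eqP.
  apply: ae_eq_integral => //.
  + by apply: measurableT_comp => //; exact/measurable_EFinP.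
  + exact: measurableT_comp.
  + by apply: (ae_imp fin1) => x; rewrite /fubini_F /fubini_G /= => ->.
- exact: ae_integrable1 If.
- transitivity (fine (\int[mu]_x fubini_F mu (EFin \o f) x)%E).
    rewrite [LHS]/Rintegral; congr fine; apply: ae_eq_integral => //.
    + exact/measurable_EFinP.
    + exact: measurable_int IF.
    + by apply: (ae_imp fin1) => x; rewrite /fubini_F /fubini_G /= => ->.
  transitivity (fine (\int[mu]_y fubini_G mu (EFin \o f) y)%E).
    by congr fine; exact: (Fubini If).
  rewrite [RHS]/Rintegral; congr fine; apply: ae_eq_integral => //.
  + exact/measurable_EFinP.
  + by apply: (ae_imp fin2) => x; rewrite /fubini_F /fubini_G /= => ->.
Qed.

End integration.

(** * Weighted convolutions on L^p, and their adjoints *)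

Section weighted_convolution.
Context {R : realType}.
Local Notation mu := (@lebesgue_measure R).
Implicit Types (f g H : R -> R).

(** Jensen's inequality for the measure H dt. It is Hölder's inequality after writing H = H^(1/p)
    H^(1/q) and giving the first factor to [a]; for p = 1, where q would be infinite, both sides are
    equal. *)
Lemma jensen_weight p (a H : R -> R) : 1 <= p ->
  measurable_fun setT a -> measurable_fun setT H ->
  (forall t, 0 <= a t) -> (forall t, 0 <= H t) ->
  ((\int[mu]_t (a t * H t)%:E) `^ p <=
   (\int[mu]_t (H t)%:E) `^ (p - 1) * \int[mu]_t (a t `^ p * H t)%:E)%E.
Proof.
rewrite le_eqVlt => /predU1P[<- ma mH a0 H0|p1 ma mH a0 H0].
  rewrite subrr poweRe0 mul1e poweRe1; last first.
    by apply: integral_ge0 => t _; rewrite lee_fin mulr_ge0.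
  by under [leRHS]eq_integral do rewrite powRr1//.
have p0 : 0 < p by rewrite (lt_trans _ p1).
have pN0 : p != 0 by rewrite gt_eqF.
have p10 : p - 1 != 0 by rewrite subr_eq0 gt_eqF.
pose q := p / (p - 1).
have q0 : 0 < q by rewrite divr_gt0// subr_gt0.
have pq : p^-1 + q^-1 = 1 by rewrite /q; field; rewrite pN0 p10.
have mpow r : measurable_fun setT (fun t => H t `^ r).
  exact: (measurableT_comp (measurable_powR r)).
have HH t : H t `^ p^-1 * H t `^ q^-1 = H t.
  rewrite -powRD ?pq ?powRr1//.
  by apply/implyP; rewrite oner_eq0.
have := hoelder mu (f := fun t => a t * H t `^ p^-1) (g := fun t => H t `^ q^-1)
  (measurable_funM ma (mpow _)) (mpow _) p0 q0 pq.
rewrite Lnorm1.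
have -> : (\int[mu]_x `|(EFin \o ((fun t => a t * H t `^ p^-1) \* (fun t => H t `^ q^-1))%R) x|
    = \int[mu]_t (a t * H t)%:E)%E.
  apply: eq_integral => t _ /=; rewrite -mulrA HH.
  by rewrite ger0_norm// mulr_ge0.
move=> /(gt0_ler_poweR (ltW p0)) => hold.
have {hold} := hold _ _.
rewrite !in_itv/= !leey !andbT => hold.
apply: le_trans (hold _ _) _.
- by apply: integral_ge0 => t _; rewrite lee_fin mulr_ge0.
- by rewrite mule_ge0 ?Lnorm_ge0.
rewrite poweRM ?Lnorm_ge0// powR_Lnorm// muleC unlock /Lnorm.
rewrite -poweRrM.
have -> : q^-1 * p = p - 1 by rewrite /q; field; rewrite pN0 p10.
rewrite le_eqVlt; apply/orP; left; apply/eqP; congr (_ `^ _ * _)%E.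
- apply: eq_integral => t _ /=.
  by rewrite ger0_norm ?powR_ge0// -powRrM mulVf ?gt_eqF// powRr1.
- apply: eq_integral => t _ /=.
  rewrite ger0_norm ?mulr_ge0 ?powR_ge0//.
  by rewrite powRM ?powR_ge0// -powRrM mulVf// powRr1.
Qed.

(** A real bound on the extended norm contains membership in L^p and a norm estimate at once. *)
Definition LpB p f (c : R) :=
  measurable_fun setT f /\ ('N[mu]_p%:E[EFin \o f] <= c%:E)%E.

Lemma LpB_int p f c : 1 <= p -> 0 <= c -> measurable_fun setT f ->
  LpB p f c <-> (\int[mu]_x (`|f x| `^ p)%:E <= (c `^ p)%:E)%E.
Proof.
move=> p1 c0 mf; have p0 : 0 < p by rewrite (lt_le_trans _ p1).
have fE : ('N[mu]_p%:E[EFin \o f] `^ p = \int[mu]_x (`|f x| `^ p)%:E)%E.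
  by rewrite powR_Lnorm ?gt_eqF.
rewrite -fE -poweR_EFin; split => [[_ fc]|fc].
  apply: gt0_ler_poweR (fc); rewrite ?ltW// in_itv/= leey ?Lnorm_ge0//.
  by rewrite lee_fin c0.
split => //.
have pV0 : 0 <= p^-1 by rewrite invr_ge0 ltW.
have := gt0_ler_poweR pV0 _ _ fc.
rewrite -!poweRrM mulfV ?gt_eqF// !poweRe1 ?Lnorm_ge0 ?lee_fin//.
by apply; rewrite in_itv/= leey andbT ?poweR_ge0 ?lee_fin ?powR_ge0.
Qed.

Lemma LpB_finite p f c : LpB p f c -> f \in Lfun mu p%:E.
Proof.
move=> [mf fc]; rewrite inE; apply/andP; split; rewrite inE//=.
by rewrite /finite_norm (le_lt_trans fc)// ltry.
Qed.

Lemma LpB_fine p f c : LpB p f c -> fine 'N[mu]_p%:E[EFin \o f] <= c.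
Proof.
move=> fB; have [_ fc] := fB; have := LpB_finite fB.
rewrite inE => /andP[_]; rewrite inE /= /finite_norm => foo.
by rewrite -lee_fin fineK// ge0_fin_numE// Lnorm_ge0.
Qed.

Lemma Lfun_LpB p f : f \in Lfun mu p%:E -> LpB p f (fine 'N[mu]_p%:E[EFin \o f]).
Proof.
rewrite inE => /andP[]; rewrite !inE /= /finite_norm => mf foo; split => //.
by rewrite fineK// ge0_fin_numE// Lnorm_ge0.
Qed.

Lemma LpBD p f g c d : 1 <= p -> LpB p f c -> LpB p g d ->
  LpB p (fun x => f x + g x) (c + d).
Proof.
move=> p1 [mf fc] [mg gd]; split; first exact: measurable_funD.
by rewrite EFinD; apply: le_trans (minkowski_EFin mu mf mg p1) _; exact: leeD.
Qed.

Lemma LpB_le p f g c : 1 <= p -> measurable_fun setT f ->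
  (forall x, `|f x| <= `|g x|) -> LpB p g c -> LpB p f c.
Proof.
move=> p1 mf fg [mg gc]; split => //.
have p0 : 0 < p by rewrite (lt_le_trans _ p1).
have pV0 : 0 <= p^-1 by rewrite invr_ge0 ltW.
have E h : ('N[mu]_p%:E[EFin \o h] = (\int[mu]_x (`|h x| `^ p)%:E) `^ p^-1)%E.
  by rewrite unlock.
apply: le_trans gc; rewrite !E; apply: (gt0_ler_poweR pV0).
- by rewrite in_itv/= leey andbT; apply: integral_ge0 => x _; rewrite lee_fin powR_ge0.
- by rewrite in_itv/= leey andbT; apply: integral_ge0 => x _; rewrite lee_fin powR_ge0.
apply: ge0_le_integral => //.
- by apply/measurable_EFinP/(measurableT_comp (measurable_powR p))/measurableT_comp.
- by apply/measurable_EFinP/(measurableT_comp (measurable_powR p))/measurableT_comp.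
- by move=> x _ /=; rewrite lee_fin; apply: ge0_ler_powR; rewrite ?nnegrE// ltW.
Qed.

Lemma LpB_leconst p f c d : c <= d -> LpB p f c -> LpB p f d.
Proof. by move=> cd [mf fc]; split => //; rewrite (le_trans fc). Qed.

Lemma LpBM p f g c M : 1 <= p -> 0 <= c -> measurable_fun setT g ->
  (forall x, `|g x| <= M) -> LpB p f c -> LpB p (fun x => g x * f x) (M * c).
Proof.
move=> p1 c0 mg gM fc; have [mf _] := fc.
have M0 : 0 <= M := le_trans (normr_ge0 _) (gM 0).
have p0 : 0 < p by rewrite (lt_le_trans _ p1).
apply: (@LpB_le _ _ (fun x => M * f x)) => //.
- exact: measurable_funM.
- by move=> x; rewrite !normrM ler_wpM2r// (le_trans (gM x))// ler_norm.
apply/LpB_int => //.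
- by rewrite mulr_ge0.
- exact: measurable_funM.
move/LpB_int : fc => /(_ p1 c0 mf) fc.
under eq_integral do rewrite normrM powRM// EFinM.
rewrite ge0_integralZl_EFin ?powR_ge0//.
- by rewrite powRM// EFinM (ger0_norm M0) lee_pmul// ?lee_fin ?powR_ge0//;
    apply: integral_ge0 => x _; rewrite lee_fin powR_ge0.
- by apply/measurable_EFinP/(measurableT_comp (measurable_powR p))/measurableT_comp.
Qed.

Lemma measurable_shear (e : R) : measurable_fun setT (fun z : R * R => z.1 + e * z.2).
Proof.
by apply: measurable_funD => //; exact: (measurable_funM (measurable_cst e)).
Qed.

End weighted_convolution.

Section adjoint.
Context {R : realType}.
Local Notation mu := (@lebesgue_measure R).
Implicit Types (f g H phi : R -> R) (N : R -> R -> R).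

(** After Tonelli the inner integral runs over [y] with [t] fixed, and translation invariance
    removes the shift e t. *)
Lemma tonelli_shear (e : R) (a H : R -> R) :
  measurable_fun setT a -> measurable_fun setT H ->
  (forall x, 0 <= a x) -> (forall t, 0 <= H t) ->
  (\int[mu]_y \int[mu]_t (a (y + e * t)%R * H t)%:E =
   (\int[mu]_x (a x)%:E) * \int[mu]_t (H t)%:E)%E.
Proof.
move=> ma mH a0 H0.
pose F (z : R * R) := (a (z.1 + e * z.2) * H z.2)%:E.
have mF : measurable_fun setT F.
  apply/measurable_EFinP; apply: measurable_funM.
    exact: (measurableT_comp ma (measurable_shear e)).
  exact: (measurableT_comp mH).
have F0 z : (0 <= F z)%E by rewrite lee_fin mulr_ge0.
transitivity (\int[mu]_t \int[mu]_y F (y, t))%E.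
  exact: (@fubini_tonelli _ _ _ _ R mu mu F mF F0).
have inner t : (\int[mu]_x (a (x + e * t)%R * H t)%:E =
    (\int[mu]_x (a x)%:E) * (H t)%:E)%E.
  under eq_integral do rewrite EFinM.
  rewrite ge0_integralZr ?lee_fin//.
  - rewrite (ge0_integral_shift (e * t) (f := EFin \o a))//.
    exact/measurable_EFinP.
  - apply/measurable_EFinP/(measurableT_comp ma).
    by apply: measurable_funD.
  - by move=> x _; rewrite lee_fin.
transitivity (\int[mu]_t ((\int[mu]_x (a x)%:E) * (H t)%:E))%E.
  by apply: eq_integral => t _; rewrite -inner.
rewrite ge0_integralZl//.
- exact/measurable_EFinP.
- by move=> t _; rewrite lee_fin.
- by apply: integral_ge0 => x _; rewrite lee_fin.
Qed.

Lemma measurable_integral2 (F : R * R -> \bar R) :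
  measurable_fun setT F -> (forall z, 0 <= F z)%E ->
  measurable_fun setT (fun x => \int[mu]_y F (x, y))%E.
Proof.
by move=> mF F0; exact: (@measurable_fun_fubini_tonelli_F _ _ _ _ R mu F mF F0).
Qed.

(* The adjoint of [phi |-> \int N x t * phi (x - e t) dt]; the sign [e = 1] or [-1]
   distinguishes the left and the right fractional operators. *)
Definition wconv (e : R) N g y := \int[mu]_t (g (y + e * t) * N (y + e * t) t).

Section wconv.
Variables (e : R) (N : R -> R -> R) (H : R -> R).
Hypothesis mN : measurable_fun setT (fun z : R * R => N z.1 z.2).
Hypothesis NH : forall x t, `|N x t| <= H t.
Hypothesis IH : L1 H.

Let H0 t : 0 <= H t. Proof. exact: le_trans (NH 0 t). Qed.

Let mH : measurable_fun setT H. Proof. exact: L1_meas. Qed.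

Let msheared g : measurable_fun setT g ->
  measurable_fun setT (fun z : R * R => g (z.1 + e * z.2) * N (z.1 + e * z.2) z.2).
Proof.
move=> mg; apply: measurable_funM.
  exact: (measurableT_comp mg (measurable_shear e)).
have m2 : measurable_fun setT (fun z : R * R => (z.1 + e * z.2, z.2)).
  by apply: measurable_fun_pair; [exact: measurable_shear|exact: measurable_snd].
exact: (measurableT_comp mN m2).
Qed.

Let sheared_le g y : measurable_fun setT g ->
  (\int[mu]_t `|(g (y + e * t)%R * N (y + e * t)%R t)%:E| <=
   \int[mu]_t (`|g (y + e * t)%R| * H t)%:E)%E.
Proof.
move=> mg; apply: ge0_le_integral => //.
- apply: measurableT_comp => //; apply/measurable_EFinP.
  exact: (measurableT_comp (msheared mg) (measurable_pair1 y)).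
- apply/measurable_EFinP; apply: measurable_funM => //.
  apply: measurableT_comp => //; apply: (measurableT_comp mg).
  exact: (measurableT_comp (measurable_shear e) (measurable_pair1 y)).
- by move=> t _; rewrite /= lee_fin normrM ler_wpM2l.
Qed.

Let mabs g : measurable_fun setT g ->
  measurable_fun setT (fun x : R => (\int[mu]_t (`|g (x + e * t)%R| * H t)%:E)%E).
Proof.
move=> mg.
apply: (measurable_integral2 (F :=
  fun z => (`|g (z.1 + e * z.2)%R| * H z.2)%:E)).
  apply/measurable_EFinP; apply: measurable_funM.
    by apply: measurableT_comp => //; exact: (measurableT_comp mg (measurable_shear e)).
  exact: (measurableT_comp mH).
by move=> z; rewrite lee_fin mulr_ge0.
Qed.

Lemma sheared_lty g : L1 g ->
  (\int[mu]_y \int[mu]_t `|(g (y + e * t)%R * N (y + e * t)%R t)%:E| < +oo)%E.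
Proof.
move=> Ig; have mg := L1_meas Ig.
apply: (@le_lt_trans _ _
   (\int[mu]_y \int[mu]_t (`|g (y + e * t)%R| * H t)%:E)%E).
  apply: ge0_le_integral => //.
  - by move=> y _; apply: integral_ge0.
  - apply: (measurable_integral2 (F :=
      (fun z => `|(g (z.1 + e * z.2)%R * N (z.1 + e * z.2)%R z.2)%:E|)%E)) => //.
    by apply: measurableT_comp => //; apply/measurable_EFinP; exact: msheared.
  - exact: mabs.
  - by move=> y _; exact: sheared_le.
rewrite (tonelli_shear e (a := fun x => `|g x|))//; last exact: measurableT_comp.
rewrite lte_mul_pinfty//.
- by apply: integral_ge0.
- have := L1_norm Ig; move=> /integrable_fin_num; apply => //.
- exact: (integrable_lty measurableT IH).
Qed.

Lemma L1_wconv g : L1 g -> L1 (wconv e N g).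
Proof.
move=> Ig; have [] // := @Rfubini R
  (fun z => g (z.1 + e * z.2) * N (z.1 + e * z.2) z.2) _ (sheared_lty Ig).
exact: msheared (L1_meas Ig).
Qed.

(** Young's inequality for a kernel that varies with the position but is dominated by a fixed
    integrable [H]: pointwise Jensen with weight [H], then integration in [y] by Tonelli. *)
Lemma LpB_wconv p g c : 1 <= p -> 0 <= c -> L1 g -> LpB p g c ->
  LpB p (wconv e N g) (\int[mu]_t H t * c).
Proof.
move=> p1 c0 Ig gc; have mg := L1_meas Ig.
have mw := L1_meas (L1_wconv Ig).
have p0 : 0 < p by rewrite (lt_le_trans _ p1).
have intH : (\int[mu]_t (H t)%:E)%E = (\int[mu]_t H t)%:E.
  by rewrite /Rintegral fineK//; exact: (integrable_fin_num measurableT IH).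
have intH0 : 0 <= \int[mu]_t H t by apply: Rintegral_ge0.
apply/LpB_int => //; first by rewrite mulr_ge0.
have pw y : ((`|wconv e N g y| `^ p)%:E <=
    (\int[mu]_t H t)%:E `^ (p - 1) *
    \int[mu]_t (`|g (y + e * t)%R| `^ p * H t)%:E)%E.
  have mgy : measurable_fun setT (fun t => g (y + e * t)).
    apply: (measurableT_comp mg).
    exact: (measurableT_comp (measurable_shear e) (measurable_pair1 y)).
  rewrite -intH.
  apply: le_trans (jensen_weight (a := fun t => `|g (y + e * t)|) p1 _ mH _ H0) => //;
    last exact: measurableT_comp.
  rewrite -poweR_EFin; apply: gt0_ler_poweR; first exact: ltW.
  - by rewrite in_itv/= leey lee_fin normr_ge0.
  - by rewrite in_itv/= leey andbT; apply: integral_ge0 => t _; rewrite lee_fin mulr_ge0.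
  rewrite /wconv /Rintegral; apply: le_trans (sheared_le y mg).
  (* [fine] sends infinite values to 0, so passing to the real integral can only decrease the
     absolute value. *)
  apply: (@le_trans _ _ `|\int[mu]_t (g (y + e * t) * N (y + e * t) t)%:E|%E).
    by case: integral => [r| |]; rewrite /= ?leey.
  apply: le_abse_integral => //; apply/measurable_EFinP.
  exact: (measurableT_comp (msheared mg) (measurable_pair1 y)).
have map : measurable_fun setT (fun x => `|g x| `^ p).
  exact: (measurableT_comp (measurable_powR p)
    (measurableT_comp (@normr_measurable R setT) mg)).
have mJ : measurable_fun setT
    (fun y : R => \int[mu]_t (`|g (y + e * t)%R| `^ p * H t)%:E)%E.
  apply: (measurable_integral2 (F :=
      fun z => (`|g (z.1 + e * z.2)%R| `^ p * H z.2)%:E)).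
    apply/measurable_EFinP; apply: measurable_funM.
      exact: (measurableT_comp map (measurable_shear e)).
    exact: (measurableT_comp mH).
  by move=> z; rewrite lee_fin mulr_ge0 ?powR_ge0.
have J0 y : (0 <= \int[mu]_t (`|g (y + e * t)%R| `^ p * H t)%:E)%E.
  by apply: integral_ge0 => t _; rewrite lee_fin mulr_ge0 ?powR_ge0.
apply: (@le_trans _ _ (\int[mu]_y ((\int[mu]_t H t)%:E `^ (p - 1) *
    \int[mu]_t (`|g (y + e * t)%R| `^ p * H t)%:E))%E).
  apply: ge0_le_integral => //.
  - apply/measurable_EFinP; apply: (measurableT_comp (measurable_powR p)).
    exact: measurableT_comp.
  - exact: measurable_funeM.
rewrite ge0_integralZl ?poweR_ge0//.
rewrite (tonelli_shear e (a := fun x => `|g x| `^ p))//.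
rewrite intH muleCA poweR_EFin -EFinM.
have -> : (\int[mu]_t H t * c) `^ p =
    c `^ p * ((\int[mu]_t H t) `^ (p - 1) * \int[mu]_t H t).
  by rewrite powRM// -(mulr_powRB1 intH0 p0); ring.
rewrite [X in (_ <= X)%E]EFinM lee_wpmul2r ?lee_fin ?mulr_ge0 ?powR_ge0//.
by move/LpB_int : gc => /(_ p1 c0 mg).
Qed.

End wconv.

Section adjoint_identity.
Variables (e : R) (N : R -> R -> R) (H g : R -> R).
Hypothesis mN : measurable_fun setT (fun z : R * R => N z.1 z.2).
Hypothesis NH : forall x t, `|N x t| <= H t.
Hypothesis IH : L1 H.
Hypothesis Ig : L1 g.

Let L1N x : L1 (N x).
Proof.
apply: L1_le IH; first exact: (measurableT_comp mN (measurable_pair1 x)).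
by move=> t; rewrite (le_trans (NH x t))// ler_norm.
Qed.

(** The adjoint identity tested against 1: Fubini, and the shift x = y + e t for each fixed [t]. A
    general test function is later absorbed into the kernel. *)
Lemma wconv_adjoint0 : L1 (fun x => g x * \int[mu]_t N x t) /\
  \int[mu]_x (g x * \int[mu]_t N x t) = \int[mu]_y wconv e N g y.
Proof.
have mg := L1_meas Ig.
pose F (z : R * R) := g z.1 * N z.1 z.2.
pose G (z : R * R) := g (z.1 + e * z.2) * N (z.1 + e * z.2) z.2.
have mF : measurable_fun setT F.
  by apply: measurable_funM => //; exact: (measurableT_comp mg).
have mG : measurable_fun setT G.
  have m2 : measurable_fun setT (fun z : R * R => (z.1 + e * z.2, z.2)).
    by apply: measurable_fun_pair; [exact: measurable_shear|exact: measurable_snd].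
  exact: (measurableT_comp mF m2).
have Foo : (\int[mu]_x \int[mu]_t `|(F (x, t))%:E| < +oo)%E.
  (* Taking [e = 0] in the sheared bound gives the unsheared one. *)
  apply: le_lt_trans (sheared_lty 0 mN NH IH Ig).
  rewrite le_eqVlt; apply/orP; left; apply/eqP.
  by apply: eq_integral => x _; apply: eq_integral => t _; rewrite mul0r addr0.
have [LF _ FF] := Rfubini mF Foo.
have [LG _ GG] := Rfubini mG (sheared_lty e mN NH IH Ig).
have EF x : \int[mu]_t F (x, t) = g x * \int[mu]_t N x t.
  by rewrite -Rint_scale.
have -> : (fun x => g x * \int[mu]_t N x t) = (fun x => \int[mu]_t F (x, t)).
  by apply/funext => x; rewrite EF.
split; first exact: LF.
transitivity (\int[mu]_t \int[mu]_y G (y, t)); last exact: esym GG.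
rewrite FF; apply: eq_Rintegral => t _.
rewrite -[LHS](Rint_aff (e := 1) (e * t)); last 2 first.
  by left.
  exact: (measurableT_comp mF (measurable_pair2 t)).
by apply: eq_Rintegral => y _; rewrite mul1r.
Qed.

End adjoint_identity.

Lemma wconv_adjoint (e : R) N H g phi :
  measurable_fun setT (fun z : R * R => N z.1 z.2) ->
  (forall x t, `|N x t| <= H t) -> L1 H -> L1 g -> bmeas phi ->
  L1 (fun x => g x * \int[mu]_t (N x t * phi (x - e * t))) /\
  \int[mu]_x (g x * \int[mu]_t (N x t * phi (x - e * t))) =
    \int[mu]_y (wconv e N g y * phi y).
Proof.
move=> mN NH IH Ig [mphi [M phiM]].
(* At the sheared point x = y + e t the absorbed factor is phi y, which no longer depends on [t]. *)
pose N' x t := N x t * phi (x - e * t).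
have mN' : measurable_fun setT (fun z : R * R => N' z.1 z.2).
  apply: measurable_funM => //; apply: (measurableT_comp mphi).
  have := @measurable_shear R (- e).
  by congr measurable_fun; apply/funext => z; rewrite mulNr.
have H0 t : 0 <= H t by exact: le_trans (NH 0 t).
have N'H x t : `|N' x t| <= M * H t.
  by rewrite /N' normrM mulrC ler_pM.
have [LN' EN'] := wconv_adjoint0 e mN' N'H (L1Z M IH) Ig.
split; first exact: LN'.
rewrite EN'.
have mG : measurable_fun setT
    (fun z : R * R => g (z.1 + e * z.2) * N (z.1 + e * z.2) z.2).
  have mF : measurable_fun setT (fun z : R * R => g z.1 * N z.1 z.2).
    by apply: measurable_funM => //; exact: (measurableT_comp (L1_meas Ig)).
  have m2 : measurable_fun setT (fun z : R * R => (z.1 + e * z.2, z.2)).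
    by apply: measurable_fun_pair; [exact: measurable_shear|exact: measurable_snd].
  exact: (measurableT_comp mF m2).
(* The factor phi y is pulled out of the inner integral where that integral converges absolutely,
   hence for almost every y. *)
have [_ aeL _] := Rfubini mG (sheared_lty e mN NH IH Ig).
apply: ae_eq_Rint.
- exact: (L1_meas (L1_wconv e mN' N'H (L1Z M IH) Ig)).
- apply: measurable_funM; [exact: (L1_meas (L1_wconv e mN NH IH Ig))|exact: mphi].
apply: (ae_imp aeL) => y /= Ly.
rewrite /wconv mulrC -Rint_scale//; apply: eq_Rintegral => t _.
by rewrite /N' addrK; ring.
Qed.

End adjoint.

(** * Test functions and convolutions *)

Section test_functions.
Context {R : realType}.
Local Notation mu := (@lebesgue_measure R).
Implicit Types (f g phi : R -> R).

Definition bsupp f := exists A, forall x, A < `|x| -> f x = 0.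

(** A test function on the line. Compactness of the support is replaced by a bound, which is easy to
    follow through convolutions. *)
Definition tf phi := smooth phi /\ bsupp phi.

Lemma continuous_bsupp_bmeas f : continuous f -> bsupp f -> bmeas f.
Proof.
move=> cf [A fA]; split; first exact: continuous_measurable_fun.
have : bounded_set (f @` `[- `|A|, `|A|]).
  apply/compact_bounded/continuous_compact; last exact: segment_compact.
  exact: continuous_subspaceT.
move=> [M [_ HM]]; exists (`|M| + 1) => x.
have [Ax|xA] := ltP A `|x|; first by rewrite fA// normr0 addr_ge0.
apply: (HM (`|M| + 1)); first by rewrite (le_lt_trans (ler_norm _))// ltrDl.
exists x => //; rewrite /= in_itv/= -ler_norml.
exact: le_trans xA (ler_norm _).
Qed.

Lemma L1_segment f A : mu.-integrable `[- A, A] (EFin \o f) ->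
  (forall x, A < `|x| -> f x = 0) -> L1 f.
Proof.
move=> If fA; rewrite /L1.
have -> : EFin \o f = (EFin \o f) \_ `[- A, A].
  apply/funext => x; rewrite patchE; case: ifPn => // /negP xA.
  rewrite /= fA// ltNge; apply/negP => xA'; apply: xA.
  by rewrite inE /= in_itv/= -ler_norml.
by apply/(integrable_mkcond _ _).1.
Qed.

Lemma continuous_bsupp_L1 f : continuous f -> bsupp f -> L1 f.
Proof.
move=> cf [A fA]; apply: L1_segment fA.
apply: continuous_compact_integrable; first exact: segment_compact.
exact: continuous_subspaceT.
Qed.

Lemma supp_derive1 f A : (forall x, A < `|x| -> f x = 0) ->
  forall x, A < `|x| -> derive1 f x = 0.
Proof.
move=> fA x Ax; rewrite derive1E.
have : is_derive x 1 f 0.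
  apply: (@near_eq_is_derive _ _ _ (cst 0 : R -> R)).
    near=> y; rewrite fA//; near: y.
    have : (`|y| @[y --> x] --> `|x|) by exact: norm_continuous.
    by move/cvgr_gt; exact.
by move=> /@derive_val.
Unshelve. all: by end_near. Qed.

Lemma bsupp_derive1 f : bsupp f -> bsupp (derive1 f).
Proof. by move=> [A fA]; exists A; exact: supp_derive1. Qed.

Lemma tf_derive1 f : tf f -> tf (derive1 f).
Proof. by move=> [sf bf]; split; [exact: smooth_derive1|exact: bsupp_derive1]. Qed.

Lemma tf_derive1n n f : tf f -> tf (derive1n n f).
Proof. by move=> tff; elim: n => [|n IH]; [|exact: tf_derive1]. Qed.

Lemma tfM g f : smooth g -> tf f -> tf (fun x => g x * f x).
Proof.
move=> sg [sf [A fA]]; split; first exact: smoothM.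
by exists A => x Ax; rewrite fA// mulr0.
Qed.

Lemma tf_bmeas f : tf f -> bmeas f.
Proof. by move=> [/smooth_continuous cf bf]; exact: continuous_bsupp_bmeas. Qed.

Lemma tf_L1 f : tf f -> L1 f.
Proof. by move=> [/smooth_continuous cf bf]; exact: continuous_bsupp_L1. Qed.

Lemma tf_refl (e x : R) f : e = 1 \/ e = -1 -> tf f -> tf (fun t => f (x - e * t)).
Proof.
move=> e1 [sf [A fA]]; split.
  rewrite (_ : (fun t => _) = fun t => f (- e * t + x)); first exact: smooth_affine.
  by apply/funext => t; rewrite mulNr addrC.
exists (A + `|x|) => t At; apply: fA.
have et : `|e * t| = `|t|.
  by rewrite normrM; case: e1 => ->; rewrite ?normrN normr1 mul1r.
by rewrite distrC (lt_le_trans _ (lerB_dist _ _))// et ltrBrDr.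
Qed.

Lemma Rint_derive_tf f : tf f -> \int[mu]_x derive1 f x = 0.
Proof.
move=> tff; have [sf [A fA]] := tff; have [sf' _] := tf_derive1 tff.
pose L := `|A| + 1.
have L0 : 0 < L by rewrite ltr_wpDl.
have AL x : L <= `|x| -> A < `|x|.
  by apply: lt_le_trans; rewrite (le_lt_trans (ler_norm _))// ltrDl.
have LL : - L < L by lra.
have := @continuous_FTC2 R (derive1 f) f (- L) L LL.
rewrite (fA L) ?(fA (- L)); [|apply: AL; rewrite ?normrN; exact: ler_norm..].
move=> ftc.
have -> : \int[mu]_x derive1 f x = \int[mu]_(x in `[- L, L]) derive1 f x.
  rewrite [RHS]Rintegral_mkcond; apply: eq_Rintegral => x _.
  rewrite patchE; case: ifPn => // /negP xA.
  rewrite (supp_derive1 fA)//; apply: AL; rewrite leNgt; apply/negP => xL.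
  by apply: xA; rewrite inE /= in_itv/= -ler_norml ltW.
rewrite /Rintegral ftc ?subee//.
- exact/continuous_subspaceT/smooth_continuous.
- split.
  + by move=> x _; exact: (sf 0).
  + apply: cvg_at_right_filter; have cf := smooth_continuous sf; exact: cf.
  + by apply: cvg_at_left_filter; have cf := smooth_continuous sf; exact: cf.
Qed.

End test_functions.

(** * Convolution of test functions with locally integrable kernels *)

Section convolution.
Context {R : realType}.
Local Notation mu := (@lebesgue_measure R).
Implicit Types (f g phi k : R -> R).

Definition conv (e : R) k phi x := \int[mu]_t (k t * phi (x - e * t)).

(** Differentiation under the integral. The derivative falls on [phi], so [k] may be singular as
    long as it is integrable; the majorant is M |k| with M a bound for phi'. *)
Lemma conv_L1_is_derive (e : R) k phi (x : R) : e = 1 \/ e = -1 -> L1 k -> tf phi ->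
  is_derive x 1 (conv e k phi) (conv e k (derive1 phi) x).
Proof.
move=> e1 Ik tphi.
have [mdphi [M dM]] := tf_bmeas (tf_derive1 tphi).
pose f (x t : R) := k t * phi (x - e * t).
have df (y t : R) : is_derive y 1 (f ^~ t) (k t * derive1 phi (y - e * t)).
  have [sphi _] := tphi.
  have d1 : is_derive y 1 (fun y => y - e * t) 1.
    by apply: is_derive_eq (is_deriveB (is_derive_id _ _) (is_derive_cst _ _ _)) _; rewrite subr0.
  have d2 := @is_derive_comp R phi (fun y => y - e * t) y _ _
    (smooth_is_derive (y - e * t) sphi) d1.
  apply: is_derive_eq (is_derive_mul (is_derive_cst (k t) y 1) d2) _.
  by rewrite mul0r add0r mulr1.
have fE (y t : R) : partial1of2 f y t = k t * derive1 phi (y - e * t).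
  by rewrite /partial1of2 (is_derive_fun (df ^~ t)).
have Ix : `]x - 1, x + 1[%classic x by rewrite /= in_itv/=; apply/andP; split; lra.
have intf (y : R) : `]x - 1, x + 1[%classic y -> mu.-integrable setT (EFin \o f y).
  by move=> _; apply: L1Ml => //; exact/tf_bmeas/tf_refl.
have derf (y t : R) : `]x - 1, x + 1[%classic y -> setT t -> derivable (f ^~ t) y 1.
  by move=> _ _; exact: ex_derive.
have G0 (t : R) : 0 <= M * `|k t|.
  by rewrite mulr_ge0// (le_trans (normr_ge0 _) (dM 0)).
have IG : mu.-integrable setT (EFin \o (fun t => M * `|k t|)).
  by apply: L1Z; exact: L1_norm.
have Gub (y t : R) : `]x - 1, x + 1[%classic y -> setT t ->
    `|partial1of2 f y t| <= M * `|k t|.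
  by move=> _ _; rewrite fE normrM mulrC ler_wpM2r.
have H1 := derivable_under_integral measurableT Ix intf derf G0 IG Gub.
have H2 := differentiation_under_integral measurableT Ix intf derf G0 IG Gub.
apply: DeriveDef; first exact: H1.
rewrite -derive1E H2; apply: eq_Rintegral => t _; exact: fE.
Qed.

(** The kernel t^-b with 0 < b < 1 is not integrable at infinity; against a function of bounded
    support, only its restriction to a bounded interval counts. *)
Definition locL1 k := forall L, L1 (k \_ `[- L, L]).

Lemma L1_locL1 k : L1 k -> locL1 k.
Proof.
move=> Ik L; have mk := L1_meas Ik; apply: L1_le Ik.
  by apply/(measurable_restrictT _ _).1 => //; exact: measurable_funTS.
by move=> x; rewrite patchE; case: ifPn => //; rewrite normr0.
Qed.

Lemma mul_patch k (e x A L t : R) phi : e = 1 \/ e = -1 ->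
  (forall y, A < `|y| -> phi y = 0) -> `|x| + A <= L ->
  (k \_ `[- L, L]) t * phi (x - e * t) = k t * phi (x - e * t).
Proof.
move=> e1 phiA xL; rewrite patchE; case: ifPn => // /negP tL.
rewrite (phiA (x - e * t)) ?mulr0//.
have et : `|e * t| = `|t|.
  by rewrite normrM; case: e1 => ->; rewrite ?normrN normr1 mul1r.
have {}tL : L < `|t|.
  by rewrite ltNge; apply/negP => tL'; apply: tL; rewrite inE /= in_itv/= -ler_norml.
by rewrite distrC (lt_le_trans _ (lerB_dist _ _))// et ltrBrDr (le_lt_trans _ tL)// addrC.
Qed.

Lemma conv_patch k (e x A L : R) phi : e = 1 \/ e = -1 ->
  (forall y, A < `|y| -> phi y = 0) -> `|x| + A <= L ->
  conv e k phi x = conv e (k \_ `[- L, L]) phi x.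
Proof.
by move=> e1 phiA xL; apply: eq_Rintegral => t _; rewrite (mul_patch _ _ e1 phiA xL).
Qed.

Lemma locL1_mul k (e x : R) phi : e = 1 \/ e = -1 -> locL1 k -> tf phi ->
  L1 (fun t => k t * phi (x - e * t)).
Proof.
move=> e1 lk tphi; have [_ [A phiA]] := tphi.
have -> : (fun t => k t * phi (x - e * t)) =
    (fun t => (k \_ `[- (`|x| + A), `|x| + A]) t * phi (x - e * t)).
  by apply/funext => t; rewrite (mul_patch _ _ e1 phiA (lexx _)).
by apply: L1Ml => //; exact/tf_bmeas/tf_refl.
Qed.

Lemma conv_is_derive (e : R) k phi (x : R) : e = 1 \/ e = -1 -> locL1 k ->
  tf phi -> is_derive x 1 (conv e k phi) (conv e k (derive1 phi) x).
Proof.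
move=> e1 lk tphi; have [_ [A phiA]] := tphi.
(* The extra 1 lets one truncation of the kernel serve all points near [x]. *)
pose L := `|x| + 1 + A.
have xL : `|x| + A <= L by rewrite lerD2r lerDl.
rewrite (conv_patch _ e1 (supp_derive1 phiA) xL).
apply: (@near_eq_is_derive _ _ _ (conv e (k \_ `[- L, L]) phi)); last first.
  exact: conv_L1_is_derive.
near=> y; rewrite (@conv_patch k e y A L)// lerD2r.
apply: ltW; near: y.
have : (`|y| @[y --> x] --> `|x|) by exact: norm_continuous.
by move/cvgr_lt; apply; rewrite ltrDl.
Unshelve. all: by end_near. Qed.

Lemma conv_derive1n (e : R) k phi n : e = 1 \/ e = -1 -> locL1 k ->
  tf phi -> derive1n n (conv e k phi) = conv e k (derive1n n phi).
Proof.
move=> e1 lk tphi; elim: n => [//|n IH].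
rewrite [LHS]/= IH; apply: is_derive_fun => x.
by apply: conv_is_derive => //; exact: tf_derive1n.
Qed.

Lemma conv_smooth (e : R) k phi : e = 1 \/ e = -1 -> locL1 k ->
  tf phi -> smooth (conv e k phi).
Proof.
move=> e1 lk tphi n x; rewrite conv_derive1n//.
have := conv_is_derive x e1 lk (tf_derive1n n tphi).
by move=> H; exact: ex_derive.
Qed.

Lemma conv_bmeas (e : R) k phi : e = 1 \/ e = -1 -> L1 k ->
  tf phi -> bmeas (conv e k phi).
Proof.
move=> e1 Ik tphi; have [mphi [M phiM]] := tf_bmeas tphi; split.
  apply: continuous_measurable_fun; apply: smooth_continuous.
  by apply: conv_smooth => //; exact: L1_locL1.
exists (\int[mu]_t (M * `|k t|)) => x.
have Lk := locL1_mul x e1 (L1_locL1 Ik) tphi.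
apply: le_trans (le_normr_Rintegral measurableT Lk) _.
apply: le_Rintegral => //.
- exact: L1_norm.
- by apply: L1Z; exact: L1_norm.
- by move=> t _; rewrite normrM mulrC ler_wpM2r.
Qed.

Lemma conv_eq0 (e : R) k phi x :
  (forall t, k t != 0 -> phi (x - e * t) = 0) -> conv e k phi x = 0.
Proof.
move=> H.
transitivity (\int[mu]_t (cst 0 t : R)); last first.
  by rewrite /Rintegral integral0.
apply: eq_Rintegral => t _; have [->|kt] := eqVneq (k t) 0; first by rewrite mul0r.
by rewrite H// mulr0.
Qed.

Lemma conv_add (e : R) k k' phi x : e = 1 \/ e = -1 -> locL1 k -> locL1 k' ->
  tf phi -> conv e (fun t => k t + k' t) phi x = conv e k phi x + conv e k' phi x.
Proof.
move=> e1 lk lk' tphi; rewrite -Rint_add; [|exact: locL1_mul..].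
by apply: eq_Rintegral => t _; rewrite mulrDl.
Qed.

(** The derivative in t of k(t) phi(x - e t) integrates to 0. The sign comes from the chain rule, as
    1/e = e. *)
Lemma conv_ibp (e : R) k phi x : e = 1 \/ e = -1 -> smooth k -> tf phi ->
  conv e k (derive1 phi) x = e * conv e (derive1 k) phi x.
Proof.
move=> e1 sk tphi; have [sphi _] := tphi.
have t1 := tfM sk (tf_refl x e1 (tf_derive1 tphi)).
have t2 := tfM (smooth_derive1 sk) (tf_refl x e1 tphi).
have := Rint_derive_tf (tfM sk (tf_refl x e1 tphi)).
have -> : derive1 (fun t => k t * phi (x - e * t)) = fun t =>
    derive1 k t * phi (x - e * t) + - e * (k t * derive1 phi (x - e * t)).
  apply: is_derive_fun => t.
  have d1 : is_derive t 1 (fun t => x - e * t) (- e).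
    apply: is_derive_eq (is_deriveB (is_derive_cst x _ _)
      (is_deriveZ e (is_derive_id _ _))) _.
    by rewrite /GRing.scale/= mulr1 sub0r.
  have d2 := @is_derive_comp R phi (fun t => x - e * t) t _ _
    (smooth_is_derive (x - e * t) sphi) d1.
  apply: is_derive_eq (is_derive_mul (smooth_is_derive t sk) d2) _.
  by congr (_ + _); ring.
rewrite Rint_add; [|exact: tf_L1|apply: L1Z; exact: tf_L1].
rewrite Rint_scale ?mulNr; last exact: tf_L1.
rewrite -/(conv e k (derive1 phi) x) -/(conv e (derive1 k) phi x).
move=> /eqP; rewrite subr_eq0 => /eqP ->.
by rewrite mulrA; case: e1 => ->; rewrite ?mulrNN !mul1r.
Qed.

Lemma conv_ibpn (e : R) n k phi x : e = 1 \/ e = -1 -> smooth k -> tf phi ->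
  conv e k (derive1n n phi) x = e ^+ n * conv e (derive1n n k) phi x.
Proof.
move=> e1; elim: n k x => [|n IH] k x sk tphi; first by rewrite expr0 mul1r.
rewrite -[derive1n n.+1 phi]/(derive1 (derive1n n phi)).
rewrite (conv_ibp _ e1 sk (tf_derive1n n tphi)) (IH _ _ (smooth_derive1 sk) tphi).
by rewrite exprS mulrA derive1n_derive1.
Qed.

End convolution.

(** * Singular kernels *)

Section improper.
Context {R : realType}.
Local Notation mu := (@lebesgue_measure R).
Implicit Types (f g : R -> R).

(** Compact intervals increasing to ]0, +oo[, away from the singularity at 0. The shifted indices
    keep the endpoints strictly ordered already for n = 0, as the fundamental theorem of calculus
    requires. *)
Definition exhaust (n : nat) : set R := `[n.+1%:R^-1, n.+2%:R]%classic.

Lemma exhaust_nd m n (t : R) : (m <= n)%N -> exhaust m t -> exhaust n t.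
Proof.
move=> mn; rewrite /exhaust /= !in_itv/= => /andP[mt tm]; apply/andP; split.
  by apply: le_trans mt; rewrite lef_pV2 ?posrE// ler_nat ltnS.
by apply: le_trans tm _; rewrite ler_nat !ltnS.
Qed.

Lemma near_exhaust (t : R) : 0 < t -> \forall n \near \oo, exhaust n t.
Proof.
move=> t0; near=> n; rewrite /exhaust /= in_itv/=; apply/andP; split.
  by apply: ltW; near: n; exact: near_infty_natSinv_lt (PosNum t0).
rewrite (@le_trans _ _ n%:R)//; last by rewrite ler_nat 2?leqW.
by near: n; exact: nbhs_infty_ger.
Unshelve. all: by end_near. Qed.

Lemma exhaust_patch_cvg f (t : R) : f t = 0 \/ 0 < t ->
  ((f \_ (exhaust n)) t)%:E @[n --> \oo] --> (f t)%:E.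
Proof.
move=> ft; apply: cvg_near_cst; case: ft => [f0|t0].
  by near=> n; rewrite patchE f0; case: ifPn.
near=> n; rewrite patchE ifT// inE; near: n; exact: near_exhaust.
Unshelve. all: by end_near. Qed.

Lemma measurable_exhaust n : measurable (exhaust n).
Proof. exact: measurable_itv. Qed.

Lemma measurable_exhaust_patch f n : measurable_fun setT f ->
  measurable_fun setT (f \_ (exhaust n)).
Proof.
move=> mf; apply/(measurable_restrictT _ _).1; first exact: measurable_exhaust.
exact: measurable_funTS.
Qed.

(** Monotone convergence along [exhaust] turns bounds that are uniform over compact subintervals
    into integrability. *)
Lemma L1_improper f (C : R) : measurable_fun setT f -> (forall t, 0 <= f t) ->
  (forall t, t <= 0 -> f t = 0) ->
  (forall a b, 0 < a -> a < b -> (\int[mu]_(t in `[a, b]) (f t)%:E <= C%:E)%E) ->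
  L1 f.
Proof.
move=> mf f0 fneg fC.
pose g n t := ((f \_ (exhaust n)) t)%:E.
have mg n : measurable_fun setT (g n).
  by apply/measurable_EFinP; exact: (measurable_exhaust_patch n mf).
have g0 n t : setT t -> (0 <= g n t)%E.
  by move=> _; rewrite /g patchE lee_fin; case: ifPn.
have ndg t : setT t -> {homo g^~ t : m n / (m <= n)%N >-> (m <= n)%E}.
  move=> _ m n mn; rewrite /g !patchE; case: ifPn => tm.
    by rewrite ifT// inE; apply: exhaust_nd mn _; rewrite inE in tm.
  by case: ifPn => _; rewrite lee_fin.
have limg t : limn (g^~ t) = (f t)%:E.
  apply/cvg_lim => //; apply: exhaust_patch_cvg.
  by have [t0|t0] := ltP 0 t; [right|left; exact: fneg].
have E : (\int[mu]_x limn (g^~ x) = \int[mu]_x (f x)%:E)%E.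
  by apply: eq_integral => x _; exact: limg.
have cvgI : (\int[mu]_x g n x)%E @[n --> \oo] --> (\int[mu]_x (f x)%:E)%E.
  by rewrite -E; exact: (@cvg_monotone_convergence _ _ _ mu _ measurableT _ mg g0 ndg).
apply/integrableP; split; first exact/measurable_EFinP.
apply: (@le_lt_trans _ _ C%:E); last exact: ltry.
have -> : (\int[mu]_x `|(EFin \o f) x| = \int[mu]_x (f x)%:E)%E.
  by apply: eq_integral => x _; rewrite /= ger0_norm.
rewrite -(cvg_lim _ cvgI)//; apply: lime_le; first by apply/cvg_ex; eexists; exact: cvgI.
near=> n.
have -> : (\int[mu]_x g n x = \int[mu]_(t in exhaust n) (f t)%:E)%E.
  rewrite [RHS]integral_mkcond; apply: eq_integral => t _.
  by rewrite /g !patchE; case: ifPn.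
apply: fC; first by rewrite invr_gt0.
by rewrite (@le_lt_trans _ _ 1)// ?invf_le1 ?ler1n ?ltr1n// ltr0n.
Unshelve. all: by end_near. Qed.

(** The fundamental theorem of calculus on each [exhaust n], then dominated convergence. [F]
    vanishes at the far end and tends to 0 at the origin, so no boundary term survives the limit. *)
Lemma singular_FTC (F D : R -> R) (L : R) : L1 D ->
  (forall t : R, 0 < t -> is_derive t 1 F (D t)) ->
  (forall t : R, 0 < t -> {for t, continuous D}) ->
  (forall t : R, t <= 0 -> D t = 0) -> (forall t, L <= t -> F t = 0) ->
  F n.+1%:R^-1 @[n --> \oo] --> 0 -> \int[mu]_t D t = 0.
Proof.
move=> ID dF cD Dneg FL F0.
pose g n t := ((D \_ (exhaust n)) t)%:E.
have mD := L1_meas ID.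
have mg n : measurable_fun setT (g n).
  by apply/measurable_EFinP; exact: (measurable_exhaust_patch n mD).
have gD : {ae mu, forall t, setT t -> g^~ t @ \oo --> (EFin \o D) t}.
  apply: aeW => t _; apply: exhaust_patch_cvg.
  by have [t0|t0] := ltP 0 t; [right|left; exact: Dneg].
have gle : {ae mu, forall t n, setT t -> (`|g n t| <= (EFin \o (fun t => `|D t|%R)) t)%E}.
  apply: aeW => t n _; rewrite /g patchE; case: ifPn => _ //=.
  by rewrite normr0 lee_fin.
have [_ _ cvgI] := @dominated_convergence _ _ _ mu _ measurableT g (EFin \o D) _
  mg ((measurable_EFinP _ _).2 mD) gD (L1_norm ID) gle.
have intg : \forall n \near \oo, (\int[mu]_t g n t = (- F n.+1%:R^-1)%:E)%E.
  near=> n.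
  have ab : n.+1%:R^-1 < n.+2%:R :> R.
    by rewrite (@le_lt_trans _ _ 1)// ?invf_le1 ?ler1n ?ltr1n// ltr0n.
  transitivity (\int[mu]_(t in exhaust n) (D t)%:E)%E.
    rewrite [RHS]integral_mkcond; apply: eq_integral => t _.
    by rewrite /g !patchE; case: ifPn.
  have pos (t : R) : n.+1%:R^-1 <= t -> 0 < t by apply: lt_le_trans; rewrite invr_gt0.
  rewrite (continuous_FTC2 (F := F) ab).
  - rewrite FL ?sub0e//; near: n; have := nbhs_infty_ger L => H.
    near=> n; rewrite (@le_trans _ _ n%:R)//; last by rewrite ler_nat 2?leqW.
    by near: n.
  - apply: continuous_in_subspaceT => t; rewrite inE /= in_itv/= => /andP[at_ _].
    exact: cD (pos _ at_).

  - have cF (t : R) : n.+1%:R^-1 <= t -> {for t, continuous F}.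
      move=> /pos t0; apply/differentiable_continuous/derivable1_diffP.
      exact: (@ex_derive _ _ _ _ _ _ _ (dF _ t0)).
    split.
    + move=> t; rewrite in_itv/= => /andP[/ltW/pos t0 _].
      exact: (@ex_derive _ _ _ _ _ _ _ (dF _ t0)).
    + by apply: cvg_at_right_filter; have := cF _ (lexx _); apply.
    + by apply: cvg_at_left_filter; have := cF _ (ltW ab); apply.
  - move=> t; rewrite in_itv/= => /andP[/ltW/pos t0 _].
    by rewrite derive1E; exact: (@derive_val _ _ _ _ _ _ _ (dF _ t0)).
have l1 : (\int[mu]_t g n t)%E @[n --> \oo] --> (0 : R)%:E.
  rewrite -oppr0; apply: cvg_trans (_ : (- F n.+1%:R^-1)%:E @[n --> \oo] --> _).
    apply: near_eq_cvg; near=> n; apply/esym; near: n; exact: intg.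
  by apply: cvg_EFin; [exact: nearW|exact: cvgN].
rewrite /Rintegral; have -> := cvg_unique _ cvgI l1; rewrite //.
Unshelve. all: by end_near. Qed.

End improper.

(** * Power kernels and their splitting into a near and a far part *)

Section kernels.
Context {R : realType}.
Local Notation mu := (@lebesgue_measure R).
Implicit Types (f g : R -> R).

Lemma integral_powR (q u v : R) : q + 1 != 0 -> 0 < u -> u < v ->
  (\int[mu]_(t in `[u, v]) (t `^ q)%:E =
   ((v `^ (q + 1) - u `^ (q + 1)) / (q + 1))%:E)%E.
Proof.
move=> q1 u0 uv.
have pos (t : R) : u <= t -> 0 < t by exact: lt_le_trans.
pose F t := (q + 1)^-1 * t `^ (q + 1).
have dF (t : R) : 0 < t -> is_derive t 1 F (t `^ q).
  move=> t0; apply: is_derive_eq (is_derive_mul (is_derive_cst (q + 1)^-1 t 1)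
    (is_derive1_powR (q + 1) t0)) _.
  by rewrite mul0r add0r mulrA mulVf// mul1r addrK.
have dp (t : R) : 0 < t -> is_derive t 1 (fun t => t `^ q) (q * t `^ (q - 1)).
  by move=> t0; exact: is_derive1_powR.
have cont (f : R -> R) (t df : R) : is_derive t 1 f df -> {for t, continuous f}.
  move=> H; apply/differentiable_continuous/derivable1_diffP.
  exact: (@ex_derive _ _ _ _ _ _ _ H).
rewrite (continuous_FTC2 (F := F) uv).
- by rewrite -EFinB /F; congr (_%:E); rewrite mulrC [_^-1 * u `^ _]mulrC -mulrBl.
- apply: continuous_in_subspaceT => t; rewrite inE /= in_itv/= => /andP[/pos t0 _].
  exact: cont (dp _ t0).
- split.
  + move=> t; rewrite in_itv/= => /andP[/ltW/pos t0 _].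
    exact: (@ex_derive _ _ _ _ _ _ _ (dF _ t0)).
  + by apply: cvg_at_right_filter; have := cont _ _ _ (dF _ u0); apply.
  + by apply: cvg_at_left_filter; have := cont _ _ _ (dF _ (pos _ (ltW uv))); apply.
- move=> t; rewrite in_itv/= => /andP[/ltW/pos t0 _].
  by rewrite derive1E; exact: (@derive_val _ _ _ _ _ _ _ (dF _ t0)).
Qed.

(** Compares a truncated power with a full one on an interval [u, v] of the caller's choice, which
    avoids a discussion of how [a, c] meets the truncation. *)
Lemma integral_le_powR f (q a c u v : R) : measurable_fun setT f ->
  (forall t, 0 <= f t) ->
  (forall t, a <= t <= c -> f t != 0 -> u <= t <= v /\ f t = t `^ q) ->
  (\int[mu]_(t in `[a, c]) (f t)%:E <= \int[mu]_(t in `[u, v]) (t `^ q)%:E)%E.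
Proof.
move=> mf f0 fq.
rewrite integral_mkcond [leRHS]integral_mkcond; apply: ge0_le_integral => //.
- by move=> t _; rewrite patchE; case: ifPn => // _; rewrite lee_fin.
- apply/(measurable_restrictT _ _).1 => //; apply: measurable_funTS.
  exact/measurable_EFinP.
- apply/(measurable_restrictT _ _).1 => //; apply: measurable_funTS.
  by apply/measurable_EFinP; exact: (measurable_powR q).
- move=> t _; rewrite !patchE; case: ifPn => [|_]; last first.
    by case: ifPn => // _; rewrite lee_fin powR_ge0.
  rewrite inE /= in_itv/= => act; have [->|ft0] := eqVneq (f t) 0.
    by case: ifPn => // _; rewrite lee_fin powR_ge0.
  have [uv ->] := fq _ act ft0.
  by rewrite ifT// inE /= in_itv.
Qed.

(** The kernel of the fractional integral of order 1 - b without its Gamma factor, extended by 0 so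
    that convolutions run over the whole line. *)
Definition pker (b t : R) : R := if 0 < t then t `^ (- b) else 0.

(** This majorant controls the singularity at 0 and is integrable for b < 1; the next one controls
    the tail at infinity and is integrable for b > 0. *)
Definition near_pker (b L t : R) : R := if 0 < t <= L then t `^ (- b) else 0.

Definition far_pker (b r t : R) : R := if r <= t then t `^ (- 1 - b) else 0.

Lemma pker_ge0 b t : 0 <= pker b t.
Proof. by rewrite /pker; case: ifPn => // _; exact: powR_ge0. Qed.

Lemma near_pker_ge0 b L t : 0 <= near_pker b L t.
Proof. by rewrite /near_pker; case: ifPn => // _; exact: powR_ge0. Qed.

Lemma measurable_pker b : measurable_fun setT (pker b).
Proof.
apply: measurable_fun_ifT; last exact: measurable_cst.
  exact: measurable_fun_ltr.
exact: (measurable_powR (- b)).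
Qed.

Lemma measurable_near_pker b L : measurable_fun setT (near_pker b L).
Proof.
apply: measurable_fun_ifT; last exact: measurable_cst.
  by apply: measurable_and; [exact: measurable_fun_ltr|exact: measurable_fun_ler].
exact: (measurable_powR (- b)).
Qed.

Lemma measurable_far_pker b r : measurable_fun setT (far_pker b r).
Proof.
apply: measurable_fun_ifT; last exact: measurable_cst.
  exact: measurable_fun_ler.
exact: (measurable_powR (- 1 - b)).
Qed.

Lemma L1_near_pker b L : b < 1 -> 0 < L -> L1 (near_pker b L).
Proof.
move=> b1 L0; apply: (@L1_improper _ _ (L `^ (- b + 1) / (- b + 1))).
- exact: measurable_near_pker.
- exact: near_pker_ge0.
- by move=> t t0; rewrite /near_pker ltNge t0.
(* The interval [a, c] may lie beyond [L]; the minimum keeps u < L. *)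
move=> a c a0 ac; pose u := Num.min a (L / 2).
have u0 : 0 < u by rewrite lt_min a0 divr_gt0.
have uL : u < L by rewrite gt_min; apply/orP; right; lra.
have b10 : 0 < - b + 1 by lra.
apply: le_trans (integral_le_powR (q := - b) (u := u) (v := L) _ _ _) _.
- exact: measurable_near_pker.
- exact: near_pker_ge0.
- move=> t /andP[at_ tc]; rewrite /near_pker; case: ifPn; rewrite ?eqxx// => /andP[t0 tL] _.
  by split => //; rewrite tL andbT ge_min at_.
rewrite integral_powR ?gt_eqF// lee_fin ler_pM2r ?invr_gt0//.
by rewrite gerBl powR_ge0.
Qed.

Lemma L1_far_pker b r : 0 < b -> 0 < r -> L1 (far_pker b r).
Proof.
move=> b0 r0.
have far0 t : 0 <= far_pker b r t.
  by rewrite /far_pker; case: ifPn => // _; exact: powR_ge0.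
apply: (@L1_improper _ _ (r `^ (- b) / b)).
- exact: measurable_far_pker.
- exact: far0.
- by move=> t t0; rewrite /far_pker ifF//; apply/negbTE; rewrite -ltNge (le_lt_trans t0).
move=> a c a0 ac; pose v := Num.max c r + 1.
have rv : r < v by rewrite /v ltr_pwDr// le_max lexx orbT.
have b1 : -1 - b + 1 = - b by ring.
apply: le_trans (integral_le_powR (q := - 1 - b) (u := r) (v := v) _ _ _) _.
- exact: measurable_far_pker.
- exact: far0.
- move=> t /andP[at_ tc]; rewrite /far_pker; case: ifPn; rewrite ?eqxx// => rt _.
  by split => //; rewrite /= /v ler_wpDr// le_max tc.
rewrite integral_powR ?b1// ?oppr_eq0 ?gt_eqF// lee_fin.
rewrite invrN mulrN -mulNr opprB ler_pM2r ?invr_gt0//.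
by rewrite gerBl powR_ge0.
Qed.

Lemma locL1_pker b : b < 1 -> locL1 (pker b).
Proof.
move=> b1 L; apply: (@L1_le _ _ (near_pker b (`|L| + 1))).
- apply/(measurable_restrictT _ _).1 => //; apply: measurable_funTS.
  exact: measurable_pker.
- move=> t; rewrite (ger0_norm (near_pker_ge0 _ _ _)) patchE; case: ifPn; last first.
    by rewrite normr0 near_pker_ge0.
  rewrite inE /= in_itv/= => /andP[_ tL].
  rewrite (ger0_norm (pker_ge0 _ _)) /pker /near_pker.
  case: ifPn => //= t0; rewrite ifT// (le_trans tL)// (le_trans (ler_norm _))//.
  by rewrite lerDl.
- by apply: L1_near_pker => //; rewrite ltr_wpDl.
Qed.

(** Rises from 0 at r to 1 at 2 r. Multiplication by it and by its complement yields k1 =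
    [far_kernel] and k0 = [near_kernel]. *)
Definition ramp (r t : R) : R := step (r^-1 * (t - r)).

Arguments ramp : simpl never.

Lemma smooth_ramp r : smooth (ramp r).
Proof.
rewrite (_ : ramp r = fun t => step (r^-1 * t + - (r^-1 * r))).
  by apply: smooth_affine; exact: smooth_step.
by apply/funext => t; rewrite /ramp mulrBr.
Qed.

Lemma smooth_onem_ramp r : smooth (fun t => 1 - ramp r t).
Proof.
rewrite (_ : (fun t => _) = fun t => 1 + -1 * ramp r t).
  apply: smoothD; first exact: smooth_cst.
  exact: (smoothM (@smooth_cst R (-1)) (@smooth_ramp r)).
by apply/funext => t; rewrite mulN1r.
Qed.

Lemma ramp_eq0 (r t : R) : 0 < r -> t <= r -> ramp r t = 0.
Proof. by move=> r0 tr; rewrite /ramp step_le0// pmulr_rle0 ?invr_gt0// subr_le0. Qed.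

Lemma ramp_eq1 (r t : R) : 0 < r -> r + r <= t -> ramp r t = 1.
Proof. by move=> r0 tr; rewrite /ramp step_ge1// ler_pdivlMl// mulr1; lra. Qed.

Lemma ramp_ge0 r t : 0 <= ramp r t. Proof. exact: step_ge0. Qed.

Lemma ramp_le1 r t : ramp r t <= 1. Proof. exact: step_le1. Qed.

Definition near_kernel (b r t : R) : R := pker b t * (1 - ramp r t).

Arguments near_kernel : simpl never.

Definition far_kernel (b r t : R) : R := pker b t * ramp r t.

Lemma kernel_split b r t : near_kernel b r t + far_kernel b r t = pker b t.
Proof. by rewrite /near_kernel /far_kernel; ring. Qed.

Lemma smooth_far_kernel b r : 0 < r -> smooth (far_kernel b r).
Proof.
move=> r0.
(* Real powers are smooth only on a positive base, so t is replaced by a positive smooth function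
   that is 1 up to r/2 and equals t from r on, hence wherever the ramp does not vanish. *)
pose lam (t : R) := 1 + ramp (r / 2) t * (t - 1).
have lam0 t : 0 < lam t.
  have [tr|tr] := leP t (r / 2).
    by rewrite /lam ramp_eq0 ?divr_gt0// mul0r addr0.
  have t0 : 0 < t by apply: lt_trans tr; rewrite divr_gt0.
  have := ramp_ge0 (r / 2) t; have := ramp_le1 (r / 2) t; rewrite /lam.
  move: (ramp (r / 2) t) => x x1 x0.
  rewrite (_ : _ + _ = (1 - x) + x * t); last by ring.
  have [->|xn0] := eqVneq x 0; first by rewrite subr0 mul0r addr0.
  by rewrite ltr_wpDl ?subr_ge0// mulr_gt0// lt0r xn0.
rewrite (_ : far_kernel b r = fun t => lam t `^ (- b) * ramp r t).
  apply: (@smoothM R (fun t => lam t `^ (- b)) _ _ (@smooth_ramp r)).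
  apply: smooth_powR => //; apply: (smoothD (f := fun=> 1)); first exact: smooth_cst.
  apply: (@smoothM R _ (fun t => t - 1) (@smooth_ramp _)).
  exact: (smoothD (@smooth_id R) (@smooth_cst R _)).
apply/funext => t; rewrite /far_kernel; have [tr|tr] := leP t r.
  by rewrite ramp_eq0// !mulr0.
have t0 : 0 < t by apply: lt_trans tr.
rewrite /pker t0 /lam (@ramp_eq1 (r / 2))//; first by rewrite mul1r addrC subrK.
  by rewrite divr_gt0.
by lra.
Qed.

(** Beyond 2 r the kernel is a pure power. Only the exponent is of interest, so the product of
    falling factors stays hidden in [c]. *)
Lemma far_kernel_tail b r n : 0 < r -> exists c : R, forall t, r + r < t ->
  derive1n n (far_kernel b r) t = c * t `^ (- b - n%:R).
Proof.
move=> r0; elim: n => [|n [c IH]].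
  exists 1 => t rt; rewrite /= /far_kernel (ramp_eq1 r0 (ltW rt)) mulr1 mul1r subr0.
  by rewrite /pker ifT//; lra.
exists (c * (- b - n%:R)) => t rt; rewrite [LHS]/= derive1E.
have t0 : 0 < t by lra.
have dF : is_derive t 1 (fun t => c * t `^ (- b - n%:R))
    (c * ((- b - n%:R) * t `^ (- b - n%:R - 1))).
  apply: is_derive_eq (is_derive_mul (is_derive_cst c t 1)
    (is_derive1_powR (- b - n%:R) t0)) _.
  by rewrite mul0r add0r.
have : is_derive t 1 (derive1n n (far_kernel b r))
    (c * ((- b - n%:R) * t `^ (- b - n%:R - 1))).
  apply: near_eq_is_derive dF; near=> y; rewrite IH//; near: y.
  exact: lt_nbhsr.
move=> H; rewrite (@derive_val _ _ _ _ _ _ _ H) mulrA.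
by congr (_ * _ `^ _); rewrite -natr1; ring.
Unshelve. all: by end_near. Qed.

Lemma far_kernel_eq0 b r n : 0 < r -> forall t, t < r ->
  derive1n n (far_kernel b r) t = 0.
Proof.
move=> r0; elim: n => [|n IH] t tr.
  by rewrite /= /far_kernel (ramp_eq0 r0 (ltW tr)) mulr0.
rewrite [LHS]/= derive1E.
have : is_derive t 1 (derive1n n (far_kernel b r)) 0.
  apply: (@near_eq_is_derive _ _ _ (cst 0 : R -> R)).
  by near=> y; rewrite IH//; near: y; exact: lt_nbhsl.
by move=> H; exact: (@derive_val _ _ _ _ _ _ _ H).
Unshelve. all: by end_near. Qed.

(** Differentiation is what makes the tail integrable: the derivative of order n + 1 decays like
    t^(-b-n-1), whereas the kernel itself decays only like t^-b. *)
Lemma L1_far_kernel b r n : 0 < b -> 0 < r ->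
  L1 (derive1n n.+1 (far_kernel b r)).
Proof.
move=> b0 r0; have sk := @smooth_derive1n R n.+1 _ (@smooth_far_kernel b r r0).
have ck := smooth_continuous sk.
have [c tailc] := far_kernel_tail b n.+1 r0.
pose k := derive1n n.+1 (far_kernel b r).
have rr0 : 0 < r + r by rewrite addr_gt0.
(* A second ramp, from 2 r to 4 r, separates a continuous function of bounded support from the
   region where the tail formula holds. *)
have -> : derive1n n.+1 (far_kernel b r) =
    fun t => k t * (1 - ramp (r + r) t) + k t * ramp (r + r) t.
  by apply/funext => t; rewrite -mulrDr subrK mulr1.
apply: L1D.
  apply: continuous_bsupp_L1.
    by apply: smooth_continuous; exact: (smoothM sk (@smooth_onem_ramp _)).
  exists (r + r + (r + r)) => t; rewrite ltr_normr => /orP[tr|tr]; last first.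
    by rewrite /k far_kernel_eq0 ?mul0r//; lra.
  by rewrite (@ramp_eq1 (r + r))// ?ltW// subrr mulr0.
apply: (@L1_le _ _ (fun t => `|c| * (r + r) `^ (- n%:R) * far_pker b (r + r) t)).
- apply: measurable_funM; apply: continuous_measurable_fun => //.
  exact/smooth_continuous/smooth_ramp.
- move=> t; have [tr|tr] := leP t (r + r).
    by rewrite ramp_eq0// mulr0 normr0.
  rewrite /k (tailc _ tr) /far_pker (ltW tr).
  have := ramp_ge0 (r + r) t; have := ramp_le1 (r + r) t.
  move: (ramp (r + r) t) => x x1 x0.
  rewrite !normrM normr_id -!mulrA ler_wpM2l// !ger0_norm ?powR_ge0//.
  have t0 : 0 < t by lra.
  rewrite -natr1 (_ : - b - (n%:R + 1) = - n%:R + (-1 - b)); last by ring.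
  rewrite powRD ?(gt_eqF t0) ?implybT// -mulrA.
  apply: ler_pM; rewrite ?powR_ge0//; first by rewrite mulr_ge0 ?powR_ge0.
    rewrite !powRN lef_pV2 ?posrE ?powR_gt0//.
    by apply: ge0_ler_powR; rewrite ?nnegrE// ltW.
  by rewrite ler_piMr ?powR_ge0.
by apply: L1Z; exact: L1_far_pker.
Qed.

End kernels.

(** * The commutator with a cutoff *)

Section commutator.
Context {R : realType}.
Local Notation mu := (@lebesgue_measure R).
Implicit Types (f g phi psi : R -> R).

Lemma near_kernel_le (b r t : R) : 0 < r ->
  `|near_kernel b r t| <= `|near_pker b (r + r) t|.
Proof.
move=> r0; rewrite /near_kernel /near_pker /pker.
case: ifPn => t0 /=; last by rewrite mul0r normr0.
have [tr|tr] := leP t (r + r).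
  rewrite normrM ler_piMr// ger0_norm ?subr_ge0 ?ramp_le1// lerBlDr lerDl.
  exact: ramp_ge0.
by rewrite (ramp_eq1 r0 (ltW tr)) subrr mulr0 normr0.
Qed.

Lemma L1_near_kernel (b r : R) : b < 1 -> 0 < r -> L1 (near_kernel b r).
Proof.
move=> b1 r0; apply: L1_le (fun t => near_kernel_le b t r0) _.
  apply: measurable_funM; first exact: measurable_pker.
  exact: (continuous_measurable_fun (smooth_continuous (@smooth_onem_ramp R r))).
by apply: L1_near_pker => //; rewrite addr_gt0.
Qed.

Lemma near_kernel_neq0 (b r t : R) : 0 < r -> near_kernel b r t != 0 ->
  0 < t < r + r.
Proof.
move=> r0; rewrite /near_kernel /pker; case: ifPn => [t0 |]; last by rewrite mul0r eqxx.
have [tr|tr] := ltP t (r + r); rewrite //= (ramp_eq1 r0 tr).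
by rewrite subrr mulr0 eqxx.
Qed.

(** The pointwise derivative of [near_kernel] on t > 0. For b > 0 it has size t^(-b-1) near 0, so it
    is not integrable without a compensating factor. *)
Definition dnear_kernel (b r t : R) : R := if 0 < t then
  - b * t `^ (- b - 1) * (1 - ramp r t) + t `^ (- b) * - derive1 (ramp r) t
  else 0.

Lemma derive1_ramp_eq0 (r t : R) : 0 < r -> r + r < t -> derive1 (ramp r) t = 0.
Proof.
move=> r0 tr; rewrite derive1E.
have : is_derive t 1 (ramp r) 0.
  apply: (@near_eq_is_derive _ _ _ (cst 1 : R -> R)).
  by near=> y; rewrite ramp_eq1//; apply: ltW; near: y; exact: lt_nbhsr.
by move=> H; exact: (@derive_val _ _ _ _ _ _ _ H).
Unshelve. all: by end_near. Qed.

Lemma derive1_ramp_eq0l (r t : R) : 0 < r -> t < r -> derive1 (ramp r) t = 0.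
Proof.
move=> r0 tr; rewrite derive1E.
have : is_derive t 1 (ramp r) 0.
  apply: (@near_eq_is_derive _ _ _ (cst 0 : R -> R)).
  by near=> y; rewrite ramp_eq0//; apply: ltW; near: y; exact: lt_nbhsl.
by move=> H; exact: (@derive_val _ _ _ _ _ _ _ H).
Unshelve. all: by end_near. Qed.

Lemma is_derive_near_kernel (b r t : R) : 0 < t ->
  is_derive t 1 (near_kernel b r) (dnear_kernel b r t).
Proof.
move=> t0; rewrite /dnear_kernel t0.
apply: (@near_eq_is_derive _ _ _ (fun t => t `^ (- b) * (1 - ramp r t))).
  by near=> y; rewrite /near_kernel /pker ifT//; near: y; exact: lt_nbhsr.
apply: is_derive_mul; first exact: is_derive1_powR.
have := smooth_is_derive t (@smooth_ramp _ r) => dr.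
by apply: is_derive_eq (is_deriveB (is_derive_cst (1 : R) t 1) dr) _; rewrite sub0r.
Unshelve. all: by end_near. Qed.

Lemma measurable_dnear_kernel (b r : R) : measurable_fun setT (dnear_kernel b r).
Proof.
apply: measurable_fun_ifT; last exact: measurable_cst.
  exact: measurable_fun_ltr.
apply: measurable_funD; apply: measurable_funM.
- by apply: measurable_funM => //; exact: (measurable_powR (- b - 1)).
- exact: (continuous_measurable_fun (smooth_continuous (@smooth_onem_ramp R r))).
- exact: (measurable_powR (- b)).
- apply: measurableT_comp => //; apply: continuous_measurable_fun.
  exact: (smooth_continuous (smooth_derive1 (@smooth_ramp R r))).
Qed.

(** One factor t brings the singularity back to t^-b. The constant collects [b] from the power and 2
    r M from the ramp, whose derivative is bounded by M and acts only for t <= 2 r. *)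
Lemma dnear_kernel_le (b r : R) : 0 < b -> 0 < r -> exists2 C, 0 <= C &
  forall t, `|dnear_kernel b r t| * `|t| <= C * near_pker b (r + r) t.
Proof.
move=> b0 r0.
have [_ [M rM]] : bmeas (derive1 (ramp r)).
  apply: continuous_bsupp_bmeas.
    exact: (smooth_continuous (smooth_derive1 (@smooth_ramp R r))).
  exists (r + r) => t; rewrite ltr_normr => /orP[tr|tr].
    exact: derive1_ramp_eq0.
  by apply: derive1_ramp_eq0l => //; lra.
have M0 : 0 <= M := le_trans (normr_ge0 _) (rM 0).
exists (b + (r + r) * M); first by rewrite addr_ge0 ?mulr_ge0 ?addr_ge0// ltW.
move=> t; rewrite /dnear_kernel /near_pker; case: ifPn => t0 /=; last first.
  by rewrite normr0 mul0r mulr0.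
have [tr|tr] := leP t (r + r); last first.
  rewrite (ramp_eq1 r0 (ltW tr)) subrr derive1_ramp_eq0// oppr0 !mulr0 addr0.
  by rewrite normr0 mul0r.
have t1 : t `^ (- b - 1) * t = t `^ (- b).
  rewrite mulrC -{1}(powRr1 (ltW t0)) -powRD ?(gt_eqF t0) ?implybT//.
  by congr (_ `^ _); ring.
rewrite -normrM mulrDl (le_trans (ler_normD _ _))// mulrDl; apply: lerD.
  rewrite mulrAC -[- b * _ * t]mulrA t1 mulNr mulNr normrN -mulrA normrM.
  rewrite (ger0_norm (ltW b0)) (ler_wpM2l (ltW b0))// normrM.
  rewrite (ger0_norm (powR_ge0 _ _)) ler_piMr ?powR_ge0//.
  by rewrite ger0_norm ?subr_ge0 ?ramp_le1// lerBlDr lerDl ramp_ge0.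
rewrite !normrM normrN (ger0_norm (powR_ge0 _ _)) (gtr0_norm t0).
rewrite -mulrA mulrC ler_wpM2r ?powR_ge0// mulrC.
by apply: ler_pM => //; rewrite ltW.
Qed.

Lemma tf_lipschitz psi : tf psi ->
  exists2 M, 0 <= M & forall x y, `|psi x - psi y| <= M * `|x - y|.
Proof.
move=> tpsi; have [spsi _] := tpsi.
have [_ [M dM]] := tf_bmeas (tf_derive1 tpsi).
have M0 : 0 <= M := le_trans (normr_ge0 _) (dM 0).
exists M => //.
have H (x y : R) : x <= y -> `|psi y - psi x| <= M * `|y - x|.
  move=> xy.
  have [c _ ->] := MVT_segment xy (fun z _ => smooth_is_derive z spsi)
    (continuous_subspaceT (smooth_continuous spsi)).
  by rewrite normrM ler_wpM2r.
move=> x y; have [xy|/ltW yx] := leP x y; last exact: H.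
by rewrite distrC [X in M * X]distrC; exact: H.
Qed.

Lemma derivable_add f g (x : R) : derivable f x 1 -> derivable g x 1 ->
  derivable (fun y => f y + g y) x 1.
Proof. exact: derivableD. Qed.

Lemma derivable_mul f g (x : R) : derivable f x 1 -> derivable g x 1 ->
  derivable (fun y => f y * g y) x 1.
Proof. exact: derivableM. Qed.

(** The bound |B t| <= M |t| makes the product with the derivative of k0 integrable, and the
    boundary term k0 B = O(t^(1-b)) vanish at the origin. *)
Lemma near_kernel_ibp (b r : R) (B : R -> R) : 0 < b -> b < 1 -> 0 < r -> tf B ->
  (exists M, forall t, `|B t| <= M * `|t|) ->
  [/\ L1 (fun t => dnear_kernel b r t * B t),
      L1 (fun t => near_kernel b r t * derive1 B t) &
      \int[mu]_t (dnear_kernel b r t * B t) =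
      - \int[mu]_t (near_kernel b r t * derive1 B t)].
Proof.
move=> b0 b1 r0 tB [M BM]; have [sB _] := tB.
have rr0 : 0 < r + r by rewrite addr_gt0.
have [C C0 dC] := dnear_kernel_le b0 r0.
have M0 : 0 <= M by have := BM 1; rewrite normr1 mulr1; exact: le_trans.
have L1d : L1 (fun t => dnear_kernel b r t * B t).
  apply: (@L1_le _ _ (fun t => M * C * near_pker b (r + r) t)).
  - apply: measurable_funM; first exact: measurable_dnear_kernel.
    exact: (tf_bmeas tB).1.
  - move=> t; rewrite [leRHS]ger0_norm ?mulr_ge0 ?near_pker_ge0//.
    rewrite normrM (@le_trans _ _ (`|dnear_kernel b r t| * (M * `|t|)))//.
      by rewrite ler_wpM2l.
    by rewrite mulrCA -mulrA ler_wpM2l.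
  - by apply: L1Z; exact: L1_near_pker.
have L1n : L1 (fun t => near_kernel b r t * derive1 B t).
  by apply: L1Ml; [exact: L1_near_kernel|exact/tf_bmeas/tf_derive1].
split => //; apply/eqP; rewrite -subr_eq0 opprK; apply/eqP.
rewrite -Rint_add//.
pose D t := dnear_kernel b r t * B t + near_kernel b r t * derive1 B t.
apply: (@singular_FTC _ (fun t => near_kernel b r t * B t) D (r + r)).
- exact: L1D.
- move=> t t0; apply: is_derive_mul; first exact: is_derive_near_kernel.
  exact: smooth_is_derive.
- move=> t t0; apply/differentiable_continuous/derivable1_diffP.
  have dcst (c : R) : derivable (fun _ : R => c) t 1 by exact: derivable_cst.
  have dpow q : derivable (fun t : R => t `^ q) t 1.
    by apply: derivable_powR; rewrite in_itv/= t0.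
  have dsm f : smooth f -> derivable f t 1 by move=> /(_ 0).
  apply: (@near_eq_derivable _ _ _ (fun t => (- b * t `^ (- b - 1) * (1 - ramp r t)
     + t `^ (- b) * - derive1 (ramp r) t) * B t +
     (t `^ (- b) * (1 - ramp r t)) * derive1 B t)).
    near=> y; have y0 : 0 < y by near: y; exact: lt_nbhsr.
    by rewrite /D /dnear_kernel /near_kernel /pker y0.
  have d1r := dsm _ (@smooth_onem_ramp R r).
  have dd := derivableN (dsm _ (smooth_derive1 (@smooth_ramp R r))).
  apply: (derivable_add (derivable_mul (derivable_add (derivable_mul
    (derivable_mul (dcst _) (dpow _)) d1r) (derivable_mul (dpow _) dd)) _)
    (derivable_mul (derivable_mul (dpow _) d1r) _)).
    exact: dsm.
  exact/dsm/smooth_derive1.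
- move=> t t0; rewrite /D /dnear_kernel /near_kernel /pker ltNge t0 /=.
  by rewrite !mul0r addr0.
- move=> t tr; have [->|/(near_kernel_neq0 r0)] := eqVneq (near_kernel b r t) 0.
    by rewrite mul0r.
  by rewrite [t < _]ltNge tr andbF.
apply: norm_cvg0.
apply: (@squeeze_cvgr _ _ _ _ (cst 0) (fun n => M * n.+1%:R^-1 `^ (1 - b))).
- near=> n; rewrite normr_ge0 /=.
  have t0 : 0 < n.+1%:R^-1 :> R by rewrite invr_gt0.
  move: (n.+1%:R^-1) t0 => t t0; rewrite normrM mulrC.
  have -> : t `^ (1 - b) = t * t `^ (- b).
    by rewrite -{2}(powRr1 (ltW t0)) -powRD ?(gt_eqF t0) ?implybT.
  rewrite mulrA; apply: ler_pM => //.
    by have := BM t; rewrite (gtr0_norm t0).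
  rewrite /near_kernel /pker t0 normrM (ger0_norm (powR_ge0 _ _)) ler_piMr ?powR_ge0//.
  by rewrite ger0_norm ?subr_ge0 ?ramp_le1// lerBlDr lerDl ramp_ge0.
- exact: cvg_cst.
rewrite -[X in _ --> X](mulr0 M); apply: cvgMr.
have b10 : 0 < 1 - b by rewrite subr_gt0.
apply: ((cvg_at_rightP _ _ _).1 (powR_cvg0 b10)); split => [n|]; first by rewrite invr_gt0.
exact: cvg_harmonic.
Unshelve. all: by end_near. Qed.

(* The singularity [t^(- b - 1)] of the first factor is tamed by the factor
   [psi x - psi (x - e t) = O(t)]. *)
Definition comm_kernel (e b r : R) psi (x t : R) : R :=
  e * (dnear_kernel b r t * (psi x - psi (x - e * t))).

Lemma measurable_comm_kernel (e b r : R) psi : tf psi ->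
  measurable_fun setT (fun z : R * R => comm_kernel e b r psi z.1 z.2).
Proof.
move=> tpsi; have mpsi := (tf_bmeas tpsi).1.
apply: measurable_funM; first exact: measurable_cst.
apply: measurable_funM.
  exact: (measurableT_comp (measurable_dnear_kernel b r) measurable_snd).
apply: measurable_funB; first exact: (measurableT_comp mpsi).
apply: (measurableT_comp mpsi).
have := @measurable_shear R (- e).
by congr measurable_fun; apply/funext => z; rewrite mulNr.
Qed.

Lemma comm_kernel_le (e b r : R) psi : e = 1 \/ e = -1 -> 0 < b -> b < 1 ->
  0 < r -> tf psi -> exists2 H, L1 H & forall x t, `|comm_kernel e b r psi x t| <= H t.
Proof.
move=> e1 b0 b1 r0 tpsi.
have [C C0 dC] := dnear_kernel_le b0 r0.
have [M M0 pM] := tf_lipschitz tpsi.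
have ne : `|e| = 1 by case: e1 => ->; rewrite ?normrN normr1.
exists (fun t => M * C * near_pker b (r + r) t).
  by apply: L1Z; apply: L1_near_pker => //; rewrite addr_gt0.
move=> x t; rewrite /comm_kernel normrM ne mul1r normrM.
have := pM x (x - e * t); rewrite subKr normrM ne mul1r => h.
rewrite (@le_trans _ _ (`|dnear_kernel b r t| * (M * `|t|)))//.
  by rewrite ler_wpM2l.
by rewrite mulrCA -mulrA ler_wpM2l.
Qed.

Lemma conv_commutator (e b r : R) psi phi (x : R) : e = 1 \/ e = -1 ->
  0 < b -> b < 1 -> 0 < r -> tf psi -> tf phi ->
  psi x * conv e (near_kernel b r) (derive1 phi) x =
  conv e (near_kernel b r) (derive1 (fun y => psi y * phi y)) x +
  \int[mu]_t (comm_kernel e b r psi x t * phi (x - e * t)).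
Proof.
move=> e1 b0 b1 r0 tpsi tphi; have [spsi _] := tpsi; have [sphi _] := tphi.
have ee : e * e = 1 by case: e1 => ->; rewrite ?mulrNN mulr1.
have lk := L1_locL1 (L1_near_kernel b1 r0).
(* [B] vanishes at t = 0, so it can be integrated by parts against the singular kernel; up to the
   sign [e], its derivative is the difference of the integrands of the two convolutions. *)
pose B t := (psi x - psi (x - e * t)) * phi (x - e * t).
have daff (t : R) : is_derive t 1 (fun t => x - e * t) (- e).
  apply: is_derive_eq (is_deriveB (is_derive_cst x _ _)
    (is_deriveZ e (is_derive_id _ _))) _.
  by rewrite /GRing.scale/= mulr1 sub0r.
have dcomp f (t : R) : smooth f ->
    is_derive t 1 (fun t => f (x - e * t)) (derive1 f (x - e * t) * - e).
  by move=> sf; exact: (@is_derive_comp R f (fun t => x - e * t) t _ _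
    (smooth_is_derive (x - e * t) sf) (daff t)).
have dB : derive1 B = fun t => e * (derive1 psi (x - e * t) * phi (x - e * t)
    - (psi x - psi (x - e * t)) * derive1 phi (x - e * t)).
  apply: is_derive_fun => t.
  have dA : is_derive t 1 (fun t => psi x - psi (x - e * t))
      (0 - derive1 psi (x - e * t) * - e).
    exact: is_deriveB (is_derive_cst (psi x) t 1) (dcomp _ t spsi).
  apply: is_derive_eq (is_derive_mul dA (dcomp _ t sphi)) _.
  by ring.
have tB : tf B.
  have [sr _] := tf_refl x e1 tpsi.
  have sA : smooth (fun t => psi x - psi (x - e * t)).
    rewrite (_ : (fun t => _) = fun t => psi x + -1 * psi (x - e * t)).
      by apply: smoothD (@smooth_cst R (psi x)) _; exact: (smoothM (@smooth_cst R (-1)) sr).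
    by apply/funext => t; rewrite mulN1r.
  exact: (tfM sA (tf_refl x e1 tphi)).
have [M M0 pM] := tf_lipschitz tpsi.
have [_ [M' phiM]] := tf_bmeas tphi.
have BM : exists M, forall t, `|B t| <= M * `|t|.
  exists (M * M') => t; rewrite /B normrM mulrAC ler_pM//.
  have := pM x (x - e * t); rewrite subKr normrM.
  by have -> : `|e| = 1 by [case: e1 => ->; rewrite ?normrN normr1]; rewrite mul1r.
have [Ld Ln EB] := near_kernel_ibp b0 b1 r0 tB BM.
have -> : \int[mu]_t (comm_kernel e b r psi x t * phi (x - e * t)) =
    \int[mu]_t (- e * (near_kernel b r t * derive1 B t)).
  rewrite (Rint_scale (- e) Ln) mulNr -mulrN -EB -(Rint_scale e Ld).
  by apply: eq_Rintegral => t _; rewrite /comm_kernel /B; ring.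
have L2 := locL1_mul x e1 lk (tf_derive1 tphi).
have L3 := locL1_mul x e1 lk (tf_derive1 (tfM spsi tphi)).
have E2 : psi x * conv e (near_kernel b r) (derive1 phi) x =
    \int[mu]_t (psi x * (near_kernel b r t * derive1 phi (x - e * t))).
  by rewrite (Rint_scale (psi x) L2).
rewrite E2 /conv -(Rint_add L3 (L1Z (- e) Ln)).
apply: eq_Rintegral => t _; rewrite dB.
have -> : derive1 (fun y => psi y * phi y) =
    fun y => derive1 psi y * phi y + psi y * derive1 phi y.
  by apply: is_derive_fun => y; apply: is_derive_mul; exact: smooth_is_derive.
have -> : - e * (near_kernel b r t * (e * (derive1 psi (x - e * t) * phi (x - e * t)
    - (psi x - psi (x - e * t)) * derive1 phi (x - e * t)))) = - (e * e) *
   (near_kernel b r t * (derive1 psi (x - e * t) * phi (x - e * t)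
    - (psi x - psi (x - e * t)) * derive1 phi (x - e * t))) by ring.
by rewrite ee; ring.
Qed.

End commutator.

(** * Fractional derivatives as convolutions *)

Section fractional.
Context {R : realType}.
Local Notation mu := (@lebesgue_measure R).
Implicit Types (f g phi psi : R -> R).

Definition sgn (s : side) : R := match s with Left => 1 | Right => -1 end.

Lemma sgnP s : sgn s = 1 \/ sgn s = -1.
Proof. by case: s; [left|right]. Qed.

(** As [phi] vanishes off [Omega], the restriction of the integral to [Omega] is invisible: the
    operators of the interval and of the line coincide on such functions. *)
Lemma fracI_conv s (Omega : set R) (b : R) phi : tf phi ->
  (forall x, ~ Omega x -> phi x = 0) ->
  fracI s Omega (1 - b) phi = fun x => (Gamma (1 - b))^-1 * conv (sgn s) (pker b) phi x.
Proof.
move=> tphi phi0; apply/funext => x; have [mphi _] := tf_bmeas tphi.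
case: s => /=; congr (_ * _); rewrite Rintegral_mkcond /conv.
- rewrite -[RHS](Rint_aff (e := -1) x); last 2 first.
    by right.
    apply: measurable_funM; first exact: measurable_pker.
    apply: (measurableT_comp mphi).
    by apply: measurable_funB => //; exact: mulrl_measurable.
  apply: eq_Rintegral => y _; rewrite patchE mul1r.
  rewrite (_ : x - (-1 * y + x) = y); last by ring.
  rewrite (_ : -1 * y + x = x - y); last by ring.
  case: ifPn => [|/negP yO].
    rewrite inE /= in_itv/= => -[Oy yx].
    by rewrite /pker subr_gt0 yx subKr powRN mulrC.
  have [->|phiy] := eqVneq (phi y) 0; first by rewrite mulr0.
  rewrite /pker subr_gt0 ifF ?mul0r//; apply/negP => yx; apply: yO.
  rewrite inE /= in_itv/=; split => //.
  by apply: contrapT => /phi0 /eqP; exact/negP.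
- rewrite -[RHS](Rint_aff (e := 1) (- x)); last 2 first.
    by left.
    apply: measurable_funM; first exact: measurable_pker.
    apply: (measurableT_comp mphi).
    by apply: measurable_funB => //; exact: mulrl_measurable.
  apply: eq_Rintegral => y _; rewrite patchE mul1r mulN1r opprK.
  rewrite [x + _]addrC subrK; case: ifPn => [|/negP yO].
    rewrite inE /= in_itv/= andbT => -[Oy yx].
    by rewrite /pker subr_gt0 yx subKr powRN mulrC.
  have [->|phiy] := eqVneq (phi y) 0; first by rewrite mulr0.
  rewrite /pker subr_gt0 ifF ?mul0r//; apply/negP => yx; apply: yO.
  rewrite inE /= in_itv/= andbT; split => //.
  by apply: contrapT => /phi0 /eqP; exact/negP.
Qed.

Lemma frac_part_itv (alpha : R) : 0 < alpha -> alpha \isn't a Num.nat ->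
  0 < alpha - (Num.truncn alpha)%:R < 1.
Proof.
move=> a0 aN; have /andP[ta at_] := truncn_itv (ltW a0).
rewrite subr_gt0 lt_neqAle ta andbT ltrBlDr addrC natr1 at_ andbT.
by apply: contra aN => /eqP <-.
Qed.

Lemma derive1n_scale (c : R) f n : smooth f ->
  derive1n n (fun x => c * f x) = fun x => c * derive1n n f x.
Proof.
move=> sf; elim: n => [//|n IH]; rewrite [LHS]/= IH.
apply: is_derive_fun => x.
have := is_derive_mul (is_derive_cst c x 1)
  (smooth_is_derive x (@smooth_derive1n R n _ sf)).
by rewrite mul0r add0r.
Qed.

(** The constant is fixed before [Omega], so that the same one serves the interval and the line. *)
Lemma fracD_conv s (alpha : R) : 0 < alpha -> alpha \isn't a Num.nat ->
  exists c : R, forall (Omega : set R) phi, tf phi ->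
  (forall x, ~ Omega x -> phi x = 0) ->
  fracD s Omega alpha phi = fun x => c *
    conv (sgn s) (pker (alpha - (Num.truncn alpha)%:R))
      (derive1n (Num.truncn alpha).+1 phi) x.
Proof.
move=> a0 aN; have /andP[b0 b1] := frac_part_itv a0 aN.
set m := Num.truncn alpha in b0 b1 *; set b := alpha - m%:R in b0 b1 *.
have nb : m.+1%:R - alpha = 1 - b by rewrite /b -natr1; ring.
(* The value of [Gamma] never matters: were it [0], [c] would be [0] too. *)
exists (match s with Left => (Gamma (1 - b))^-1
  | Right => (-1) ^+ m.+1 * (Gamma (1 - b))^-1 end) => Omega phi tphi phi0.
have lk := locL1_pker b1.
rewrite /fracD (negbTE aN) -/m nb (fracI_conv s b tphi phi0); cbv zeta.
rewrite derive1n_scale; last by apply: conv_smooth lk tphi; exact: sgnP.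
rewrite (conv_derive1n _ (sgnP s) lk tphi).
by case: s => //; apply/funext => x; rewrite mulrA.
Qed.

End fractional.

(** * Uniqueness of weak derivatives *)

Section uniqueness.
Context {R : realType}.
Local Notation mu := (@lebesgue_measure R).
Implicit Types (f g v w phi psi : R -> R) (Omega : set R).

Lemma test_fun_tf Omega phi : test_fun Omega phi -> tf phi.
Proof.
move=> [sphi cK _]; split => //.
have [M [_ HM]] := compact_bounded cK; exists (`|M| + 1) => x Mx.
apply: contrapT => /eqP phix; move: Mx; apply/negP; rewrite -leNgt.
apply: (HM (`|M| + 1)); first by rewrite (le_lt_trans (ler_norm _))// ltrDl.
exact: subset_closure.
Qed.

Lemma test_fun_out Omega phi : test_fun Omega phi ->
  forall x, ~ Omega x -> phi x = 0.
Proof.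
move=> [_ _ KO] x nOx; apply: contrapT => /eqP phix; apply: nOx; apply: KO.
exact: subset_closure.
Qed.

Lemma smooth_test_fun Omega phi (c d : R) : smooth phi -> `[c, d]%classic `<=` Omega ->
  (forall x, x \notin `[c, d] -> phi x = 0) -> test_fun Omega phi.
Proof.
move=> sphi cdO phi0.
have cl : closure [set x | phi x != 0] `<=` `[c, d]%classic.
  have /closure_id -> : closed `[c, d]%classic by exact: itv_closed.
  apply: closure_subset => x /= phix; apply: contrapT => /negP xcd.
  by move: phix; rewrite phi0// eqxx.
split => //; last exact: subset_trans cl cdO.
apply: subclosed_compact cl; first exact: closed_closure.
exact: segment_compact.
Qed.

Lemma test_fun_derive1 Omega phi : test_fun Omega phi -> test_fun Omega (derive1 phi).
Proof.
move=> [sphi cK KO].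
have cl : closure [set x | derive1 phi x != 0] `<=` closure [set x | phi x != 0].
  have /closure_id -> : closed (closure [set x | phi x != 0]) by exact: closed_closure.
  apply: closure_subset => x /= dphi; apply: contrapT => nx.
  have : is_derive x 1 phi 0.
    apply: (@near_eq_is_derive _ _ _ (cst 0 : R -> R)).
    have xC : nbhs x (~` closure [set x | phi x != 0]).
      apply: open_nbhs_nbhs; split => //.
      by rewrite openC; exact: closed_closure.
    apply: filterS xC => y /= yC; apply/esym/eqP; apply: contrapT => /negP phiy.
    by apply: yC; exact: subset_closure.
  move=> H; move: dphi; rewrite derive1E.
  by rewrite (@derive_val _ _ _ _ _ _ _ H) eqxx.
split; first exact: smooth_derive1.
  by apply: subclosed_compact cl => //; exact: closed_closure.
exact: subset_trans cl KO.
Qed.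

Lemma Rint_restrict Omega v phi :
  \int[mu]_(x in Omega) (v x * phi x) = \int[mu]_x ((v \_ Omega) x * phi x).
Proof.
rewrite Rintegral_mkcond; apply: eq_Rintegral => x _.
by rewrite !patchE; case: ifPn => //; rewrite mul0r.
Qed.

Lemma locint_integrable Omega v K : locally_integrable Omega v -> compact K ->
  K `<=` Omega -> mu.-integrable K (EFin \o v).
Proof.
move=> [mv oO vK] cK KO; have mK := compact_measurable cK.
have mvK : measurable_fun K v by apply: measurable_funS mv => //; exact: open_measurable.
by apply/integrableP; split; [exact/measurable_EFinP|exact: vK].
Qed.

Lemma locint_L1 Omega v K : locally_integrable Omega v -> compact K -> K `<=` Omega ->
  L1 (v \_ K).
Proof.
move=> lv cK KO; have Iv := locint_integrable lv cK KO.
rewrite /L1 (_ : EFin \o (v \_ K) = (EFin \o v) \_ K); last first.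
  by apply/funext => x; rewrite /= !patchE; case: ifPn.
by apply/(integrable_mkcond _ _).1 => //; exact: compact_measurable.
Qed.

Lemma locint_test_L1 Omega v phi : locally_integrable Omega v -> test_fun Omega phi ->
  L1 (fun x => (v \_ Omega) x * phi x).
Proof.
move=> lv tphi; have [sphi cK KO] := tphi.
set K := closure _ in cK KO.
have -> : (fun x => (v \_ Omega) x * phi x) = (fun x => (v \_ K) x * phi x).
  apply/funext => x; have [->|phix] := eqVneq (phi x) 0; first by rewrite !mulr0.
  have Kx : K x by exact: subset_closure.
  by rewrite !patchE !ifT// inE//; exact: KO.
by apply: L1Ml; [exact: locint_L1 lv cK KO|exact/tf_bmeas/test_fun_tf/tphi].
Qed.

Lemma near_bump_eq1 (c d x : R) : c < x -> x < d ->
  \forall n \near \oo, bump n.+1%:R^-1 c d x = 1.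
Proof.
move=> cx xd; have xc0 : 0 < x - c by rewrite subr_gt0.
have dx0 : 0 < d - x by rewrite subr_gt0.
near=> n; apply: bump_eq1; first by rewrite invr_gt0.
have h1 : n.+1%:R^-1 < x - c by near: n; exact: near_infty_natSinv_lt (PosNum xc0).
have h2 : n.+1%:R^-1 < d - x by near: n; exact: near_infty_natSinv_lt (PosNum dx0).
move: (n.+1%:R^-1) h1 h2 => e h1 h2.
by rewrite in_itv/=; apply/andP; split; lra.
Unshelve. all: by end_near. Qed.

(** Bumps with shrinking transition layers converge pointwise to the indicator of ]c, d[; dominated
    convergence passes to the limit. *)
Lemma vanishing_integral Omega w (c d : R) : locally_integrable Omega w ->
  (forall phi, test_fun Omega phi -> \int[mu]_(x in Omega) (w x * phi x) = 0) ->
  `[c, d]%classic `<=` Omega -> \int[mu]_(x in `]c, d[) w x = 0.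
Proof.
move=> lw w0 cdO.
have Icd : L1 (w \_ `[c, d]) by apply: locint_L1 lw _ cdO; exact: segment_compact.
pose h (n : nat) x := (w \_ `[c, d]) x * bump n.+1%:R^-1 c d x.
have e0 n : 0 < n.+1%:R^-1 :> R by rewrite invr_gt0.
have mb n : measurable_fun setT (bump n.+1%:R^-1 c d).
  exact: (continuous_measurable_fun (smooth_continuous (@smooth_bump R _ _ _))).
have test n : test_fun Omega (bump n.+1%:R^-1 c d).
  apply: (smooth_test_fun _ cdO) => [|x xcd]; first exact: smooth_bump.
  by apply: bump_eq0 => //; apply: contra xcd; exact: subset_itv_oo_cc.
have inth n : \int[mu]_x h n x = 0.
  rewrite -(w0 _ (test n)) Rint_restrict; apply: eq_Rintegral => x _.
  rewrite /h; have [->|bx] := eqVneq (bump n.+1%:R^-1 c d x) 0; first by rewrite !mulr0.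
  have xcd : x \in `]c, d[ by apply: contra_neqT bx => xcd; exact: bump_eq0.
  have xcd' : `[c, d]%classic x by exact: subset_itv_oo_cc.
  by rewrite !patchE !ifT// inE//; exact: cdO.
have mcd : measurable_fun setT (w \_ `]c, d[).
  have -> : w \_ `]c, d[ = (w \_ `[c, d]) \_ `]c, d[.
    apply/funext => x; rewrite !patchE; case: ifPn => //; rewrite inE /= => xcd.
    by rewrite ifT// inE /=; exact: subset_itv_oo_cc.
  apply/(measurable_restrictT _ _).1 => //; apply: measurable_funTS.
  exact: L1_meas.
have hcvg : {ae mu, forall x, setT x ->
    (h n x)%:E @[n --> \oo] --> (EFin \o (w \_ `]c, d[)) x}.
  apply: aeW => x _; apply: cvg_near_cst.
  have [xcd|xcd] := boolP (x \in `]c, d[); last first.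
    near=> n; rewrite /h bump_eq0// mulr0 /= patchE ifN//.
    by apply: contra xcd; rewrite inE.
  have /andP[cx xd] := xcd.
  near=> n; rewrite /h /= !patchE !ifT ?inE//=; last exact: subset_itv_oo_cc.
  by congr (_%:E); rewrite -[RHS]mulr1; congr (_ * _); near: n; exact: near_bump_eq1.
have hle : {ae mu, forall x n, setT x ->
    (`|(h n x)%:E| <= (EFin \o (fun x => `|(w \_ `[c, d]) x|%R)) x)%E}.
  apply: aeW => x n _; rewrite /h /= lee_fin normrM ler_piMr//.
  by rewrite ger0_norm ?bump_ge0 ?bump_le1.
have [_ _ cvgI] := @dominated_convergence _ _ _ mu setT measurableT
  (fun n x => (h n x)%:E) (EFin \o (w \_ `]c, d[)) _
  (fun n => (measurable_EFinP _ _).2 (measurable_funM (L1_meas Icd) (mb n)))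
  ((measurable_EFinP _ _).2 mcd) hcvg (L1_norm Icd) hle.
rewrite Rintegral_mkcond {1}/Rintegral.
suff -> : (\int[mu]_x (EFin \o (w \_ `]c, d[)) x)%E = 0%E by [].
apply: (cvg_unique _ cvgI) => //; apply: cvg_near_cst; near=> n.
have Lh : L1 (h n).
  apply: L1Ml => //; split; first exact: mb.
  by exists 1 => x; rewrite ger0_norm ?bump_ge0 ?bump_le1.
have := inth n; rewrite /Rintegral => /eqP.
rewrite fine_eq0 ?(integrable_fin_num measurableT Lh)// => /eqP.
by [].
Unshelve. all: by end_near. Qed.

(** By Lebesgue differentiation [w] is almost everywhere the derivative of its primitive, and that
    primitive is 0 throughout ]c, d[. *)
Lemma vanishing_ae Omega w (c d : R) : locally_integrable Omega w ->
  (forall phi, test_fun Omega phi -> \int[mu]_(x in Omega) (w x * phi x) = 0) ->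
  `[c, d]%classic `<=` Omega -> {ae mu, forall x, c < x < d -> w x = 0}.
Proof.
move=> lw w0 cdO.
have Icd : L1 (w \_ `[c, d]) by apply: locint_L1 lw _ cdO; exact: segment_compact.
have Iw := locint_integrable lw (@segment_compact _ c d) cdO.
have lcd : locally_integrable setT (w \_ `[c, d]).
  by apply: open_integrable_locally => //; exact: openT.
have := @FTC1Ny R (w \_ `[c, d]).
move=> /(_ _ lcd) ftc.
have Iy y : mu.-integrable `]-oo, y] (EFin \o (w \_ `[c, d])).
  by apply: integrableS Icd.
have {}ftc := ftc Iy.
apply: (ae_imp ftc) => x [_ Fx] /andP[cx xd].
have -> : w x = (w \_ `[c, d]) x.
  by rewrite patchE ifT// inE /= in_itv/= !ltW.
rewrite -Fx derive1E.
have : is_derive x 1 (fun x => \int[mu]_(t in `]-oo, x]) (w \_ `[c, d]) t) 0.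
  apply: (@near_eq_is_derive _ _ _ (cst 0 : R -> R)).
  near=> y; have cy : c < y by near: y; exact: lt_nbhsr.
  have yd : y < d by near: y; exact: lt_nbhsl.
  have cyO : `[c, y]%classic `<=` Omega.
    apply: subset_trans cdO => z /=; rewrite !in_itv/= => /andP[-> zy].
    by rewrite (le_trans zy)// ltW.
  rewrite /= -(vanishing_integral lw w0 cyO).
  rewrite Rintegral_itv_obnd_cbnd; last first.
    apply: integrableS Iw => // z /=; rewrite !in_itv/= => /andP[cz zy].
    by rewrite !ltW// (lt_trans zy).
  rewrite Rintegral_itv_bndo_bndc; last first.
    apply: integrableS Iw => // z /=; rewrite !in_itv/= => /andP[cz zy].
    by rewrite cz ltW// (lt_trans zy).
  rewrite Rintegral_mkcond [RHS]Rintegral_mkcond; apply: eq_Rintegral => z _.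
  rewrite !patchE !mem_setE !in_itv/=; case: (leP z y) => zy; last by rewrite andbF.
  by rewrite andbT (le_trans zy (ltW yd)) andbT.
by move=> H; exact: (@derive_val _ _ _ _ _ _ _ H).
Unshelve. all: by end_near. Qed.

(** Countably many closed intervals reduce an almost everywhere statement to one interval at a time;
    the bounded interval and the line are both of this kind. *)
Definition exhaustible Omega := open Omega /\ exists c d : nat -> R,
  (forall n, `[c n, d n]%classic `<=` Omega) /\
  (forall x, Omega x -> exists n, c n < x < d n).

(** The fundamental lemma of the calculus of variations. *)
Lemma vanishing Omega w : exhaustible Omega -> locally_integrable Omega w ->
  (forall phi, test_fun Omega phi -> \int[mu]_(x in Omega) (w x * phi x) = 0) ->
  {ae mu, forall x, Omega x -> w x = 0}.
Proof.
move=> [oO [c [d [cdO Ocd]]]] lw w0.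
have /ae_foralln H : forall n, {ae mu, forall x, c n < x < d n -> w x = 0}.
  by move=> n; exact: vanishing_ae lw w0 (cdO n).
by apply: (ae_imp H) => x Hx /Ocd[n]; exact: Hx.
Qed.

Lemma weak_unique Omega v w : exhaustible Omega ->
  locally_integrable Omega v -> locally_integrable Omega w ->
  (forall phi, test_fun Omega phi ->
    \int[mu]_(x in Omega) (v x * phi x) = \int[mu]_(x in Omega) (w x * phi x)) ->
  {ae mu, forall x, Omega x -> v x = w x}.
Proof.
move=> eO lv lw vw.
have lvw : locally_integrable Omega (fun x => v x - w x).
  exact: (locally_integrableB lv lw).
have H := vanishing eO lvw _.
apply: (ae_imp (H _)) => [phi tphi|x Hx Ox].
  have Lv := locint_test_L1 lv tphi; have Lw := locint_test_L1 lw tphi.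
  have E := vw _ tphi; rewrite (Rint_restrict Omega v) (Rint_restrict Omega w) in E.
  rewrite (Rint_restrict Omega (fun x => v x - w x)); transitivity (\int[mu]_x ((v \_ Omega) x * phi x) +
      -1 * \int[mu]_x ((w \_ Omega) x * phi x)); last by rewrite E mulN1r subrr.
  rewrite -(Rint_scale (-1) Lw) -(Rint_add Lv (L1Z (-1) Lw)).
  by apply: eq_Rintegral => x _; rewrite !patchE; case: ifPn => _ /=; rewrite ?mul0r; ring.
by apply/eqP; rewrite -subr_eq0 Hx.
Qed.

Lemma exhaustible_itv (a b : R) : exhaustible `]a, b[.
Proof.
split; first exact: itv_open.
exists (fun n => a + n.+1%:R^-1), (fun n => b - n.+1%:R^-1); split.
  have e0 n : 0 < n.+1%:R^-1 :> R by rewrite invr_gt0.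
  move=> n x; rewrite /= !in_itv/= => /andP[ax xb]; have := e0 n.
  by move: (n.+1%:R^-1) ax xb => e ax xb e0'; apply/andP; split; lra.
move=> x; rewrite /= in_itv/= => /andP[ax xb].
suff : \forall n \near \oo, a + n.+1%:R^-1 < x < b - n.+1%:R^-1.
  by move=> [n _ Hn]; exists n; apply: Hn => /=.
have xa0 : 0 < x - a by rewrite subr_gt0.
have bx0 : 0 < b - x by rewrite subr_gt0.
near=> n.
have h1 : n.+1%:R^-1 < x - a by near: n; exact: near_infty_natSinv_lt (PosNum xa0).
have h2 : n.+1%:R^-1 < b - x by near: n; exact: near_infty_natSinv_lt (PosNum bx0).
by move: (n.+1%:R^-1) h1 h2 => e h1 h2; apply/andP; split; lra.
Unshelve. all: by end_near. Qed.

Lemma exhaustible_setT : exhaustible setT.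
Proof.
split; first exact: openT.
exists (fun n => - n%:R), (fun n => n%:R); split => // x _.
exists (Num.truncn `|x|).+1; rewrite -ltr_norml.
by have /andP[_ ->] := truncn_itv (normr_ge0 x).
Qed.

Lemma ae_Lp_norm Omega (p : R) v w : measurable Omega ->
  measurable_fun Omega v -> measurable_fun Omega w ->
  {ae mu, forall x, Omega x -> v x = w x} ->
  ('N[mu]_p%:E[EFin \o (v \_ Omega)] = 'N[mu]_p%:E[EFin \o (w \_ Omega)])%E.
Proof.
move=> mO mv mw vw.
have mr f : measurable_fun Omega f ->
    measurable_fun setT (fun x => (`|(f \_ Omega) x| `^ p)%:E).
  move=> mf; apply/measurable_EFinP; apply: (measurableT_comp (measurable_powR p)).
  by apply: measurableT_comp => //; apply/(measurable_restrictT _ _).1.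
have E f : ('N[mu]_p%:E[EFin \o (f \_ Omega)] =
    (\int[mu]_x (`|(f \_ Omega) x| `^ p)%:E) `^ p^-1)%E by rewrite unlock.
rewrite !E; congr (_ `^ _)%E.
apply: ae_eq_integral; [exact: measurableT|exact: mr|exact: mr|].
apply: (ae_imp vw) => x vwx _; rewrite !patchE; case: ifPn => //.
by rewrite inE => /vwx ->.
Qed.

End uniqueness.

(** * The Leibniz formula for weak derivatives *)

Section product_rule.
Context {R : realType}.
Local Notation mu := (@lebesgue_measure R).
Implicit Types (f g F phi psi : R -> R) (U : nat -> R -> R).

(* With [U k] standing for the k-th weak derivative of [u]: [prodD n i j] is the
   Leibniz expansion of [(psi^(i) u^(j))^(n)], [restD n i j] is that expansion
   without its last term [psi^(i) u^(j+n)], and [drestD] the derivative of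
   [restD]. *)
Fixpoint prodD psi U (n i j : nat) (x : R) : R :=
  match n with
  | 0 => derive1n i psi x * U j x
  | n'.+1 => prodD psi U n' i.+1 j x + prodD psi U n' i j.+1 x
  end.

Fixpoint restD psi U (n i j : nat) (x : R) : R :=
  match n with
  | 0 => 0
  | n'.+1 => prodD psi U n' i.+1 j x + restD psi U n' i j.+1 x
  end.

Fixpoint drestD psi U (n i j : nat) (x : R) : R :=
  match n with
  | 0 => 0
  | n'.+1 => prodD psi U n'.+1 i.+1 j x + drestD psi U n' i j.+1 x
  end.

Lemma prodD_restD psi U n i j x :
  prodD psi U n i j x = derive1n i psi x * U (j + n)%N x + restD psi U n i j x.
Proof.
elim: n i j => [|n IH] i j; first by rewrite addn0 addr0.
rewrite /= (IH i j.+1) addrCA; congr (_ * U _ _ + _).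
by rewrite addSn addnS.
Qed.

Lemma prodD_L1 psi U n i j : tf psi ->
  (forall k, (k <= j + n)%N -> L1 (U k)) -> L1 (prodD psi U n i j).
Proof.
move=> tpsi; elim: n i j => [|n IH] i j IU.
  have := L1Ml (IU j (leq_addr _ _)) (tf_bmeas (tf_derive1n i tpsi)).
  by congr (is_true (L1 _)); apply/funext => x; rewrite mulrC.
apply: L1D; apply: IH => k kn; apply: IU.
  by rewrite addnS leqW.
by rewrite addnS -addSn.
Qed.

Lemma drestD_L1 psi U n i j : tf psi ->
  (forall k, (k <= j + n)%N -> L1 (U k)) -> L1 (drestD psi U n i j).
Proof.
move=> tpsi; elim: n i j => [|n IH] i j IU.
  exact: integrable0.
apply: L1D; first exact: prodD_L1.
by apply: IH => k kn; apply: IU; rewrite addnS -addSn.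
Qed.

Lemma restD_L1 psi U n i j : tf psi ->
  (forall k, (k <= j + n)%N -> L1 (U k)) -> L1 (restD psi U n i j).
Proof.
move=> tpsi; elim: n i j => [|n IH] i j IU.
  exact: integrable0.
apply: L1D.
  by apply: prodD_L1 => // k kn; apply: IU; rewrite addnS leqW.
by apply: IH => k kn; apply: IU; rewrite addnS -addSn.
Qed.

(** [C] is chosen before [U] and [N]: this order is the source of the uniformity in [u] of the final
    estimate. *)
Lemma prodD_LpB psi (p : R) n i j : 1 <= p -> tf psi -> exists2 C, 0 <= C &
  forall U N, 0 <= N -> (forall k, (k <= j + n)%N -> LpB p (U k) N) ->
    LpB p (prodD psi U n i j) (C * N).
Proof.
move=> p1 tpsi; elim: n i j => [|n IH] i j.
  have [mpsi [M psiM]] := tf_bmeas (tf_derive1n i tpsi).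
  exists M; first exact: le_trans (psiM 0).
  by move=> U N N0 UN; apply: LpBM => //; apply: UN; exact: leq_addr.
have [C1 C10 H1] := IH i.+1 j; have [C2 C20 H2] := IH i j.+1.
exists (C1 + C2) => [|U N N0 UN]; first exact: addr_ge0.
rewrite mulrDl; apply: LpBD => //.
  by apply: H1 => // k kn; apply: UN; rewrite addnS leqW.
by apply: H2 => // k kn; apply: UN; rewrite addnS -addSn.
Qed.

Lemma drestD_LpB psi (p : R) n i j : 1 <= p -> tf psi -> exists2 C, 0 <= C &
  forall U N, 0 <= N -> (forall k, (k <= j + n)%N -> LpB p (U k) N) ->
    LpB p (drestD psi U n i j) (C * N).
Proof.
move=> p1 tpsi; elim: n i j => [|n IH] i j.
  exists 0 => // U N N0 UN; rewrite mul0r; split; first exact: measurable_cst.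
  by rewrite (_ : EFin \o _ = cst 0%E)// Lnorm0// gt_eqF// lte_fin (lt_le_trans _ p1).
have [C1 C10 H1] := prodD_LpB n.+1 i.+1 j p1 tpsi.
have [C2 C20 H2] := IH i j.+1.
exists (C1 + C2) => [|U N N0 UN]; first exact: addr_ge0.
rewrite mulrDl; apply: LpBD => //; first exact: H1.
by apply: H2 => // k kn; apply: UN; rewrite addnS -addSn.
Qed.

Lemma Rint_addM f g F : L1 f -> L1 g -> bmeas F ->
  \int[mu]_x ((f x + g x) * F x) =
  \int[mu]_x (f x * F x) + \int[mu]_x (g x * F x).
Proof.
move=> If Ig bF; rewrite -(Rint_add (L1Ml If bF) (L1Ml Ig bF)).
by apply: eq_Rintegral => x _; rewrite mulrDl.
Qed.

Lemma Rint_Madd f F G : L1 f -> bmeas F -> bmeas G ->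
  \int[mu]_x (f x * (F x + G x)) =
  \int[mu]_x (f x * F x) + \int[mu]_x (f x * G x).
Proof.
move=> If bF bG; rewrite -(Rint_add (L1Ml If bF) (L1Ml If bG)).
by apply: eq_Rintegral => x _; rewrite mulrDr.
Qed.

Section ibp.
Variables (Omega : set R) (c d : R) (psi : R -> R) (U : nat -> R -> R) (m : nat).
Hypothesis cdO : `[c, d]%classic `<=` Omega.
Hypothesis spsi : smooth psi.
Hypothesis psi0 : forall x, x \notin `[c, d] -> psi x = 0.
Hypothesis IU : forall k, (k <= m)%N -> L1 (U k).
Hypothesis UD : forall j phi, (j < m)%N -> test_fun Omega phi ->
  \int[mu]_x (U j x * derive1 phi x) = - \int[mu]_x (U j.+1 x * phi x).

Let test_psi : test_fun Omega psi. Proof. exact: smooth_test_fun cdO psi0. Qed.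

Let tpsi : tf psi. Proof. exact: test_fun_tf test_psi. Qed.

Let psiD0 i x : x \notin `[c, d] -> derive1n i psi x = 0.
Proof.
elim: i x => [|i IH] x xcd; first exact: psi0.
rewrite /= derive1E.
have : is_derive x 1 (derive1n i psi) 0.
  apply: (@near_eq_is_derive _ _ _ (cst 0 : R -> R)).
  have xC : nbhs x (~` `[c, d]%classic).
    apply: open_nbhs_nbhs; split; last by move=> /=; exact/negP.
    by rewrite openC; exact: itv_closed.
  by apply: filterS xC => y /negP ycd; rewrite IH.
by move=> H; exact: (@derive_val _ _ _ _ _ _ _ H).
Qed.

(** [F] may be supported anywhere on the line, since its product with a derivative of psi is a test
    function of [Omega]. *)
Lemma prodD_ibp n i j F : tf F -> (j + n < m)%N ->
  \int[mu]_x (prodD psi U n i j x * derive1 F x) =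
  - \int[mu]_x (prodD psi U n.+1 i j x * F x).
Proof.
move=> tF; have [sF _] := tF; have tF' := tf_derive1 tF.
elim: n i j => [|n IH] i j jm.
  rewrite addn0 in jm.
  have spi := @smooth_derive1n R i _ spsi.
  have tpF : test_fun Omega (fun x => derive1n i psi x * F x).
    apply: (smooth_test_fun _ cdO) => [|x xcd]; first exact: smoothM.
    by rewrite psiD0// mul0r.
  have := UD jm tpF.
  have -> : derive1 (fun x => derive1n i psi x * F x) =
      fun x => derive1n i.+1 psi x * F x + derive1n i psi x * derive1 F x.
    by apply: is_derive_fun => x; apply: is_derive_mul; exact: smooth_is_derive.
  have bF1 := tf_bmeas (tfM (@smooth_derive1n R i.+1 _ spsi) tF).
  have bF2 := tf_bmeas (tfM spi tF').
  rewrite (Rint_Madd (IU (ltnW jm)) bF1 bF2) => H.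
  have -> : \int[mu]_x (prodD psi U 0 i j x * derive1 F x) =
      \int[mu]_x (U j x * (derive1n i psi x * derive1 F x)).
    by apply: eq_Rintegral => x _; rewrite /=; ring.
  have -> : \int[mu]_x (prodD psi U 1 i j x * F x) =
      \int[mu]_x (U j x * (derive1n i.+1 psi x * F x)) +
      \int[mu]_x (U j.+1 x * (derive1n i psi x * F x)).
    rewrite -(Rint_add (L1Ml (IU (ltnW jm)) bF1) (L1Ml (IU jm) (tf_bmeas (tfM spi tF)))).
    by apply: eq_Rintegral => x _; rewrite /=; ring.
  by rewrite opprD -H addrA addNr add0r.
have bF := tf_bmeas tF; have bF' := tf_bmeas tF'.
have IP k l n' : (l + n' <= m)%N -> L1 (prodD psi U n' k l).
  by move=> h; apply: prodD_L1 => // k' hk'; apply: IU; exact: leq_trans hk' h.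
have h1 : (j + n <= m)%N by apply: leq_trans (ltnW jm); rewrite leq_add2l.
have h2 : (j.+1 + n <= m)%N by rewrite addSn -addnS ltnW.
have h3 : (j + n.+1 <= m)%N by rewrite ltnW.
have h4 : (j.+1 + n.+1 <= m)%N by rewrite addSn.
have -> : \int[mu]_x (prodD psi U n.+1 i j x * derive1 F x) =
    \int[mu]_x (prodD psi U n i.+1 j x * derive1 F x) +
    \int[mu]_x (prodD psi U n i j.+1 x * derive1 F x).
  by rewrite -(Rint_addM (IP _ _ _ h1) (IP _ _ _ h2) bF').
rewrite (IH i.+1 j); last by rewrite -ltnS -addnS.
rewrite (IH i j.+1); last by rewrite addSn -addnS.
by rewrite -opprD -(Rint_addM (IP _ _ _ h3) (IP _ _ _ h4) bF).
Qed.

Lemma prodD_ibpn n F : tf F -> (n <= m)%N ->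
  \int[mu]_x (psi x * U 0 x * derive1n n F x) =
  (-1) ^+ n * \int[mu]_x (prodD psi U n 0 0 x * F x).
Proof.
elim: n F => [|n IH] F tF nm; first by rewrite expr0 mul1r.
rewrite -derive1n_derive1 (IH _ (tf_derive1 tF) (ltnW nm)) prodD_ibp//.
by rewrite exprS mulN1r mulrN mulNr.
Qed.

(** Without its top term the expansion involves only [U k] with k < j + n, so one more integration
    by parts is possible at j + n = m, where [prodD_ibp] stops. *)
Lemma restD_ibp n i j F : tf F -> (j + n <= m)%N ->
  \int[mu]_x (restD psi U n i j x * derive1 F x) =
  - \int[mu]_x (drestD psi U n i j x * F x).
Proof.
move=> tF; have tF' := tf_derive1 tF.
have bF := tf_bmeas tF; have bF' := tf_bmeas tF'.
elim: n i j => [|n IH] i j jm.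
  rewrite /=; under eq_Rintegral do rewrite mul0r.
  by under [in RHS]eq_Rintegral do rewrite mul0r; rewrite /Rintegral integral0 oppr0.
have IUl l : (l <= m)%N -> forall k, (k <= l)%N -> L1 (U k).
  by move=> lm k kl; apply: IU; exact: leq_trans lm.
have h1 : (j + n <= m)%N by apply: leq_trans jm; rewrite leq_add2l.
have h2 : (j.+1 + n <= m)%N by rewrite addSn -addnS.
have -> : \int[mu]_x (restD psi U n.+1 i j x * derive1 F x) =
    \int[mu]_x (prodD psi U n i.+1 j x * derive1 F x) +
    \int[mu]_x (restD psi U n i j.+1 x * derive1 F x).
  by rewrite -(Rint_addM (prodD_L1 _ tpsi (IUl _ h1)) (restD_L1 _ tpsi (IUl _ h2)) bF').
have h3 : (j + n < m)%N by rewrite -addnS.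
rewrite (prodD_ibp i.+1 tF h3) (IH i j.+1 h2).
rewrite -opprD -(Rint_addM (prodD_L1 _ tpsi (IUl _ jm)) (drestD_L1 _ tpsi (IUl _ h2)) bF)//.
Qed.

End ibp.
End product_rule.

(** * Localization of the weak fractional derivative *)

Section localization.
Context {R : realType}.
Local Notation mu := (@lebesgue_measure R).
Implicit Types (f g phi : R -> R).

Lemma tf_conv_near (e b r : R) phi : e = 1 \/ e = -1 -> b < 1 -> 0 < r ->
  tf phi -> tf (conv e (near_kernel b r) phi).
Proof.
move=> e1 b1 r0 tphi; have [_ [A phiA]] := tphi; split.
  by apply: conv_smooth => //; exact/L1_locL1/L1_near_kernel.
exists (A + (r + r)) => x xA; apply: conv_eq0 => t /(near_kernel_neq0 r0) /andP[t0 tr].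
apply: phiA; rewrite (lt_le_trans _ (lerB_dist _ _))//.
have -> : `|e * t| = t.
  by rewrite normrM (gtr0_norm t0); case: e1 => ->; rewrite ?normrN normr1 mul1r.
by lra.
Qed.

Section main_identity.
Variables (s : side) (alpha a b r : R) (psi : R -> R).
Hypothesis alpha0 : 0 < alpha.
Hypothesis alphaN : alpha \isn't a Num.nat.
Hypothesis r0 : 0 < r.
Hypothesis spsi : smooth psi.
Hypothesis psi0 : forall x, x \notin `[a + 3 * r, b - 3 * r] -> psi x = 0.

Let Omega : set R := `]a, b[%classic.
Let m := Num.truncn alpha.
Let beta := alpha - m%:R.
Let e : R := sgn s.
Let k0 := near_kernel beta r.
Let k1n := derive1n m.+1 (far_kernel beta r).

Let beta0 : 0 < beta. Proof. by have /andP[] := frac_part_itv alpha0 alphaN. Qed.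
Let beta1 : beta < 1. Proof. by have /andP[] := frac_part_itv alpha0 alphaN. Qed.
Let e1 : e = 1 \/ e = -1. Proof. exact: sgnP. Qed.

Let cdO : `[a + 3 * r, b - 3 * r]%classic `<=` Omega.
Proof.
move=> x; rewrite /Omega /= !in_itv/= => /andP[ax xb].
have r3 : 0 < 3 * r by rewrite mulr_gt0.
by apply/andP; split; [rewrite (lt_le_trans _ ax)// ltrDl|rewrite (le_lt_trans xb)// gtrBl].
Qed.

Let test_psi : test_fun Omega psi. Proof. exact: smooth_test_fun cdO psi0. Qed.
Let tpsi : tf psi. Proof. exact: test_fun_tf test_psi. Qed.
Let Ik0 : L1 k0. Proof. exact: L1_near_kernel. Qed.
Let Ik1n : L1 k1n. Proof. exact: L1_far_kernel. Qed.

(* The terms are, in order: the [k1] part of the fractional derivative of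
   [psi u], the lower order Leibniz terms, the commutator, the weak fractional
   derivative of [u], and the correction for replacing the full kernel by [k0] in
   the latter. *)
Definition localized_fracD (c : R) (U : nat -> R -> R) (V : R -> R) (x : R) : R :=
  c * e ^+ m.+1 * (-1) ^+ m * wconv e (fun _ => k1n) (fun x => psi x * U 0 x) x
  + - c * wconv e (fun _ => k0) (drestD psi U m 0 0) x
  + c * wconv e (comm_kernel e beta r psi) (U m) x
  + psi x * V x
  + - (c * e ^+ m.+1 * (-1) ^+ m) * (psi x * wconv e (fun _ => k1n) (U 0) x).

Let mk (k : R -> R) : L1 k -> measurable_fun setT (fun z : R * R => k z.2).
Proof. by move=> /L1_meas mk; exact: (measurableT_comp mk). Qed.

Lemma localized_fracD_LpB (c p : R) : 1 <= p -> exists2 C, 0 <= C &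
  forall U V N, 0 <= N -> (forall k, (k <= m)%N -> L1 (U k) /\ LpB p (U k) N) ->
    LpB p V N -> LpB p (localized_fracD c U V) (C * N).
Proof.
move=> p1.
have [mpsi [M psiM]] := tf_bmeas tpsi.
have M0 : 0 <= M := le_trans (normr_ge0 _) (psiM 0).
have [D D0 drestB] := drestD_LpB m 0 0 p1 tpsi.
have [H IH NH] := comm_kernel_le e1 beta0 beta1 r0 tpsi.
have scale (q C N : R) g : 0 <= C -> 0 <= N -> LpB p g (C * N) ->
    LpB p (fun x => q * g x) (`|q| * C * N).
  move=> C0 N0 gC; rewrite -mulrA; by apply: LpBM => //; exact: mulr_ge0.
have normI k : L1 k -> 0 <= \int[mu]_t `|k t| by move=> _; apply: Rintegral_ge0.
have wk k C N g : L1 k -> 0 <= C -> 0 <= N -> L1 g -> LpB p g (C * N) ->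
    LpB p (wconv e (fun _ => k) g) (\int[mu]_t `|k t| * C * N).
  move=> Ik C0 N0 Ig gB; rewrite -mulrA.
  by apply: (LpB_wconv _ (mk Ik) _ (L1_norm Ik)) => //; exact: mulr_ge0.
pose q := c * e ^+ m.+1 * (-1) ^+ m.
(* One summand per term of [localized_fracD]: Young's inequality contributes the L^1 norm of a
   kernel or of its majorant [H], [M] bounds psi, and [D] comes from the Leibniz terms. *)
exists (`|q| * (\int[mu]_t `|k1n t| * M) + `|- c| * (\int[mu]_t `|k0 t| * D)
  + `|c| * (\int[mu]_t H t * 1) + M + `|- q| * (M * \int[mu]_t `|k1n t|)).
  rewrite !addr_ge0// !mulr_ge0// ?normI//.
  by apply: Rintegral_ge0 => t _; exact: le_trans (NH 0 t).
move=> U V N N0 UB VB; have [IU0 U0B] := UB 0%N isT.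
rewrite !mulrDl; do !apply: (LpBD p1).
- apply: scale => //; first by rewrite mulr_ge0 ?normI.
  apply: wk => //; first by apply: L1_le (L1Z M IU0) => [|x];
    [exact: measurable_funM mpsi (L1_meas IU0)|
     rewrite !normrM ler_wpM2r// (le_trans (psiM x))// ler_norm].
  exact: LpBM.
- apply: scale => //; first by rewrite mulr_ge0 ?normI.
  apply: wk => //; last by apply: drestB => // k km; have [] := UB k km.
  by apply: drestD_L1 => // k km; have [] := UB k km.
- apply: scale => //; first by rewrite mulr1; apply: Rintegral_ge0 => t _; exact: le_trans (NH 0 t).
  rewrite mulr1; have [IUm UmB] := UB m (leqnn m).
  exact: (LpB_wconv _ (measurable_comm_kernel _ _ _ tpsi) NH IH).
- exact: LpBM.
- apply: scale => //; first by rewrite mulr_ge0 ?normI.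
  rewrite -mulrA; apply: LpBM => //; first by rewrite mulr_ge0 ?normI.
  by rewrite -[\int[mu]_t _ in X in LpB _ _ X]mulr1; apply: wk => //; rewrite mul1r.
Qed.

Section with_data.
Variables (U : nat -> R -> R) (V : R -> R).
Hypothesis IU : forall k, (k <= m)%N -> L1 (U k).
Hypothesis IV : L1 V.
Hypothesis UD : forall k phi, (k <= m)%N -> test_fun Omega phi ->
  \int[mu]_x (U k x * phi x) = (-1) ^+ k * \int[mu]_x (U 0%N x * derive1n k phi x).
Hypothesis VD : forall phi, test_fun Omega phi ->
  \int[mu]_x (V x * phi x) =
  (-1) ^+ m * \int[mu]_x (U 0%N x * fracD s Omega alpha phi x).

Let L1_psi g : L1 g -> L1 (fun x => psi x * g x).
Proof.
move=> Ig; rewrite (_ : (fun x => _) = fun x => g x * psi x).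
  by apply: L1Ml => //; exact: tf_bmeas.
by apply/funext => x; rewrite mulrC.
Qed.

Let L1_wk k g : L1 k -> L1 g -> L1 (wconv e (fun _ => k) g).
Proof.
by move=> Ik Ig; exact: (L1_wconv e (mk Ik) (fun _ t => lexx `|k t|) (L1_norm Ik)).
Qed.

Let L1_wcomm g : L1 g -> L1 (wconv e (comm_kernel e beta r psi) g).
Proof.
move=> Ig; have [H IH NH] := comm_kernel_le e1 beta0 beta1 r0 tpsi.
exact: (L1_wconv e (measurable_comm_kernel _ _ _ tpsi) NH IH).
Qed.

Let adj k g phi : L1 k -> L1 g -> bmeas phi ->
  \int[mu]_x (g x * conv e k phi x) =
  \int[mu]_x (wconv e (fun _ => k) g x * phi x).
Proof.
move=> Ik Ig bphi.
by have [] := wconv_adjoint e (mk Ik) (fun _ t => lexx `|k t|) (L1_norm Ik) Ig bphi.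
Qed.

Lemma localized_fracD_L1 c : L1 (localized_fracD c U V).
Proof.
have I0 : L1 (U 0%N) by exact: IU.
do !apply: L1D; try apply: L1Z.
- exact/L1_wk/L1_psi.
- by apply: L1_wk => //; apply: drestD_L1.
- exact/L1_wcomm/IU.
- exact: L1_psi.
- exact/L1_psi/L1_wk.
Qed.

(** All m+1 derivatives leave [phi] for k1, which replaces a kernel that is only locally integrable
    by the integrable [k1n]. *)
Let conv_split phi x : tf phi ->
  conv e (pker beta) (derive1n m.+1 phi) x =
  conv e k0 (derive1n m.+1 phi) x + e ^+ m.+1 * conv e k1n phi x.
Proof.
move=> tphi; have tphin := tf_derive1n m.+1 tphi.
have sfar := @smooth_far_kernel R beta r r0.
have lk0 := L1_locL1 Ik0.
have lfar : locL1 (far_kernel beta r).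
  move=> L; apply: (@L1_le _ _ (pker beta \_ `[- L, L])); last exact: locL1_pker.
    apply/(measurable_restrictT _ _).1 => //; apply: measurable_funTS.
    exact: (continuous_measurable_fun (smooth_continuous sfar)).
  move=> t; rewrite !patchE; case: ifPn => // _.
  by rewrite /far_kernel normrM ler_piMr// ger0_norm ?ramp_ge0 ?ramp_le1.
rewrite -(conv_ibpn m.+1 x e1 sfar tphi) -(conv_add x e1 lk0 lfar tphin).
by apply: eq_Rintegral => t _; rewrite kernel_split.
Qed.

Let L1_eq f g : L1 g -> (forall x, f x = g x) -> L1 f.
Proof. by move=> Ig fg; rewrite (_ : f = g)//; exact/funext. Qed.

Let L1_conv g phi : L1 g -> tf phi ->
  L1 (fun x => g x * conv e (pker beta) (derive1n m.+1 phi) x).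
Proof.
move=> Ig tphi; have b1 := conv_bmeas e1 Ik0 (tf_derive1n m.+1 tphi).
have b2 := conv_bmeas e1 Ik1n tphi.
apply: (L1_eq (L1D (L1Ml Ig b1) (L1Z (e ^+ m.+1) (L1Ml Ig b2)))) => x.
by rewrite conv_split//; ring.
Qed.

Let split_pairing g phi : L1 g -> tf phi ->
  \int[mu]_x (g x * conv e (pker beta) (derive1n m.+1 phi) x) =
  \int[mu]_x (g x * conv e k0 (derive1n m.+1 phi) x) +
  e ^+ m.+1 * \int[mu]_x (wconv e (fun _ => k1n) g x * phi x).
Proof.
move=> Ig tphi; have tphin := tf_derive1n m.+1 tphi.
have b1 := conv_bmeas e1 Ik0 tphin.
have b2 := conv_bmeas e1 Ik1n tphi.
rewrite -(adj Ik1n Ig (tf_bmeas tphi)) -(Rint_scale (e ^+ m.+1) (L1Ml Ig b2)).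
rewrite -(Rint_add (L1Ml Ig b1) (L1Z (e ^+ m.+1) (L1Ml Ig b2))).
by apply: eq_Rintegral => x _; rewrite conv_split//; ring.
Qed.

Let UD1 j phi : (j < m)%N -> test_fun Omega phi ->
  \int[mu]_x (U j x * derive1 phi x) = - \int[mu]_x (U j.+1 x * phi x).
Proof.
move=> jm tphi; rewrite (UD (ltnW jm) (test_fun_derive1 tphi)) derive1n_derive1.
by rewrite (UD jm tphi) [in RHS]exprS mulN1r mulNr opprK.
Qed.

(** The hypotheses on [U] and [V] concern test functions of the interval, the conclusion all those
    of the line; each use of the former goes through psi or [F2]. *)
Lemma localized_fracD_identity c phi : tf phi ->
  (forall (Omega : set R) phi, tf phi -> (forall x, ~ Omega x -> phi x = 0) ->
    fracD s Omega alpha phi =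
    fun x => c * conv e (pker beta) (derive1n m.+1 phi) x) ->
  \int[mu]_x (localized_fracD c U V x * phi x) =
  (-1) ^+ m * \int[mu]_x (psi x * U 0%N x * fracD s setT alpha phi x).
Proof.
move=> tphi fracE; have bphi := tf_bmeas tphi.
have I0 : L1 (U 0%N) by exact: IU.
have Im : L1 (U m) by exact: IU.
have IpU0 := L1_psi I0.
have IpV := L1_psi IV.
have Idr : L1 (drestD psi U m 0 0) by apply: drestD_L1.
have Irest : L1 (restD psi U m 0 0) by apply: restD_L1.
have mm : (-1) ^+ m * (-1) ^+ m = 1 :> R by rewrite -exprMn mulrNN mulr1 expr1n.
set q := e ^+ m.+1.
pose F := conv e k0 phi.
have tF : tf F := tf_conv_near e1 beta1 r0 tphi.
pose F2 := conv e k0 (fun x => psi x * phi x).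
have tpphi : tf (fun x => psi x * phi x) by exact: tfM.
have tF2 : tf F2 := tf_conv_near e1 beta1 r0 tpphi.
have lk0 := L1_locL1 Ik0.
have test_pphi : test_fun Omega (fun x => psi x * phi x).
  apply: (smooth_test_fun _ cdO); first by case: tpphi.
  by move=> x /psi0 ->; rewrite mul0r.
(* Convolution with [k0] shifts by less than 2 r, to the right or to the left according to [e]; of
   the margin 3 r of psi, at least r is left. *)
have test_F2' : test_fun Omega (derive1 F2).
  have arO : `[a + r, b - r]%classic `<=` Omega.
    move=> x; rewrite /Omega /= !in_itv/= => /andP[ax xb].
    by apply/andP; split; [rewrite (lt_le_trans _ ax)// ltrDl|rewrite (le_lt_trans xb)// gtrBl].
  apply: test_fun_derive1; apply: (smooth_test_fun _ arO); first by case: tF2.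
  move=> x xab; apply: conv_eq0 => t /(near_kernel_neq0 r0) /andP[t0 tr].
  rewrite psi0 ?mul0r//; apply: contra xab; rewrite !in_itv/= => /andP[h1 h2].
  by case: e1 h1 h2 => ->; rewrite ?mul1r ?mulN1r ?opprK => h1 h2; apply/andP; split; lra.
(* Only m of the m+1 derivatives are moved onto psi U 0. The last one stays on [F], for the
   commutator and for the lower order terms. *)
have near_part : \int[mu]_x (psi x * U 0%N x * conv e k0 (derive1n m.+1 phi) x) =
    (-1) ^+ m * (\int[mu]_x (U m x * derive1 F2 x) +
      \int[mu]_x (wconv e (comm_kernel e beta r psi) (U m) x * phi x) -
      \int[mu]_x (wconv e (fun _ => k0) (drestD psi U m 0 0) x * phi x)).
  rewrite -(conv_derive1n m.+1 e1 lk0 tphi) -derive1n_derive1.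
  rewrite (prodD_ibpn cdO spsi psi0 IU UD1 (tf_derive1 tF) (leqnn m)).
  congr (_ * _).
  have -> : \int[mu]_x (prodD psi U m 0 0 x * derive1 F x) =
     \int[mu]_x (psi x * U m x * derive1 F x) +
     \int[mu]_x (restD psi U m 0 0 x * derive1 F x).
    rewrite -(Rint_addM (L1_psi Im) Irest (tf_bmeas (tf_derive1 tF))).
    by apply: eq_Rintegral => x _; rewrite prodD_restD add0n.
  rewrite (restD_ibp cdO spsi psi0 IU UD1 (j := 0%N) (n := m) 0%N tF (leqnn m)) (adj Ik0 Idr bphi).
  congr (_ - _).
  have [H IH NH] := comm_kernel_le e1 beta0 beta1 r0 tpsi.
  have [Lc <-] := wconv_adjoint e (measurable_comm_kernel e beta r tpsi) NH IH Im bphi.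
  rewrite -(Rint_add (L1Ml Im (tf_bmeas (tf_derive1 tF2))) Lc).
  apply: eq_Rintegral => x _; rewrite -mulrDr mulrAC mulrC; congr (_ * _).
  have dconv f : tf f -> derive1 (conv e k0 f) = conv e k0 (derive1 f).
    by move=> tf'; exact: (conv_derive1n 1 e1 lk0 tf').
  rewrite /F /F2 !dconv//; exact: conv_commutator.
(* Testing [V] against psi phi brings in the full kernel; subtracting its far part leaves the
   pairing with [k0]. *)
have inner_part : c * \int[mu]_x (U m x * derive1 F2 x) = \int[mu]_x (psi x * V x * phi x)
    - c * (-1) ^+ m * q * \int[mu]_x (psi x * wconv e (fun _ => k1n) (U 0%N) x * phi x).
  rewrite UD// derive1n_derive1 /F2 (conv_derive1n m.+1 e1 lk0 tpphi).
  have := split_pairing I0 tpphi.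
  have -> : \int[mu]_x (psi x * V x * phi x) = \int[mu]_x (V x * (psi x * phi x)).
    by apply: eq_Rintegral => x _; ring.
  rewrite VD// (fracE Omega)//; last exact: test_fun_out test_pphi.
  have -> : \int[mu]_x (psi x * wconv e (fun _ => k1n) (U 0%N) x * phi x) =
      \int[mu]_x (wconv e (fun _ => k1n) (U 0%N) x * (psi x * phi x)).
    by apply: eq_Rintegral => x _; ring.
  have -> : \int[mu]_x (U 0%N x * (c * conv e (pker beta) (derive1n m.+1 (fun x => psi x * phi x)) x)) =
     c * \int[mu]_x (U 0%N x * conv e (pker beta) (derive1n m.+1 (fun x => psi x * phi x)) x).
    rewrite -(Rint_scale c (L1_conv I0 tpphi)).
    by apply: eq_Rintegral => x _; ring.
  by move=> ->; rewrite -/q; ring.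
rewrite (fracE setT)//; last by move=> x [].
have -> : \int[mu]_x (psi x * U 0%N x * (c * conv e (pker beta) (derive1n m.+1 phi) x)) =
   c * \int[mu]_x (psi x * U 0%N x * conv e (pker beta) (derive1n m.+1 phi) x).
  rewrite -(Rint_scale c (L1_conv IpU0 tphi)).
  by apply: eq_Rintegral => x _; ring.
rewrite split_pairing// near_part -/q.
have I1 := L1_wk Ik1n IpU0.
have I2 := L1_wk Ik0 Idr.
have I3 := L1_wcomm Im.
have I5 := L1_psi (L1_wk Ik1n I0).
pose q' := c * q * (-1) ^+ m.
have -> : \int[mu]_x (localized_fracD c U V x * phi x) =
    q' * \int[mu]_x (wconv e (fun _ => k1n) (fun x => psi x * U 0%N x) x * phi x)
  + - c * \int[mu]_x (wconv e (fun _ => k0) (drestD psi U m 0 0) x * phi x)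
  + c * \int[mu]_x (wconv e (comm_kernel e beta r psi) (U m) x * phi x)
  + \int[mu]_x (psi x * V x * phi x)
  + - q' * \int[mu]_x (psi x * wconv e (fun _ => k1n) (U 0%N) x * phi x).
  rewrite -(Rint_scale q' (L1Ml I1 bphi)) -(Rint_scale (- c) (L1Ml I2 bphi)).
  rewrite -(Rint_scale c (L1Ml I3 bphi)) -(Rint_scale (- q') (L1Ml I5 bphi)).
  have J1 := L1Z q' (L1Ml I1 bphi).
  have J2 := L1Z (- c) (L1Ml I2 bphi).
  have J3 := L1Z c (L1Ml I3 bphi).
  have J5 := L1Z (- q') (L1Ml I5 bphi).
  have J4 := L1Ml IpV bphi.
  rewrite -(Rint_add J1 J2) -(Rint_add (L1D J1 J2) J3).
  rewrite -(Rint_add (L1D (L1D J1 J2) J3) J4).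
  rewrite -(Rint_add (L1D (L1D (L1D J1 J2) J3) J4) J5).
  by apply: eq_Rintegral => x _; rewrite /localized_fracD -/q -/q'; ring.
(* What remains is algebra in the values of the integrals, with t = (-1)^m its own inverse. *)
have alg (t X A1 A2 A3 A5 PV : R) : t * t = 1 -> c * X = PV - c * t * q * A5 ->
    c * q * t * A1 + - c * A2 + c * A3 + PV + - (c * q * t) * A5 =
    t * (c * (t * (X + A3 - A2) + q * A1)).
  move=> tt cX.
  have -> : t * (c * (t * (X + A3 - A2) + q * A1)) =
    (t * t) * (c * X + c * A3 - c * A2) + c * q * t * A1 by ring.
  by rewrite tt mul1r cX; ring.
exact: alg mm inner_part.
Qed.

End with_data.

End main_identity.
End localization.

(** * The extension *)

Section extension.
Context {R : realType}.
Local Notation mu := (@lebesgue_measure R).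
Implicit Types (f g u v phi : R -> R) (Omega : set R).

Definition weak_rep Omega (T : (R -> R) -> R) v :=
  locally_integrable Omega v /\
  forall phi, test_fun Omega phi -> \int[mu]_(x in Omega) (v x * phi x) = T phi.

Lemma weak_rep_xget Omega T (p B : R) v : exhaustible Omega ->
  weak_rep Omega T v -> LpB p (v \_ Omega) B ->
  weak_rep Omega T (xget (cst 0) [set v | weak_rep Omega T v]) /\
  LpB p ((xget (cst 0) [set v | weak_rep Omega T v]) \_ Omega) B.
Proof.
move=> eO [lv Tv] [mvO vB]; have mO := open_measurable eO.1.
have [lx Tx] : weak_rep Omega T (xget (cst 0) [set v | weak_rep Omega T v]).
  by apply: (@xgetPex _ (cst 0) [set v | weak_rep Omega T v]); exists v.
move: (xget _ _) lx Tx => x lx Tx.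
have mx : measurable_fun Omega x by case: lx.
have mv : measurable_fun Omega v by case: lv.
split => //; split; first by apply/(measurable_restrictT _ _).1.
rewrite (@ae_Lp_norm _ _ _ x v)//.
by apply: weak_unique => // phi tphi; rewrite Tx// Tv.
Qed.

(** The bound |u| <= 1 + |u|^p, with the constant 1 replaced by an integrable bump that equals 1 on
    the interval. *)
Lemma in_Lp_L1 (a b p : R) u : 1 <= p -> in_Lp `]a, b[ p u -> L1 (u \_ `]a, b[).
Proof.
move=> p1 pu; have := Lfun_LpB pu => -[mu_ _].
have Lp := Lfun_integrable p1 pu.
have Lb : L1 (bump 1 (a - 1) (b + 1)).
  apply: tf_L1; apply: (@test_fun_tf _ setT).
  apply: (@smooth_test_fun _ _ _ (a - 1) (b + 1)) => //.
    exact: smooth_bump.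
  move=> x xab; apply: bump_eq0 => //; apply: contra xab; exact: subset_itv_oo_cc.
apply: (@L1_le _ _ (fun x => bump 1 (a - 1) (b + 1) x + `|(u \_ `]a, b[) x| `^ p)) => //.
  move=> x; rewrite [leRHS]ger0_norm ?addr_ge0 ?bump_ge0 ?powR_ge0//.
  have [ux1|/ltW ux1] := leP `|(u \_ `]a, b[) x| 1; last first.
    by rewrite ler_wpDl ?bump_ge0// le1r_powR.
  have [xab|xab] := boolP (x \in `]a, b[).
    rewrite bump_eq1 ?ler_wpDr ?powR_ge0//.
    by rewrite subrK addrK; exact: subset_itv_oo_cc.
  by rewrite patchE mem_setE (negbTE xab) normr0 addr_ge0 ?bump_ge0 ?powR_ge0.
exact: (L1D Lb Lp).
Qed.

Lemma in_Lp_locint (a b p : R) u : 1 <= p -> in_Lp `]a, b[ p u ->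
  locally_integrable `]a, b[ u.
Proof.
move=> p1 pu; have Iu := in_Lp_L1 p1 pu.
apply: open_integrable_locally; first exact: itv_open.
have Iu' : mu.-integrable `]a, b[ (EFin \o (u \_ `]a, b[)) by apply: integrableS Iu.
apply: eq_integrable Iu' => // x xab.
by rewrite /= patchE xab.
Qed.

Lemma L1_locint f : L1 f -> locally_integrable setT f.
Proof. by move=> If; apply: open_integrable_locally => //; exact: openT. Qed.

Lemma is_weakD0 Omega u : locally_integrable Omega u -> is_weakD Omega 0 u u.
Proof. by move=> lu; split => // phi _; rewrite expr0 mul1r. Qed.

Lemma Lp_norm_ge0 Omega (p : R) u : 0 <= Lp_norm Omega p u.
Proof. by rewrite /Lp_norm fine_ge0// Lnorm_ge0. Qed.

Lemma powR_root_le (p x S : R) : 0 < p -> 0 <= x -> x `^ p <= S -> x <= S `^ p^-1.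
Proof.
move=> p0 x0 xS; have : (x `^ p) `^ p^-1 <= S `^ p^-1.
  have S0 := le_trans (powR_ge0 _ _) xS.
  by apply: ge0_ler_powR; rewrite ?nnegrE ?powR_ge0 ?invr_ge0 ?(ltW p0).
by rewrite -powRrM mulfV ?gt_eqF// powRr1.
Qed.

Lemma Sobolev_normX Omega m (p : R) u : 0 < p ->
  Sobolev_norm Omega m p u `^ p = \sum_(k < m.+1) Lp_norm Omega p (weakD Omega k u) `^ p.
Proof.
move=> p0; rewrite /Sobolev_norm -powRrM mulVf ?gt_eqF// powRr1//.
by apply: sumr_ge0 => k _; exact: powR_ge0.
Qed.

Lemma Lp_norm_weakD_le s Omega (alpha p : R) u k : 0 < p ->
  (k <= Num.truncn alpha)%N ->
  Lp_norm Omega p (weakD Omega k u) <= fracSobolev_norm s Omega alpha p u.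
Proof.
move=> p0 km; apply: powR_root_le => //; first exact: Lp_norm_ge0.
rewrite Sobolev_normX// (bigD1 (Ordinal (km : (k < (Num.truncn alpha).+1)%N)))//=.
rewrite -addrA lerDl addr_ge0 ?powR_ge0//.
by apply: sumr_ge0 => i _; exact: powR_ge0.
Qed.

Lemma Lp_norm_weak_fracD_le s Omega (alpha p : R) u : 0 < p ->
  Lp_norm Omega p (weak_fracD s Omega alpha u) <= fracSobolev_norm s Omega alpha p u.
Proof.
move=> p0; apply: powR_root_le => //; first exact: Lp_norm_ge0.
by rewrite lerDr powR_ge0.
Qed.

(** m + 2 counts the weak derivatives of orders 0 to m and the fractional one; as p >= 1, the p-th
    root of this number is at most the number itself. *)
Lemma fracSobolev_norm_le s Omega (alpha p B : R) u : 1 <= p -> 0 <= B ->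
  (forall k, (k <= Num.truncn alpha)%N -> Lp_norm Omega p (weakD Omega k u) <= B) ->
  Lp_norm Omega p (weak_fracD s Omega alpha u) <= B ->
  fracSobolev_norm s Omega alpha p u <= (Num.truncn alpha).+2%:R * B.
Proof.
move=> p1 B0 kB fB; have p0 : 0 < p by rewrite (lt_le_trans _ p1).
have pw x : 0 <= x -> x <= B -> x `^ p <= B `^ p.
  by move=> x0 xB; apply: ge0_ler_powR; rewrite ?nnegrE// ltW.
rewrite /fracSobolev_norm Sobolev_normX//.
apply: (@le_trans _ _ (((Num.truncn alpha).+2%:R * B `^ p) `^ p^-1)).
  apply: ge0_ler_powR; rewrite ?nnegrE ?invr_ge0 ?(ltW p0)//.
  - by rewrite addr_ge0 ?powR_ge0// sumr_ge0// => k _; exact: powR_ge0.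
  - by rewrite mulr_ge0 ?powR_ge0.
  rewrite -natr1 mulrDl mul1r; apply: lerD; last by apply: pw => //; exact: Lp_norm_ge0.
  rewrite mulr_natl -[X in _ *+ X]card_ord -sumr_const; apply: ler_sum => k _.
  by apply: pw; [exact: Lp_norm_ge0|apply: kB; rewrite -ltnS].
rewrite powRM ?powR_ge0// -powRrM mulfV ?gt_eqF// powRr1// ler_wpM2r//.
by apply: ler1_powR; rewrite ?ler1n// invf_le1.
Qed.

End extension.

(** * Boundedness of the cutoff operator *)

Section extension_bound.
Context {R : realType}.
Local Notation mu := (@lebesgue_measure R).
Implicit Types (f g u v phi : R -> R) (Omega : set R).

(** Equal to 1 on [a + 4 r, b - 4 r]; the margin 3 r exceeds the range 2 r of k0. *)
Definition plateau (a b r : R) : R -> R := bump r (a + 3 * r) (b - 3 * r).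

(** The extension operator. With [u] extended by 0, it is literally psi times the order 0 datum
    [U 0], a function on the whole line. *)
Definition cutoff (a b r : R) u (x : R) : R := plateau a b r x * (u \_ `]a, b[) x.

Section estimates.
Variables (s : side) (a b alpha p r : R).
Hypothesis alpha0 : 0 < alpha.
Hypothesis p1 : 1 <= p.
Hypothesis r0 : 0 < r.

Let Omega : set R := `]a, b[%classic.
Let m := Num.truncn alpha.
Let psi := plateau a b r.

Let spsi : smooth psi. Proof. exact: smooth_bump. Qed.

Let psi0 x : x \notin `[a + 3 * r, b - 3 * r] -> psi x = 0.
Proof. by move=> xab; apply: bump_eq0 => //; apply: contra xab; exact: subset_itv_oo_cc. Qed.

Let cdO : `[a + 3 * r, b - 3 * r]%classic `<=` Omega.
Proof.
move=> x; rewrite /Omega /= !in_itv/= => /andP[ax xb].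
have r3 : 0 < 3 * r by rewrite mulr_gt0.
by apply/andP; split; [rewrite (lt_le_trans _ ax)// ltrDl|rewrite (le_lt_trans xb)// gtrBl].
Qed.

Let tpsi : tf psi. Proof. by apply: test_fun_tf; exact: smooth_test_fun cdO psi0. Qed.

Definition derivative_data (U : nat -> R -> R) (N : R) :=
  [/\ forall k, (k <= m)%N -> L1 (U k), forall k, (k <= m)%N -> LpB p (U k) N &
  forall k phi, (k <= m)%N -> test_fun Omega phi ->
  \int[mu]_x (U k x * phi x) = (-1) ^+ k * \int[mu]_x (U 0%N x * derive1n k phi x)].

Lemma derivative_data_step U N j phi : derivative_data U N -> (j < m)%N ->
  test_fun Omega phi ->
  \int[mu]_x (U j x * derive1 phi x) = - \int[mu]_x (U j.+1 x * phi x).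
Proof.
move=> [_ _ UD] jm tphi.
rewrite (UD _ _ (ltnW jm) (test_fun_derive1 tphi)) derive1n_derive1.
by rewrite (UD _ _ jm tphi) [in RHS]exprS mulN1r mulNr opprK.
Qed.

Lemma cutoff_weakD : exists2 C, 0 <= C & forall U N k, 0 <= N ->
  derivative_data U N -> (k <= m)%N -> exists w, [/\ L1 w, LpB p w (C * N) &
    forall phi, tf phi -> \int[mu]_x (w x * phi x) =
      (-1) ^+ k * \int[mu]_x (psi x * U 0%N x * derive1n k phi x)].
Proof.
have H k := cid2 (prodD_LpB k 0 0 p1 tpsi).
have C0 k : 0 <= s2val (H k) := s2valP (H k).
(* The sum over all orders is one constant valid for every k <= m. *)
exists (\sum_(k < m.+1) s2val (H k)); first exact: sumr_ge0.
move=> U N k N0 dU km; have [IU UB UD] := dU.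
exists (prodD psi U k 0 0); split.
- by apply: prodD_L1 => // j jk; apply: IU; exact: leq_trans jk km.
- apply: (@LpB_leconst _ _ _ (s2val (H k) * N)).
    rewrite ler_wpM2r// (bigD1 (Ordinal (km : (k < m.+1)%N)))//= lerDl.
    exact: sumr_ge0.
  by apply: (s2valP' (H k)) => // j jk; apply: UB; exact: leq_trans jk km.
- move=> phi tphi.
  have D1 j f := derivative_data_step (j := j) (phi := f) dU.
  rewrite (prodD_ibpn cdO spsi psi0 IU D1 tphi km) mulrA -exprMn mulrNN mulr1.
  by rewrite expr1n mul1r.
Qed.

Lemma cutoff_fracD : exists2 C, 0 <= C & forall U V N, 0 <= N ->
  derivative_data U N -> L1 V -> LpB p V N ->
  (forall phi, test_fun Omega phi -> \int[mu]_x (V x * phi x) =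
    (-1) ^+ m * \int[mu]_x (U 0%N x * fracD s Omega alpha phi x)) ->
  exists w, [/\ L1 w, LpB p w (C * N) &
    forall phi, tf phi -> \int[mu]_x (w x * phi x) =
      (-1) ^+ m * \int[mu]_x (psi x * U 0%N x * fracD s setT alpha phi x)].
Proof.
have [aN|aN] := boolP (alpha \is a Num.nat).
  (* For integer [alpha] the operator is local and does not depend on the domain, so the Leibniz
     formula of order m gives the claim. *)
  have [C C0 HC] := cutoff_weakD; exists C => // U V N N0 dU IV VB VD.
  have [w [Iw wB wE]] := HC U N m N0 dU (leqnn m); exists w; split => // phi tphi.
  by rewrite wE// /fracD aN.
have [c fracE] := fracD_conv s alpha0 aN.
have [C C0 HC] := localized_fracD_LpB s alpha0 aN r0 spsi psi0 c p1.
exists C => // U V N N0 dU IV VB VD; have [IU UB UD] := dU.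
exists (localized_fracD s alpha r psi c U V); split.
- exact: (localized_fracD_L1 s alpha0 aN r0 spsi psi0 IU IV).
- by apply: HC => // k km; split; [exact: IU|exact: UB].
- move=> phi tphi.
  exact: (localized_fracD_identity alpha0 aN r0 spsi psi0 IU IV UD VD tphi fracE).
Qed.

End estimates.

Lemma xget_Lp_norm Omega (T : (R -> R) -> R) (p : R) v : exhaustible Omega ->
  weak_rep Omega T v -> in_Lp Omega p v ->
  let x := xget (cst 0) [set v | weak_rep Omega T v] in
  weak_rep Omega T x /\ LpB p (x \_ Omega) (Lp_norm Omega p x).
Proof.
move=> eO Tv pv x; have [Tx xB] := weak_rep_xget eO Tv (Lfun_LpB pv).
by split => //; exact: Lfun_LpB (LpB_finite xB).
Qed.

Lemma Sobolev_data s (a b alpha p : R) u : 0 < alpha -> 1 <= p ->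
  fracSobolev s `]a, b[ alpha p u ->
  exists2 U, U 0%N = u \_ `]a, b[ &
    derivative_data a b alpha p U (fracSobolev_norm s `]a, b[ alpha p u).
Proof.
move=> alpha0 p1 [[pu Du] _]; set m := Num.truncn alpha in Du *.
have p0 : 0 < p by rewrite (lt_le_trans _ p1).
set Omega : set R := `]a, b[%classic in pu Du *.
set N := fracSobolev_norm _ _ _ _ _.
have eO : exhaustible Omega := exhaustible_itv a b.
have lu : locally_integrable Omega u := in_Lp_locint p1 pu.
(* The chosen weak derivative of order 0 agrees with [u] only almost everywhere; taking [u] itself
   makes the later identity with [cutoff] an equality of functions. *)
pose V k := if k is 0 then u else weakD Omega k u.
have VP k : (k <= m)%N -> is_weakD Omega k u (V k) /\ LpB p (V k \_ Omega) N.
  move=> km; have [v wv pv] := Du k km.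
  have [Wx xB] := xget_Lp_norm eO wv pv.
  have xN : LpB p (weakD Omega k u \_ Omega) N.
    by apply: LpB_leconst xB; exact: Lp_norm_weakD_le.
  case: k km {wv xB} Wx xN => [|k] km Wx xN; last by [].
  split; first exact: is_weakD0.
  case: xN => mx xN; split.
    by have := Lfun_LpB pu; case.
  have [lx Tx] := Wx; rewrite (@ae_Lp_norm _ Omega p u (weakD Omega 0 u))//.
  - by apply: open_measurable; exact: itv_open.
  - by case: lu.
  - by case: lx.
  - by apply: weak_unique => // phi tphi; rewrite Tx// expr0 mul1r.
exists (fun k => V k \_ Omega) => //; split.
- by move=> k /VP[_ /LpB_finite]; exact: in_Lp_L1.
- by move=> k /VP[].
- move=> k phi /VP[[_ Vk] _] tphi.
  by rewrite -(Rint_restrict Omega (V k)) -(Rint_restrict Omega u) Vk.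
Qed.

Lemma LpB_setT_norm (T : (R -> R) -> R) (p B : R) w : L1 w -> LpB p w B ->
  (forall phi, tf phi -> \int[mu]_x (w x * phi x) = T phi) ->
  [/\ weak_rep setT T w, in_Lp setT p w &
    Lp_norm setT p (xget (cst 0) [set v | weak_rep setT T v]) <= B].
Proof.
move=> Iw wB wT; have Ww : weak_rep setT T w.
  by split; [exact: L1_locint|move=> phi /test_fun_tf; exact: wT].
have wB' : LpB p (w \_ setT) B by rewrite patch_setT.
split => //; first exact: LpB_finite wB'.
have [_ xB] := weak_rep_xget exhaustible_setT Ww wB'.
exact: LpB_fine xB.
Qed.

Lemma cutoff_bounded s (a b alpha p r : R) : 0 < alpha -> 1 <= p -> 0 < r ->
  exists2 C, 0 < C & forall u, fracSobolev s `]a, b[ alpha p u ->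
    fracSobolev s setT alpha p (cutoff a b r u) /\
    fracSobolev_norm s setT alpha p (cutoff a b r u) <=
      C * fracSobolev_norm s `]a, b[ alpha p u.
Proof.
move=> alpha0 p1 r0; have p0 : 0 < p by rewrite (lt_le_trans _ p1).
have [C1 C10 HC1] := cutoff_weakD a b alpha p1 r0.
(* A weak derivative on one side is defined by testing against the operator of the other side. *)
have [C2 C20 HC2] := cutoff_fracD (opposite s) a b alpha0 p1 r0.
set m := Num.truncn alpha in HC1 HC2.
(* The added 1 makes the constant strictly positive. *)
have C0 : 0 < C1 + C2 + 1 by rewrite ltr_wpDl// addr_ge0.
exists (m.+2%:R * (C1 + C2 + 1)); first by rewrite mulr_gt0.
move=> u Su; have [U U0 dU] := Sobolev_data alpha0 p1 Su.
have [_ [v wv pv]] := Su.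
set N := fracSobolev_norm s `]a, b[ alpha p u in dU *.
have N0 : 0 <= N by exact: powR_ge0.
have [[lV VT] VB] := xget_Lp_norm (exhaustible_itv a b) wv pv.
set V := xget _ _ in lV VT VB.
have VN : LpB p (V \_ `]a, b[) N.
  by apply: LpB_leconst VB; exact: Lp_norm_weak_fracD_le.
have IV : L1 (V \_ `]a, b[) by apply: in_Lp_L1 p1 _; exact: LpB_finite VN.
have psiU0 : (fun x => plateau a b r x * U 0%N x) = cutoff a b r u.
  by rewrite U0.
have cB1 : C1 * N <= (C1 + C2 + 1) * N by rewrite ler_wpM2r// -addrA lerDl addr_ge0.
have cB2 : C2 * N <= (C1 + C2 + 1) * N.
  by rewrite ler_wpM2r// addrAC lerDr addr_ge0.
have W1 k : (k <= m)%N -> exists w, [/\ is_weakD setT k (cutoff a b r u) w,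
    in_Lp setT p w & Lp_norm setT p (weakD setT k (cutoff a b r u)) <= C1 * N].
  move=> km; have [w [Iw wB wT]] := HC1 U N k N0 dU km; exists w.
  rewrite U0 in wT.
  exact: (LpB_setT_norm (T := fun phi => (-1) ^+ k *
    \int[mu]_x (cutoff a b r u x * derive1n k phi x)) Iw wB wT).
have VD phi : test_fun `]a, b[ phi -> \int[mu]_x ((V \_ `]a, b[) x * phi x) =
    (-1) ^+ m * \int[mu]_x (U 0%N x * fracD (opposite s) `]a, b[ alpha phi x).
  by move=> tphi; rewrite U0 -!Rint_restrict VT.
have [w [Iw wB wT]] := HC2 U _ N N0 dU IV VN VD.
rewrite U0 in wT.
have [W2 pw W2N] := LpB_setT_norm (T := fun phi => (-1) ^+ m *
    \int[mu]_x (cutoff a b r u x * fracD (opposite s) setT alpha phi x)) Iw wB wT.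
split.
  split; last by exists w.
  split; last by move=> k km; have [w' [h1 h2 _]] := W1 k km; exists w'.
  rewrite /in_Lp patch_setT; apply: (@LpB_finite _ _ _ (1 * N)).
  have [_ UB _] := dU; have u0B := UB 0%N isT; rewrite U0 in u0B.
  apply: LpBM => //.
    exact: (continuous_measurable_fun (smooth_continuous (@smooth_bump R _ _ _))).
  by move=> x; rewrite ger0_norm ?bump_ge0 ?bump_le1.
rewrite -mulrA; apply: fracSobolev_norm_le => //; first by rewrite mulr_ge0// ltW.
  by move=> k km; have [_ [_ _ h]] := W1 k km; exact: le_trans h cB1.
exact: le_trans W2N cB2.
Qed.

End extension_bound.

(** * A compact set that determines the interval and the cutoff *)

Section carrier.
Context {R : realType}.
Implicit Types (a b r : R).

(* [C alpha p K] does not take [a] and [b] as arguments.  The isolated point makes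
   [a], [b] and the cutoff width [r] recoverable from the compact set. *)
Definition carrier a b r : set R := [set a + r] `|` `[a + 3 * r, b - 3 * r]%classic.

Lemma compact_carrier a b r : compact (carrier a b r).
Proof. by apply: compactU; [exact: compact_set1|exact: segment_compact]. Qed.

Lemma carrier_sub a b r : 0 < r -> a + 3 * r < b - 3 * r ->
  carrier a b r `<=` `]a, b[%classic.
Proof.
move=> r0 ab x [->|]; rewrite /= !in_itv/=; first by apply/andP; split; lra.
by move=> /andP[ax xb]; apply/andP; split; lra.
Qed.

Lemma carrierP a b r x :
  carrier a b r x <-> x = a + r \/ a + 3 * r <= x <= b - 3 * r.
Proof. by rewrite /carrier /setU /= in_itv. Qed.

(** The set determines its least point a + r, its greatest point b - 3 r, and the least point a + 3
    r after the isolated one; these three numbers determine a, b and r. *)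
Lemma carrier_inj a b r a' b' r' : 0 < r -> a + 3 * r < b - 3 * r ->
  0 < r' -> a' + 3 * r' < b' - 3 * r' -> carrier a b r = carrier a' b' r' ->
  [/\ a = a', b = b' & r = r'].
Proof.
move=> r0 ab r0' ab' E.
have H x : (x = a + r \/ a + 3 * r <= x <= b - 3 * r) <->
    (x = a' + r' \/ a' + 3 * r' <= x <= b' - 3 * r').
  by rewrite -!carrierP E.
have E1 : a + r = a' + r'.
  have [/(_ (or_introl erefl)) h _] := H (a + r).
  have [_ /(_ (or_introl erefl)) h'] := H (a' + r').
  by case: h h' => [//|/andP[h1 _]] [->//|/andP[h2 _]]; lra.
have E2 : b - 3 * r = b' - 3 * r'.
  have [/(_ (or_intror _)) h _] := H (b - 3 * r).
  have [_ /(_ (or_intror _)) h'] := H (b' - 3 * r').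
  have {}h := h (_ : a + 3 * r <= b - 3 * r <= b - 3 * r).
  have {}h' := h' (_ : a' + 3 * r' <= b' - 3 * r' <= b' - 3 * r').
  move: h h'; rewrite !lexx !(ltW ab) !(ltW ab') => /(_ isT) h /(_ isT) h'.
  by case: h h' => [h|/andP[_ h]] [h'|/andP[_ h']]; lra.
have E3 : a + 3 * r = a' + 3 * r'.
  have := (H (a + 3 * r)).1; have := (H (a' + 3 * r')).2.
  rewrite !lexx !(ltW ab) !(ltW ab') => h' h.
  have {}h := h (or_intror isT); have {}h' := h' (or_intror isT).
  by case: h h' => [h|/andP[h _]] [h'|/andP[h' _]]; lra.
by split; lra.
Qed.

(** The function 1/(x-a) + 1/(b-x) is continuous on [A], hence bounded there by some M', and this
    keeps [A] at distance 1/M' from both endpoints. No extremal points are used, so [A] may be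
    empty. *)
Lemma compact_margin a b (A : set R) : a < b -> compact A -> A `<=` `]a, b[%classic ->
  exists2 r, 0 < r & a + 3 * r < b - 3 * r /\
    A `<=` `[a + 3 * r + r, b - 3 * r - r]%classic.
Proof.
move=> ab cA AO.
pose f x := (x - a)^-1 + (b - x)^-1.
have cf : {within A, continuous f}.
  apply: continuous_in_subspaceT => x; rewrite inE => /AO /=; rewrite in_itv/= => /andP[ax xb].
  rewrite /f; apply: cvgD; apply: cvgV; rewrite ?subr_eq0 ?gt_eqF//.
    by apply: cvgB; [exact: cvg_id|exact: cvg_cst].
  by apply: cvgB; [exact: cvg_cst|exact: cvg_id].
have [M [_ HM]] := compact_bounded (continuous_compact cf cA).
pose M' := `|M| + 1.
have M'0 : 0 < M' by rewrite ltr_wpDl.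
have fM x : A x -> f x <= M'.
  move=> Ax; apply: le_trans (ler_norm _) _; apply: (HM M'); last by exists x.
  by rewrite (le_lt_trans (ler_norm _))// ltrDl.
(* The 4 pays for the margin 3 r of the support and the transition layer r; the 7 gives 6 r < b - a,
   so that the support has nonempty interior. *)
pose r := Num.min (M'^-1 / 4) ((b - a) / 7).
have r0 : 0 < r by rewrite lt_min !divr_gt0 ?invr_gt0 ?subr_gt0.
have r1 : 4 * r <= M'^-1.
  have : r <= M'^-1 / 4 by rewrite ge_min lexx.
  by move: (M'^-1) => y; lra.
have r2 : 7 * r <= b - a.
  have : r <= (b - a) / 7 by rewrite ge_min lexx orbT.
  by lra.
exists r => //; split; first by lra.
move=> x Ax; have := AO x Ax; rewrite /= !in_itv/= => /andP[ax xb].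
have xa0 : 0 < x - a by rewrite subr_gt0.
have bx0 : 0 < b - x by rewrite subr_gt0.
have h1 : (x - a)^-1 <= M'.
  by apply: le_trans (fM x Ax); rewrite lerDl invr_ge0 ltW.
have h2 : (b - x)^-1 <= M'.
  by apply: le_trans (fM x Ax); rewrite lerDr invr_ge0 ltW.
have {}h1 : M'^-1 <= x - a by rewrite -[leRHS]invrK lef_pV2 ?posrE ?invr_gt0.
have {}h2 : M'^-1 <= b - x by rewrite -[leRHS]invrK lef_pV2 ?posrE ?invr_gt0.
by move: (M'^-1) r1 h1 h2 => y r1 h1 h2; apply/andP; split; lra.
Qed.

End carrier.

Unset Implicit Arguments.

Theorem theorem5p4 (R : realType) (s : side) :
  exists C : R -> R -> set R -> R,
  forall (a b alpha p : R), a < b -> 0 < alpha -> 1 <= p ->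
  forall Omega' : set R, compactly_contained Omega' `]a, b[ ->
  exists K : set R,
    [/\ compact K, K `<=` `]a, b[, 0 < C alpha p K &
      forall u : R -> R, fracSobolev s `]a, b[ alpha p u ->
      exists E : (R -> R) -> (R -> R),
        [/\ space_map `]a, b[ setT (fracSobolev s `]a, b[ alpha p)
              (fracSobolev s setT alpha p) E,
            E u = u %[ae lebesgue_measure in Omega'],
            ess_support (E u) `<=` K &
            fracSobolev_norm s setT alpha p (E u) <=
              C alpha p K * fracSobolev_norm s `]a, b[ alpha p u]].
Proof.
(* The constant may depend on [alpha], [p] and [K] alone, so it is required to work for every triple
   a, b, r with this carrier. By [carrier_inj] there is at most one, and [cutoff_bounded] provides a
   constant for it. *)
pose admissible (alpha p : R) (K : set R) : set R := [set c | 0 < c /\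
  forall a b r, 0 < r -> a + 3 * r < b - 3 * r -> K = carrier a b r ->
  forall u, fracSobolev s `]a, b[ alpha p u ->
    fracSobolev_norm s setT alpha p (cutoff a b r u) <=
    c * fracSobolev_norm s `]a, b[ alpha p u].
exists (fun alpha p K => xget 1 (admissible alpha p K)).
move=> a b alpha p ab alpha0 p1 Omega' [cO OO].
have [r r0 [abr Or]] := compact_margin ab cO OO.
have [c c0 Hc] := cutoff_bounded s a b alpha0 p1 r0.
have [C0 HC] : admissible alpha p (carrier a b r) (xget 1 (admissible alpha p (carrier a b r))).
  apply: (@xgetPex _ 1 (admissible alpha p (carrier a b r))).
  exists c; split => // a' b' r' r0' abr' /(carrier_inj r0 abr r0' abr')[<- <- <-] u Su.
  by have [] := Hc u Su.
exists (carrier a b r); split => //.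
- exact: compact_carrier.
- exact: carrier_sub.
(* The same operator serves every [u]. *)
move=> u Su; exists (cutoff a b r); split.
- split => [v Sv|v w _ _ vw]; first by have [] := Hc v Sv.
  apply: (ae_imp vw) => x {}vw _; rewrite /cutoff !patchE.
  by case: ifPn => // /set_mem /vw ->.
- apply: aeW => x Ox; have xr := Or x (subset_closure Ox).
  have xab := OO x (subset_closure Ox).
  by rewrite /cutoff /plateau bump_eq1// mul1r patchE ifT// inE.
- move=> x; apply: contra_notP => xK; exists (~` carrier a b r) => //=; split.
    rewrite openC; apply: compact_closed; [exact: order_hausdorff|exact: compact_carrier].
  apply: aeW => y yK; rewrite /cutoff /plateau bump_eq0 ?mul0r//.
  apply/negP => ycd; apply: yK; apply/carrierP; right.
  by move: ycd; rewrite in_itv/= => /andP[/ltW -> /ltW ->].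
- exact: HC.
Qed.
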